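(* Let $d\ge2$, $1\le p<d$ and $w\in\mathcal A_p(\mathbb R^d)$. The following two conditions are equivalent: (1) $\displaystyle\inf_{\ell(Q)=1}w(Q)>0$, where the infimum is over all cubes $Q\subset\mathbb R^d$ of edge length $1$. (2) For every $u\in\dot W^{1,p}(\mathbb R^d,w)$ there exists a unique constant $c$ such that for every sequence of cubes $Q_i\subset\mathbb R^d$ with $\liminf_{i\to\infty}\ell(Q_i)>0$ and $Q_i\to\infty$ it holds that $$\lim_{i\to\infty}\frac1{w(Q_i)}\int_{Q_i}u\,w\,dx=c.$$
   Context: Muckenhoupt weights: a non-negative $w\in L^1_{\mathrm{loc}}(\mathbb R^d)$ belongs to $\mathcal A_p(\mathbb R^d)$, $1<p<\infty$, if $w>0$ a.e. and there is $C\ge1$ such that for every ball $B$, $\left(\frac1{|B|}\int_B w\,dx\right)\left(\frac1{|B|}\int_B w^{-1/(p-1)}dx\right)^{p-1}\le C$; it belongs to $\mathcal A_1(\mathbb R^d)$ if $w>0$ a.e. and there is $C\ge1$ such that for every ball $B$, $\frac1{|B|}\int_B w\,dx\le C\,w(y)$ for a.e. $y\in B$. We write $w(A)=\int_Aw\,dx$. Sobolev space: $\dot W^{1,p}(\mathbb R^d,w)$ consists of the functions $u\in L^p_{\mathrm{loc}}(\mathbb R^d,w)$ (for $w\in\mathcal A_p$ these lie in $L^1_{\mathrm{loc}}(\mathbb R^d)$) whose distributional gradient satisfies $|\nabla u|\in L^p(\mathbb R^d,w)$. Every such $u$ is always taken to be its Lebesgue representative with respect to Lebesgue measure: $u(x)=\limsup_{r\to0}\frac1{|B(x,r)|}\int_{B(x,r)}u(y)\,dy$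 for every $x$. Cubes are closed with edges parallel to the coordinate axes and $\ell(Q)$ denotes the edge length of $Q$. For a sequence of cubes $(Q_i)_{i\in\mathbb N}$, $Q_i\to\infty$ means that for every $R>0$ there is $N\in\mathbb N$ such that $B(0,R)\cap Q_i=\emptyset$ for all $i\ge N$. *)

(* Defs.v *)
From HB Require Import structures.
From mathcomp Require Import all_boot all_order all_algebra.
From mathcomp Require Import all_classical all_reals all_analysis.
From mathcomp Require Import measurable_realfun.
Set Implicit Arguments.
Unset Strict Implicit.
Unset Printing Implicit Defensive.
Import Order.TTheory GRing.Theory Num.Theory.
Import numFieldNormedType.Exports.
Local Open Scope classical_set_scope.
Local Open Scope ring_scope.

(* Lebesgue measure on R^n is built in two steps: the n-fold product of the
   one-dimensional Lebesgue measure on the product sigma-algebra [borel_rV],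
   then its (Caratheodory) completion [leb], so that "measurable" below means
   Lebesgue measurable. *)
Section LebesgueMeasure_rV.
Variable R : realType.

Definition cylinders n : set (set 'rV[R]_n) :=
  [set A | exists (i : 'I_n) (B : set (measurableTypeR R)),
     measurable B /\ A = [set x : 'rV[R]_n | B (x ord0 i)]].

Definition borel_rV n : Type := 'rV[R]_n.
HB.instance Definition _ n := Pointed.on (borel_rV n).
HB.instance Definition _ n :=
  Measurable.copy (borel_rV n) (g_sigma_algebraType (cylinders (n := n))).

Definition rV_cons n (z : measurableTypeR R * borel_rV n) : borel_rV n.+1 :=
  \row_(i < n.+1) oapp (z.2 ord0) z.1 (unlift ord0 i).

Definition rV_uncons n (x : borel_rV n.+1) : measurableTypeR R * borel_rV n :=
  (x ord0 ord0, \row_(i < n) x ord0 (lift ord0 i)).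

Lemma rV_consK n : cancel (@rV_cons n) (@rV_uncons n).
Proof.
move=> [t x]; congr pair; first by rewrite mxE unlift_none.
by apply/rowP => i; rewrite !mxE liftK.
Qed.

Lemma measurable_coord n (i : 'I_n) :
  measurable_fun setT ((fun x => x ord0 i) : borel_rV n -> measurableTypeR R).
Proof.
move=> _ B mB; rewrite setTI; apply: sub_sigma_algebra.
by exists i, B.
Qed.

Lemma measurable_fun_coords d' (T : measurableType d') n (f : T -> borel_rV n) :
  (forall i, measurable_fun setT ((fun t => f t ord0 i) : T -> measurableTypeR R)) ->
  measurable_fun setT f.
Proof.
move=> mf.
apply: (@measurability _ _ _ _ setT f (cylinders (n := n))) => //.
move=> _ [_ [i [B [mB ->]] <-]].
exact: mf.
Qed.

Lemma measurable_rV_cons n : measurable_fun setT (@rV_cons n).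
Proof.
apply: measurable_fun_coords => i.
case: (unliftP ord0 i) => [j|] ->.
  rewrite (_ : (fun _ => _) = (fun x : borel_rV n => x ord0 j) \o snd).
    by apply: measurableT_comp => //; exact: measurable_coord.
  by apply/funext => z /=; rewrite mxE liftK.
rewrite (_ : (fun _ => _) = fst)//.
by apply/funext => z /=; rewrite mxE unlift_none.
Qed.

Lemma measurable_rV_uncons n : measurable_fun setT (@rV_uncons n).
Proof.
apply: measurable_fun_pair; first exact: measurable_coord.
apply: measurable_fun_coords => i /=.
under eq_fun do rewrite mxE.
exact: measurable_coord.
Qed.

Section lebesgue_rV_succ.
Local Open Scope ereal_scope.
Variables (n : nat) (mu : {sigma_finite_measure set (borel_rV n) -> \bar R}).

Definition lebesgue_rV_succ : set (borel_rV n.+1) -> \bar R :=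
  pushforward (lebesgue_measure \x mu) (@rV_cons n).

Let pushforward_cons :
  {measure set (measurableTypeR R * borel_rV n) -> \bar R} ->
  {measure set (borel_rV n.+1) -> \bar R} :=
  fun m => measure_function_pushforward__canonical__measure_function_Measure
    m (@measurable_rV_cons n).

Let succ0 : lebesgue_rV_succ set0 = 0.
Proof. exact: (measure0 (pushforward_cons (lebesgue_measure \x mu))). Qed.

Let succ_ge0 A : 0 <= lebesgue_rV_succ A.
Proof. exact: (measure_ge0 (pushforward_cons (lebesgue_measure \x mu))). Qed.

Let succ_sigma_additive : semi_sigma_additive lebesgue_rV_succ.
Proof.
exact: (@measure_semi_sigma_additive _ _ _
  (pushforward_cons (lebesgue_measure \x mu))).
Qed.

HB.instance Definition _ := isMeasure.Build _ _ _ lebesgue_rV_succ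
  succ0 succ_ge0 succ_sigma_additive.

Let succ_sigma_finite : sigma_finite setT lebesgue_rV_succ.
Proof.
have /sigma_finiteP[F [TF ndF Foo]] := sigma_finiteT (@lebesgue_measure R).
have /sigma_finiteP[G [TG ndG Goo]] := sigma_finiteT mu.
exists (fun k => @rV_uncons n @^-1` (F k `*` G k)).
  rewrite -preimage_bigcup -[LHS](preimage_setT (@rV_uncons n)); congr preimage.
  rewrite -setXTT TF TG predeqE => -[x y]; split.
    move=> [/= [i _ Fix] [j _ Gjy]]; exists (maxn i j) => //; split.
    - by move: x Fix; exact/subsetPset/ndF/leq_maxl.
    - by move: y Gjy; exact/subsetPset/ndG/leq_maxr.
  by move=> [k _ []/= ? ?]; split; exists k.
move=> k; have [mF Fk] := Foo k; have [mG Gk] := Goo k; split.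
  rewrite -[X in measurable X]setTI; apply: measurable_rV_uncons => //.
  exact: measurableX.
rewrite /lebesgue_rV_succ /pushforward -comp_preimage.
rewrite (_ : _ \o _ = id); last by apply/funext => z; exact: rV_consK.
by rewrite preimage_id product_measure1E// lte_mul_pinfty// ge0_fin_numE.
Qed.

HB.instance Definition _ := Measure_isSigmaFinite.Build _ _ _ lebesgue_rV_succ
  succ_sigma_finite.

End lebesgue_rV_succ.

Fixpoint lebesgue_rV n : {sigma_finite_measure set (borel_rV n) -> \bar R} :=
  if n is m.+1 then lebesgue_rV_succ (lebesgue_rV m)
  else dirac ((0 : 'rV[R]_0) : borel_rV 0).

End LebesgueMeasure_rV.

Section MuckenhouptSobolev.
Variables (R : realType) (d : nat).
Local Notation rV := 'rV[R]_d.

(* The type ['rV[R]_d] with the sigma-algebra of Lebesgue measurable sets. *)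
Definition lebesgue_space : Type := rV.
HB.instance Definition _ := Measurable.copy lebesgue_space
  (caratheodory_type ((lebesgue_rV R d)^*)%mu).

Definition leb : set lebesgue_space -> \bar R :=
  @completed_measure_extension _ _ _ (lebesgue_rV R d).
HB.instance Definition _ := Measure.on leb.

Let leb_sigma_finite : sigma_finite setT leb.
Proof.
exact/completed_measure_extension_sigma_finite/sigma_finiteT.
Qed.

HB.instance Definition _ := Measure_isSigmaFinite.Build _ _ _ leb
  leb_sigma_finite.

(* The norm of ['rV[R]_d] in the library is the sup norm. *)
Definition enorm (x : rV) : R := Num.sqrt (\sum_(i < d) x ord0 i ^+ 2).
Definition eball (x : rV) (r : R) : set rV := [set y | enorm (y - x) < r].

Definition avg (u : rV -> \bar R) (A : set rV) : \bar R :=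
  (\int[leb]_(x in A) u x / leb A)%E.

Definition loc_integrable (f : rV -> R) : Prop :=
  measurable_fun [set: lebesgue_space] f /\
  forall K : set rV, compact K -> (\int[leb]_(x in K) `|f x|%:E < +oo)%E.

Definition muckenhoupt (p : R) (w : rV -> R) : Prop :=
  [/\ forall x, 0 <= w x,
      loc_integrable w,
      (\forall x \ae leb, 0 < w x) &
      exists2 C : R, 1 <= C & forall (z : rV) (r : R), 0 < r ->
        let B := eball z r in
        if p == 1 then
          \forall y \ae leb, B y -> (avg (EFin \o w) B <= C%:E * (w y)%:E)%E
        else
          (avg (EFin \o w) B *
           avg (fun x => (w x `^ (- (p - 1)^-1))%:E) B `^ (p - 1) <= C%:E)%E].

Definition wmeas (w : rV -> R) (A : set rV) : \bar R :=
  (\int[leb]_(x in A) (w x)%:E)%E.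

Definition wavg (w : rV -> R) (u : rV -> \bar R) (A : set rV) : \bar R :=
  (\int[leb]_(x in A) (u x * (w x)%:E) / wmeas w A)%E.

Definition Lp_loc (p : R) (w : rV -> R) (u : rV -> \bar R) : Prop :=
  measurable_fun [set: lebesgue_space] (u : lebesgue_space -> \bar R) /\
  forall K : set rV, compact K ->
    (\int[leb]_(x in K) (`|u x| `^ p * (w x)%:E) < +oo)%E.

Definition partial (i : 'I_d) (f : rV -> R) : rV -> R :=
  fun x => 'D_(delta_mx ord0 i) f x.

Definition smooth (f : rV -> R) : Prop :=
  forall (s : seq 'I_d), continuous (foldr partial f s) /\
    forall (i : 'I_d) (x : rV), derivable (foldr partial f s) x (delta_mx ord0 i).

Definition test_function (f : rV -> R) : Prop :=
  smooth f /\ compact (closure [set x | f x != 0]).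

Definition weak_gradient (u : rV -> \bar R) (g : 'I_d -> rV -> R) : Prop :=
  forall i, loc_integrable (g i) /\
    forall phi, test_function phi ->
      (\int[leb]_x (u x * (partial i phi x)%:E) =
       - \int[leb]_x (g i x * phi x)%:E)%E.

(* Members of the Sobolev space are extended-real-valued since the limsup
   defining the Lebesgue representative may be infinite on a null set. *)
Definition lebesgue_representative (u : rV -> \bar R) : Prop :=
  forall x, u x = limf_esup (fun r : R => avg u (eball x r)) 0^'+.

Definition homogeneous_sobolev (p : R) (w : rV -> R) (u : rV -> \bar R) : Prop :=
  [/\ Lp_loc p w u,
      lebesgue_representative u &
      exists2 g : 'I_d -> rV -> R, weak_gradient u g &
        (\int[leb]_x
           ((Num.sqrt (\sum_(i < d) g i x ^+ 2) `^ p) * w x)%:E < +oo)%E].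

Record cube := Cube { corner : rV; edge : R; edge_gt0 : 0 < edge }.

Definition cube_set (Q : cube) : set rV :=
  [set x | forall i, corner Q ord0 i <= x ord0 i <= corner Q ord0 i + edge Q].

Definition cubes_to_infty (Q : nat -> cube) : Prop :=
  forall r : R, 0 < r -> exists N : nat, forall i : nat, (N <= i)%N ->
    eball 0 r `&` cube_set (Q i) = set0.

End MuckenhouptSobolev.

(* Main.v *)
Require Import Defs.
From HB Require Import structures.
From mathcomp Require Import all_boot all_order all_algebra.
From mathcomp Require Import all_classical all_reals all_analysis.
From mathcomp Require Import measurable_realfun.
From mathcomp Require Import ring lra.
Set Implicit Arguments.
Unset Strict Implicit.
Unset Printing Implicit Defensive.
Import Order.TTheory GRing.Theory Num.Theory.
Import numFieldNormedType.Exports.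
Local Open Scope classical_set_scope.
Local Open Scope ring_scope.

(** Notation for this overview: Q is a cube of edge l, u_Q the mean of u over Q for
    Lebesgue measure, w(Q) the integral of w over Q, and E(Q) the energy of u on Q,
    that is the integral of |grad u|^p w over Q.

    The weight enters through one inequality ([muckenhoupt_qbox]): for f >= 0 and
    lam > 0, the product of w(Q) with the integral of f over Q is at most |Q| times
    the integral over Q of lam w + K lam^(1-p) f^p w. For p > 1 it follows from the
    A_p condition and Young's inequality, for p = 1 directly from the A_1 condition.
    With f = |grad u| and lam^p = E(Q) / w(Q) it bounds the mean of |grad u| over Q
    by (1 + K) lam. With f the indicator of a smaller cube it shows that w is
    doubling ([wmass_doubling]).

    Testing the weak gradient against products of one-dimensional bumps shows that
    the means of u over two nested cubes of comparable edges differ by at most a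
    multiple of the edge times the mean of |grad u| ([mean_sub]). Summed over the
    dyadic subcubes of Q, with the inequality above used on each of them, this
    becomes a weighted Poincare inequality ([cube_poincare]): the w-average of
    |u - u_Q| over Q is at most C l (E(Q) / w(Q))^(1/p).

    Assume that the infimum over unit cubes is positive. Then w(Q) >= c l^d as soon
    as l is bounded below ([wmass_growth]), and both the gap between u_Q and the
    w-average of u over Q, and the gap between u_Q and the mean over the cube of
    doubled edge, are at most C l^(1-d/p) times the p-th root of the energy on that
    doubled cube. As p < d, the means over the cubes of edge 2^k l converge
    geometrically. Their limit depends neither on
    Q nor on l, since any two cubes lie in a third one of comparable edge. The
    average over Q is close to this limit when l is large, because of the negative
    power, and also when l is bounded but Q is far away, because then E is small on
    the first doublings of Q and the last of them is large ([limit_average]).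

    Conversely, assume that the infimum is 0. By doubling, unit cubes near the
    origin have mass bounded below, so there are unit cubes Q_k that tend to
    infinity with w(Q_k) as small as desired. The sum over k of k times a bump
    around Q_k is smooth, has finite energy if the Q_k are light enough, and its
    average over Q_k is at least a constant times k: there is no finite limit
    ([staircase_no_limit]). *)

(** * Lebesgue measure of boxes *)

Lemma le_of_eq disp (X : porderType disp) (x y : X) : x = y -> (x <= y)%O.
Proof. by move->. Qed.

Definition product_set (R : realType) n (B : 'I_n -> set R) : set 'rV[R]_n :=
  [set x | forall i, B i (x ord0 i)].

Section measure.
Variable R : realType.

Lemma borel_product_set n (B : 'I_n -> set (measurableTypeR R)) :
  (forall i, measurable (B i)) ->
  measurable (product_set B : set (borel_rV R n)).
Proof.
move=> mB; rewrite (_ : product_set B =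
  \bigcap_(i in [set: 'I_n]) ((fun x : borel_rV R n => x ord0 i) @^-1` B i)).
  apply: fin_bigcap_measurable => [|i _]; first exact: finite_finset.
   rewrite -[X in measurable X]setTI.
  by apply: measurable_coord.
by apply/seteqP; split => x Bx i => [_|]; exact: (Bx i).
Qed.

Lemma lebesgue_rV_product_set n (B : 'I_n -> set (measurableTypeR R)) :
  (forall i, measurable (B i)) ->
  lebesgue_rV R n (product_set B) = (\prod_(i < n) lebesgue_measure (B i))%E.
Proof.
elim: n B => [|n IH] B mB.
  rewrite big_ord0 /=.
  rewrite (_ : product_set B = setT) ?diracT//.
  by apply/seteqP; split => // x _ [].
rewrite big_ord_recl /= -IH//.
rewrite /lebesgue_rV_succ /pushforward.
rewrite (_ : _ @^-1` _ = B ord0 `*` product_set (fun i => B (lift ord0 i))).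
  rewrite product_measure1E//.
  exact: (borel_product_set (B := fun i => B (lift ord0 i))).
apply/seteqP; split => -[t x] /=.
  move=> H; split; first by have := H ord0; rewrite mxE unlift_none.
  by move=> i; have := H (lift ord0 i); rewrite mxE liftK.
move=> [Bt Bx] i; case: (unliftP ord0 i) => [j|] ->.
  by rewrite mxE liftK; exact: Bx.
by rewrite mxE unlift_none.
Qed.

Variable d : nat.
Local Notation T := (lebesgue_space R d).
Local Notation mu := (@leb R d).

Lemma borel_lebesgue (A : set (borel_rV R d)) :
  measurable A -> measurable (A : set T).
Proof. by move=> mA; apply: sub_caratheodory; exact: sub_sigma_algebra. Qed.

Lemma leb_borel (A : set (borel_rV R d)) :
  measurable A -> mu A = lebesgue_rV R d A.
Proof. exact: measurable_mu_extE. Qed.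

Lemma lebesgue_product_set (B : 'I_d -> set (measurableTypeR R)) :
  (forall i, measurable (B i)) -> measurable (product_set B : set T).
Proof. by move=> mB; apply: borel_lebesgue; exact: borel_product_set. Qed.

Lemma leb_product_set (B : 'I_d -> set (measurableTypeR R)) :
  (forall i, measurable (B i)) ->
  mu (product_set B) = (\prod_(i < d) lebesgue_measure (B i))%E.
Proof.
by move=> mB; rewrite leb_borel ?lebesgue_rV_product_set//; exact: borel_product_set.
Qed.

Lemma measurable_to_borel :
  measurable_fun [set: T] (id : T -> borel_rV R d).
Proof. by move=> _ A mA; rewrite setTI; exact: borel_lebesgue. Qed.

Lemma borel_measurable_fun d' (Y : measurableType d') (f : borel_rV R d -> Y) :
  measurable_fun [set: borel_rV R d] f -> measurable_fun [set: T] (f : T -> Y).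
Proof. by move=> mf; exact: (measurableT_comp mf measurable_to_borel). Qed.

Lemma measurable_coordinate (i : 'I_d) :
  measurable_fun [set: T] ((fun x => x ord0 i) : T -> measurableTypeR R).
Proof. by apply: borel_measurable_fun; exact: measurable_coord. Qed.

Definition box (a b : 'rV[R]_d) : set 'rV[R]_d :=
  [set x | forall i, a ord0 i <= x ord0 i < b ord0 i].

Lemma box_product_set a b :
  box a b = product_set (fun i => [set` `[a ord0 i, b ord0 i[]).
Proof. by apply/seteqP; split => x H i; have := H i; rewrite /= in_itv. Qed.

Lemma borel_box a b : measurable (box a b : set (borel_rV R d)).
Proof. by rewrite box_product_set; apply: borel_product_set => i; exact: measurable_itv. Qed.

Lemma measurable_box a b : measurable (box a b : set T).
Proof. by apply: borel_lebesgue; exact: borel_box. Qed.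

Lemma leb_box (a b : 'rV[R]_d) : (forall i, a ord0 i <= b ord0 i) ->
  mu (box a b) = (\prod_(i < d) (b ord0 i - a ord0 i))%:E.
Proof.
move=> ab; rewrite box_product_set leb_product_set//.
rewrite -prodEFin; apply: eq_bigr => i _.
rewrite lebesgue_measure_itv/= lte_fin; case: ltgtP (ab i) => // abi _.
by rewrite abi subrr.
Qed.

(** A countable union, since the cubes have rational centre and radius. *)
Lemma open_rV_bigcup (O : set 'rV[R]_d) : open O ->
  O = \bigcup_(q in [set q : 'rV[rat]_d * rat |
         box (\row_i (ratr (q.1 ord0 i) - ratr q.2)) (\row_i (ratr (q.1 ord0 i) + ratr q.2)) `<=` O])
        box (\row_i (ratr (q.1 ord0 i) - ratr q.2)) (\row_i (ratr (q.1 ord0 i) + ratr q.2)).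
Proof.
move=> oO; apply/seteqP; split => [x Ox|x [q Oq xq]]; last exact: Oq.
have /nbhs_ballP[e /= e0 xeO] : nbhs x O by exact: open_nbhs_nbhs.
have e40 : 0 < e / 4 by lra.
have [r /andP[r0 re]] : exists r : rat, (0 < ratr r :> R) && (ratr r < e / 4).
  by have [r] := rat_in_itvoo e40; rewrite in_itv/= => H; exists r.
have [q Hq] : exists q : 'I_d -> rat, forall i, x ord0 i - ratr r < ratr (q i) < x ord0 i + ratr r.
  suff /choice[f Hf] : forall i, exists q : rat,
      x ord0 i - ratr r < ratr q < x ord0 i + ratr r by exists f.
  move=> i; have h : x ord0 i - ratr r < x ord0 i + ratr r by lra.
  by have [s] := rat_in_itvoo h; rewrite in_itv/= => H; exists s.
exists (\row_i q i, r) => /=; last first.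
  by move=> i; rewrite !mxE; have := Hq i; lra.
move=> y yq; apply: xeO; split => // i j; rewrite /ball/= (ord1 i).
 have := Hq j; have := yq j; rewrite !mxE => h1 h2.
rewrite ltr_norml; lra.
Qed.

Lemma borel_open (O : set 'rV[R]_d) : open O -> measurable (O : set (borel_rV R d)).
Proof.
move=> /open_rV_bigcup ->; rewrite bigcup_mkcond.
apply: countable_bigcupT_measurable; first exact: countableP.
by move=> q; case: ifP => // _; exact: borel_box.
Qed.

Lemma borel_continuous (f : 'rV[R]_d -> R) : continuous f ->
  measurable_fun [set: borel_rV R d] (f : borel_rV R d -> measurableTypeR R).
Proof.
move=> cf; apply: (measurability _ (RGenOpens.measurableE R)).
move=> _ [_ [a [b ->] <-]]; rewrite setTI; apply: borel_open.
move/continuousP : cf; apply; exact: interval_open.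
Qed.

Lemma measurable_open (O : set 'rV[R]_d) : open O -> measurable (O : set T).
Proof. by move=> oO; apply: borel_lebesgue; exact: borel_open. Qed.

Lemma measurable_compact (K : set 'rV[R]_d) : compact K -> measurable (K : set T).
Proof.
move=> cK; rewrite -[K]setCK; apply: measurableC; apply: measurable_open.
by rewrite openC; apply: compact_closed => //; exact: norm_hausdorff.
Qed.

Lemma measurable_continuous (f : 'rV[R]_d -> R) : continuous f ->
  measurable_fun [set: T] (f : T -> measurableTypeR R).
Proof. by move=> cf; apply: borel_measurable_fun; exact: borel_continuous. Qed.

Lemma leb_hyperplane (i : 'I_d) (t : R) : mu [set x : 'rV[R]_d | x ord0 i = t] = 0%E.
Proof.
pose B j : set (measurableTypeR R) := if j == i then [set t] else setT.
transitivity (mu (product_set B)); last first.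
  rewrite leb_product_set; last by move=> j; rewrite /B; case: ifP.
  by rewrite (bigD1 i)//= {1}/B eqxx lebesgue_measure_set1 mul0e.
congr (mu _).
apply/seteqP; split => x /=.
  by move=> xt j; rewrite /B; case: eqVneq => [->|].
by move=> /(_ i); rewrite /B eqxx.
Qed.

(** The half-open boxes are stable under intersection and generate the Borel sets,
    so that a measure is determined by its values on them. *)
Definition boxes : set (set 'rV[R]_d) := [set box ab.1 ab.2 | ab in setT].

Lemma borel_boxes : @measurable _ (borel_rV R d) = <<s boxes >>.
Proof.
apply/seteqP; split; last first.
  by apply: smallest_sub; [exact: sigma_algebra_measurable|move=> _ [ab _ <-]; exact: borel_box].
apply: smallest_sub; first exact: smallest_sigma_algebra.
move=> _ [i [B [mB ->]]].
pose f : g_sigma_algebraType boxes -> measurableTypeR R := fun x => x ord0 i.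
suff mf : measurable_fun setT f by have := mf measurableT B mB; rewrite setTI.
apply: (measurability _ (RGenCInfty.measurableE R)).
move=> _ [_ [t ->] <-]; rewrite setTI.
rewrite (_ : _ @^-1` _ = \bigcup_(n : nat)
    box (\row_j if j == i then t else - n%:R) (\row_j n%:R)).
  by apply: bigcupT_measurable => n; apply: sub_sigma_algebra; exists (\row_j (if j == i then t else - n%:R), \row_j n%:R).
apply/seteqP; split => x /=.
  rewrite /f in_itv/= andbT => tx; exists (Num.truncn (`|x|)).+1 => //= j.
  have xj : `|x ord0 j| < (Num.truncn `|x|).+1%:R.
    rewrite (le_lt_trans _ (truncnS_gt _))// [leRHS]mx_normrE.
    by apply: (le_trans _ (le_bigmax _ _ (ord0, j))).
  rewrite !mxE; case: eqVneq xj => [->|_] xj.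
    by rewrite tx/=; move: xj; rewrite ltr_norml => /andP[].
  by move: xj; rewrite ltr_norml => /andP[/ltW -> ->].
move=> [n _ /(_ i)]; rewrite !mxE eqxx /f in_itv/= andbT; lra.
Qed.

Lemma box_setI (a b a' b' : 'rV[R]_d) : box a b `&` box a' b' =
  box (\row_i Num.max (a ord0 i) (a' ord0 i)) (\row_i Num.min (b ord0 i) (b' ord0 i)).
Proof.
apply/seteqP; split => x.
  move=> [xab xab'] i; rewrite !mxE ge_max lt_min.
  by have /andP[-> ->] := xab i; have /andP[-> ->] := xab' i.
by move=> H; split => i; have := H i; rewrite !mxE ge_max lt_min;
  move=> /andP[/andP[? ?] /andP[? ?]]; apply/andP.
Qed.

Lemma boxes_setI : setI_closed boxes.
Proof.
move=> _ _ [[a b] _ <-] [[a' b'] _ <-] /=; rewrite box_setI.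
by exists (\row_i Num.max (a ord0 i) (a' ord0 i), \row_i Num.min (b ord0 i) (b' ord0 i)).
Qed.

Lemma bigcup_boxes : \bigcup_(n : nat) box (\row__ - n%:R) (\row__ n%:R) = [set: 'rV[R]_d].
Proof.
apply/seteqP; split => // x _; exists (Num.truncn (`|x|)).+1 => //= j.
have xj : `|x ord0 j| < (Num.truncn `|x|).+1%:R.
  rewrite (le_lt_trans _ (truncnS_gt _))// [leRHS]mx_normrE.
  by apply: (le_trans _ (le_bigmax _ _ (ord0, j))).
by rewrite !mxE; move: xj; rewrite ltr_norml => /andP[/ltW -> ->].
Qed.

Lemma measurable_translation (c : 'rV[R]_d) :
  measurable_fun setT ((fun x => x + c) : borel_rV R d -> borel_rV R d).
Proof.
apply: measurable_fun_coords => i; under eq_fun do rewrite mxE.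
by apply: measurable_funD => //; exact: measurable_coord.
Qed.

Lemma lebesgue_rV_translation (c : 'rV[R]_d) (A : set (borel_rV R d)) : measurable A ->
  lebesgue_rV R d ((fun x => x + c) @^-1` A) = lebesgue_rV R d A.
Proof.
move=> mA.
pose m1 : {measure set (borel_rV R d) -> \bar R} :=
  measure_function_pushforward__canonical__measure_function_Measure
    (lebesgue_rV R d) (measurable_translation c).
rewrite -[LHS]/(m1 A).
apply: (@measure_unique _ R (borel_rV R d) boxes
  (fun n => box (\row__ - n%:R) (\row__ n%:R))
  borel_boxes boxes_setI _ bigcup_boxes m1 (lebesgue_rV R d)) => //.
- by move=> n; exists (\row__ - n%:R, \row__ n%:R).
- move=> _ [[a b] _ <-] /=; rewrite /pushforward.
  rewrite (_ : _ @^-1` _ = box (a - c) (b - c)); last first.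
    apply/seteqP; split => x H i; have := H i; rewrite !mxE; lra.
  rewrite !box_product_set !lebesgue_rV_product_set//.
  apply: eq_bigr => i _; rewrite !lebesgue_measure_itv/= !lte_fin !mxE ltrD2r.
  by case: ifP => // _; rewrite -!EFinD; congr (_%:E); lra.
- move=> n; rewrite -ge0_fin_numE; last exact: measure_ge0.
  rewrite /= /pushforward.
  rewrite (_ : _ @^-1` _ = box (\row_i (- n%:R - c ord0 i)) (\row_i (n%:R - c ord0 i))); last first.
    apply/seteqP; split => x H i; have := H i; rewrite !mxE; lra.
  rewrite box_product_set lebesgue_rV_product_set//.
  rewrite (eq_bigr (fun=> (n%:R - - n%:R)%:E)) ?prodEFin// => i _.
  rewrite lebesgue_measure_itv/= !mxE lte_fin; case: ifPn => [_|].
    by rewrite -EFinD; congr (_%:E); lra.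
  rewrite -leNgt => h; congr (_%:E); have : 0 <= n%:R :> R by []. lra.
Qed.

(** The completed measure and the product measure agree on Borel sets; the
    integral of a Borel function can thus be computed with the latter, for which
    uniqueness of measures yields invariance under translation. *)
Lemma ge0_integral_leb_borel (f : borel_rV R d -> \bar R) :
  measurable_fun setT f -> (forall x, 0 <= f x)%E ->
  (\int[mu]_x f x = \int[lebesgue_rV R d]_x f x)%E.
Proof.
move=> mf f0; transitivity (\int[pushforward mu (id : T -> borel_rV R d)]_x f x)%E.
  apply/esym; rewrite (ge0_integral_pushforward measurable_to_borel _ measurableT mf); last by move=> x _; exact: f0.
  by [].
apply: eq_measure_integral => [|mm A mA _]; first exact: measurable_to_borel.
exact: (leb_borel mA).
Qed.

Lemma ge0_integral_translation (c : 'rV[R]_d) (f : borel_rV R d -> \bar R) :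
  measurable_fun setT f -> (forall x, 0 <= f x)%E ->
  (\int[mu]_x f (x + c)%R = \int[mu]_x f x)%E.
Proof.
move=> mf f0; have mc := measurable_translation c.
rewrite (ge0_integral_leb_borel (f := fun x => f (x + c))); last 2 first.
- exact: (measurableT_comp mf mc).
- by move=> x; exact: f0.
rewrite (ge0_integral_leb_borel mf f0).
pose t : borel_rV R d -> borel_rV R d := +%R^~ c.
transitivity (\int[pushforward (lebesgue_rV R d) t]_x f x)%E.
  apply/esym; rewrite (ge0_integral_pushforward mc _ measurableT mf); last by move=> x _; exact: f0.
  by [].
apply: eq_measure_integral => A mA _.
exact: (lebesgue_rV_translation _ mA).
Qed.

Lemma integral_translation (c : 'rV[R]_d) (f : borel_rV R d -> \bar R) :
  measurable_fun setT f ->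
  (\int[mu]_x f (x + c)%R = \int[mu]_x f x)%E.
Proof.
move=> mf; rewrite [LHS]integralE [RHS]integralE; congr (_ - _)%E.
  rewrite -(ge0_integral_translation c (measurable_funepos mf) (funepos_ge0 _)).
  by apply: eq_integral => x _; rewrite !funeposE.
rewrite -(ge0_integral_translation c (measurable_funeneg mf) (funeneg_ge0 _)).
by apply: eq_integral => x _; rewrite !funenegE.
Qed.

(** Half-open boxes tile, open boxes are limits of bumps and closed boxes are
    compact. They differ by their faces, which are null, so that an integral does
    not see the difference. *)
Definition faces (a b : 'rV[R]_d) : set 'rV[R]_d :=
  \bigcup_(i in [set: 'I_d]) ([set x | x ord0 i = a ord0 i] `|` [set x | x ord0 i = b ord0 i]).

Lemma measurable_hyperplane (i : 'I_d) (t : R) :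
  measurable ([set x : 'rV[R]_d | x ord0 i = t] : set T).
Proof. by have := measurable_coordinate i measurableT (measurable_set1 t); rewrite setTI. Qed.

Lemma measurable_faces (a b : 'rV[R]_d) : measurable (faces a b : set T).
Proof.
apply: fin_bigcup_measurable => [|i _]; first exact: finite_finset.
by apply: measurableU; exact: measurable_hyperplane.
Qed.

Lemma leb_faces (a b : 'rV[R]_d) : mu (faces a b) = 0%E.
Proof.
pose P (A : set 'rV[R]_d) := measurable (A : set T) /\ mu A = 0%E.
have PU (A B : set 'rV[R]_d) : P A -> P B -> P (A `|` B).
  move=> [mA A0] [mB B0]; split; first exact: measurableU.
  by rewrite null_set_setU.
pose F (s : seq 'I_d) : set 'rV[R]_d :=
  [set x | exists2 i, i \in s & x ord0 i = a ord0 i \/ x ord0 i = b ord0 i].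
suff FP s : P (F s).
  have [_ <-] := FP (enum 'I_d); congr (mu _); apply/seteqP; split => x [i].
    by move=> _ H; exists i => //; rewrite mem_enum.
  by move=> _ H; exists i.
elim: s => [|i s IH].
  have -> : F [::] = set0 by apply/seteqP; split => // x [].
  by split; [exact: (@measurable0 _ T)|exact: (measure0 mu)].
have -> : F (i :: s) = ([set x : 'rV[R]_d | x ord0 i = a ord0 i] `|` [set x | x ord0 i = b ord0 i]) `|` F s.
  apply/seteqP; split => x.
    by move=> [j]; rewrite inE => /predU1P[->|js] H; [left|right; exists j].
  move=> [H|[j js H]]; first by exists i; rewrite ?mem_head.
  by exists j => //; rewrite inE js orbT.
apply: (PU _ _ _ IH); apply: PU; split; try exact: measurable_hyperplane; exact: leb_hyperplane.
Qed.

Definition open_box (a b : 'rV[R]_d) : set 'rV[R]_d :=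
  [set x | forall i, a ord0 i < x ord0 i < b ord0 i].

Definition closed_box (a b : 'rV[R]_d) : set 'rV[R]_d :=
  [set x | forall i, a ord0 i <= x ord0 i <= b ord0 i].

Lemma box_faces (a b : 'rV[R]_d) : box a b `\` faces a b = open_box a b.
Proof.
apply/seteqP; split => x.
  move=> [xab nx] i; have /andP[aix ->] := xab i; rewrite andbT lt_neqAle aix andbT.
  by apply/eqP => ax; apply: nx; exists i => //; left; rewrite /= ax.
move=> H; split; first by move=> i; have /andP[/ltW -> ->] := H i.
move=> [i _ [] /= xi]; have := H i; rewrite xi ltxx ?andbF//.
Qed.

Lemma closed_box_faces (a b : 'rV[R]_d) : closed_box a b `\` faces a b = open_box a b.
Proof.
apply/seteqP; split => x.
  move=> [xab nx] i; have /andP[aix xbi] := xab i; rewrite !lt_neqAle aix xbi !andbT.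
  apply/andP; split; apply/eqP => ax; apply: nx; exists i => //.
    by left; rewrite /= ax.
  by right; rewrite /= ax.
move=> H; split; first by move=> i; have /andP[/ltW -> /ltW ->] := H i.
move=> [i _ [] /= xi]; have := H i; rewrite xi ltxx ?andbF//.
Qed.

Lemma measurable_closed_box a b : measurable (closed_box a b : set T).
Proof.
rewrite (_ : closed_box a b = product_set (fun i => [set` `[a ord0 i, b ord0 i]])).
  by apply: lebesgue_product_set => i; exact: measurable_itv.
by apply/seteqP; split => x H i; have := H i; rewrite /= in_itv.
Qed.

Lemma measurable_open_box a b : measurable (open_box a b : set T).
Proof.
rewrite -box_faces; apply: measurableD; [exact: measurable_box|exact: measurable_faces].
Qed.

Lemma integral_negligible_setD (D N : set T) (f : T -> \bar R) :
  measurable D -> measurable N -> measurable_fun D f -> mu N = 0%E ->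
  (\int[mu]_(x in D) f x = \int[mu]_(x in D `\` N) f x)%E.
Proof.
move=> mD mN mf N0; rewrite [LHS]integralE [RHS]integralE; congr (_ - _)%E.
  exact: ge0_negligible_integral mN mD (measurable_funepos mf) (fun x _ => funepos_ge0 f x) N0.
exact: ge0_negligible_integral mN mD (measurable_funeneg mf) (fun x _ => funeneg_ge0 f x) N0.
Qed.

Lemma integral_box_open_box (a b : 'rV[R]_d) (f : 'rV[R]_d -> \bar R) :
  measurable_fun [set: T] (f : T -> _) ->
  (\int[mu]_(x in box a b) f x = \int[mu]_(x in open_box a b) f x)%E.
Proof.
move=> mf; rewrite -box_faces; apply: integral_negligible_setD.
- exact: measurable_box.
- exact: measurable_faces.
- exact: measurable_funS mf.
- exact: leb_faces.
Qed.

Lemma integral_closed_box (a b : 'rV[R]_d) (f : 'rV[R]_d -> \bar R) :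
  measurable_fun [set: T] (f : T -> _) ->
  (\int[mu]_(x in closed_box a b) f x = \int[mu]_(x in box a b) f x)%E.
Proof.
move=> mf; rewrite (integral_box_open_box a b mf) -closed_box_faces; apply: integral_negligible_setD.
- exact: measurable_closed_box.
- exact: measurable_faces.
- exact: measurable_funS mf.
- exact: leb_faces.
Qed.

(** The outer measure gives Borel covers of measure at most [mu A + 1 / (n + 1)];
    their intersection is as required. *)
Lemma borel_hull (A : set T) : (mu A < +oo)%E ->
  exists B : set (borel_rV R d), [/\ measurable B, A `<=` B & mu B = mu A].
Proof.
move=> Aoo.
have Afin : mu A \is a fin_num by rewrite ge0_fin_numE// mu_ext_ge0.
have /choice[B HB] : forall n : nat, exists B : set (borel_rV R d),
    [/\ measurable B, A `<=` B & (lebesgue_rV R d B <= mu A + (n.+1%:R^-1)%:E)%E].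
  move=> n; have n0 : 0 < n.+1%:R^-1 :> R by rewrite invr_gt0.
  have /(lb_ereal_inf_adherent n0)[_ [F [mF AF] <-] Flt] := Afin.
  exists (\bigcup_k F k); split => //; first exact: bigcup_measurable.
  apply: le_trans (ltW Flt).
  by apply: measure_sigma_subadditive => //; exact: bigcup_measurable.
exists (\bigcap_n B n).
have mB : measurable (\bigcap_n B n : set (borel_rV R d)).
  by apply: bigcapT_measurable => n; have [] := HB n.
have AB : A `<=` \bigcap_n B n by move=> x Ax n _; have [_ + _] := HB n; exact.
split => //; apply/eqP; rewrite eq_le; apply/andP; split; last exact: le_mu_ext.
apply/lee_addgt0Pr => e e0; rewrite leb_borel//.
have [n ne] : exists n : nat, n.+1%:R^-1 < e.
  exists (Num.truncn e^-1); rewrite invf_plt ?posrE//.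
  exact: truncnS_gt.
have [mBn _ Bn] := HB n; apply: (@le_trans _ _ (lebesgue_rV R d (B n))); last first.
  apply: (le_trans Bn).
  by rewrite leeD2l// lee_fin ltW.
apply: le_measure; rewrite ?inE//; exact: bigcap_inf.
Qed.

End measure.

(** * Smooth bumps on the line *)

Section smooth1.
Variable R : realType.
Implicit Types (f g : R -> R) (x : R).

Lemma is_derive_change f x (a b : R) : is_derive x 1 f a -> a = b -> is_derive x 1 f b.
Proof. by move=> ? <-. Qed.

Definition derivation_closed (S : set (R -> R)) :=
  forall f, S f -> exists2 f', S f' & forall x, is_derive x 1 f (f' x).

(** Coinductive form of having derivatives of every order: a class of functions
    stable under derivation is a witness that does not name the n-th derivative. *)
Definition smooth1 f := exists2 S, derivation_closed S & S f.

Lemma smooth1_derive f : smooth1 f ->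
  exists2 f', smooth1 f' & forall x, is_derive x 1 f (f' x).
Proof. by move=> [S SS /[dup] Sf /SS[f' Sf' ff']]; exists f' => //; exists S. Qed.

Lemma smooth1_primitive f f' : (forall x, is_derive x 1 f (f' x)) -> smooth1 f' ->
  smooth1 f.
Proof.
move=> ff' [S SS Sf']; exists (S `|` [set f]); last by right.
move=> g [/SS[g' Sg' gg']|->]; first by exists g' => //; left.
by exists f' => //; left.
Qed.

Lemma smooth1_continuous f : smooth1 f -> continuous f.
Proof.
move=> /smooth1_derive[f' _ ff'] x.
by apply/differentiable_continuous/derivable1_diffP; apply: (@ex_derive _ _ _ _ _ _ _ (ff' x)).
Qed.

Lemma smooth1_cst c : smooth1 (fun=> c).
Proof.
exists [set f | exists c, f = fun=> c]; last by exists c.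
move=> _ [k ->]; exists (fun=> 0); first by exists 0.
by move=> x; exact: is_derive_cst.
Qed.

Inductive alg_closure (S : set (R -> R)) : set (R -> R) :=
| alg_base f : S f -> alg_closure S f
| alg_add f g : alg_closure S f -> alg_closure S g -> alg_closure S (f \+ g)
| alg_mul f g : alg_closure S f -> alg_closure S g -> alg_closure S (f \* g).

(** By the Leibniz rule, the algebra generated by smooth functions is stable
    under derivation. *)
Lemma smooth1_alg_closure f : alg_closure smooth1 f -> smooth1 f.
Proof.
move=> Af; exists (alg_closure smooth1) => // {Af f} f; elim=> {f}[f|f g Af [f' Af' ff'] Ag [g' Ag' gg']|f g Af [f' Af' ff'] Ag [g' Ag' gg']].
- by move=> /smooth1_derive[f' sf' ff']; exists f' => //; exact: alg_base.
- exists (f' \+ g'); first exact: alg_add.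
  by move=> x; exact: is_deriveD.
- exists ((f \* g') \+ (g \* f')); first by apply: alg_add; exact: alg_mul.
  by move=> x; exact: is_deriveM.
Qed.

Lemma smooth1D f g : smooth1 f -> smooth1 g -> smooth1 (f \+ g).
Proof.
by move=> sf sg; apply: smooth1_alg_closure; apply: alg_add; exact: alg_base.
Qed.

Lemma smooth1M f g : smooth1 f -> smooth1 g -> smooth1 (f \* g).
Proof.
by move=> sf sg; apply: smooth1_alg_closure; apply: alg_mul; exact: alg_base.
Qed.

Lemma smooth1_affine f (k c : R) : smooth1 f -> smooth1 (fun x => f (k * x + c)).
Proof.
move=> [S SS Sf]; exists [set g | exists2 h, S h & exists m, g = fun x => m * h (k * x + c)]; last first.
  by exists f => //; exists 1; apply/funext => x; rewrite mul1r.
move=> _ [h Sh [m ->]]; have [h' Sh' hh'] := SS _ Sh.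
exists (fun x => (m * k) * h' (k * x + c)); first by exists h' => //; exists (m * k).
move=> x.
have d1 : is_derive x 1 (fun x : R => k * x + c) k.
  have := is_deriveD (is_deriveZ k (is_derive_id x (1 : R))) (is_derive_cst c x (1:R)).
  by rewrite addr0 [k *: 1]mulr1.
have d2 := @is_derive1_comp _ h (fun x => k * x + c) x _ _ (hh' (k * x + c)) d1.
have := is_deriveZ m d2.
by have -> : m *: (h' (k * x + c) * k) = m * k * h' (k * x + c) by rewrite /GRing.scale/=; ring.
Qed.

(** The functions [p(1/x) exp(-1/x)], extended by 0, form a class stable under
    derivation: the derivative replaces [p] by [X^2 (p - p')]. *)
Definition flat (p : {poly R}) x : R := if 0 < x then p.[x^-1] * expR (- x^-1) else 0.

Lemma horner_bound (p : {poly R}) : exists (C : R) n, 0 <= C /\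
  forall t, 1 <= t -> `|p.[t]| <= C * t ^+ n.
Proof.
elim/poly_ind : p => [|p c [C [n [C0 HC]]]].
  by exists 0, 0%N; split => // t _; rewrite horner0 normr0 mul0r.
exists (C + `|c|), n.+1; split; first by rewrite addr_ge0.
move=> t t1; rewrite hornerD hornerMX hornerC (le_trans (ler_normD _ _))//.
have t0 : 0 <= t by lra.
rewrite mulrDl lerD//; last by rewrite ler_peMr// exprn_ege1.
by rewrite normrM (ger0_norm t0) exprSr mulrA ler_wpM2r// HC.
Qed.

(** This is where the exponential beats the powers of [1/x]; it gives
    differentiability at 0. *)
Lemma flat_bound (p : {poly R}) : exists2 C, 0 <= C &
  forall x, 0 < x -> x <= 1 -> `|p.[x^-1] * expR (- x^-1)| <= C * x.
Proof.
have [C [n [C0 HC]]] := horner_bound p.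
exists (C * (n.+1)`!%:R); first by rewrite mulr_ge0.
move=> x x0 x1; set t := x^-1.
have t1 : 1 <= t by rewrite /t invf_ge1.
have t0 : 0 < t by lra.
have xt : x = t^-1 by rewrite /t invrK.
rewrite normrM (gtr0_norm (expR_gt0 _)) expRN xt.
have Hexp : t ^+ n.+1 / n.+1`!%:R <= expR t.
  by have := expR_ge1Dxn n (ltW t0); lra.
have n0 : 0 < n.+1`!%:R :> R by rewrite ltr0n fact_gt0.
rewrite ler_pdivrMr ?expR_gt0//.
apply: (le_trans (HC t t1)).
rewrite -!mulrA ler_wpM2l//.
by rewrite mulrCA -ler_pdivrMl ?invr_gt0// invrK -exprS [leRHS]mulrC -ler_pdivrMr.
Qed.

Lemma is_derive_flat (p : {poly R}) x :
  is_derive x 1 (flat p) (flat ('X^2 * (p - p^`())) x).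
Proof.
have [x0|x0|->] := ltgtP x 0.
- rewrite {2}/flat ltNge ltW//=.
  apply: near_eq_is_derive (is_derive_cst 0 x 1).
  near=> y; rewrite /flat ltNge (_ : y <= 0)//.
  by apply: ltW; near: y; exact: lt_nbhsl.
- rewrite {2}/flat x0.
  have : is_derive x 1 (fun y => p.[y^-1] * expR (- y^-1))
     (('X^2 * (p - p^`())).[x^-1] * expR (- x^-1)).
    have x0' : x != 0 by lra.
    have dV : is_derive x 1 (fun y : R => y^-1) (- x ^- 2).
      have := @is_deriveV _ id x 1 1 x0' (is_derive_id _ _).
      by rewrite [_ *: 1]mulr1.
    have dp := @is_derive1_comp _ (horner p) (fun y => y^-1) x _ _ (is_derive_poly p x^-1) dV.
    have dN := is_deriveN dV.
    have de := @is_derive1_comp _ expR (fun y => - y^-1) x _ _ (is_derive_expR _) dN.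
    apply: (is_derive_change (is_deriveM dp de)).
    rewrite /= !hornerE /GRing.scale/=.
    by field.
  apply: near_eq_is_derive.
  near=> y; rewrite /flat (_ : 0 < y)//.
  by near: y; exact: lt_nbhsr.
- have [C C0 HC] := flat_bound ('X * p).
  rewrite {2}/flat ltxx.
  have cv : h^-1 *: (flat p (h *: 1 + 0) - flat p 0) @[h --> 0^'] --> (0 : R).
    apply/cvgrPdist_le => e e0; near=> h.
    rewrite {2}/flat ltxx subr0 addr0 sub0r normrN [h *: 1]mulr1.
    rewrite /flat; case: ifPn => h0; last by rewrite scaler0 normr0 ltW.
    have h1 : h <= Num.min 1 (e / (C + 1)).
      apply: (le_trans (ler_norm h)); near: h; apply: dnbhs0_le; rewrite lt_min ltr01/= divr_gt0//; lra.
    rewrite le_min in h1; case/andP: h1 => h1 he.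
    have := HC h h0 h1; rewrite hornerM hornerX -mulrA.
    move=> /le_trans; apply.
    rewrite ler_pdivlMr in he; [nra|lra].
  apply: DeriveDef; first by apply/cvg_ex; exists 0; exact: cv.
  by apply/cvg_lim => //; exact: cv.
Unshelve. all: by end_near. Qed.

Lemma smooth1_flat p : smooth1 (flat p).
Proof.
exists (range flat); last by exists p.
move=> _ [q _ <-]; exists (flat ('X^2 * (q - q^`()))); first by exists ('X^2 * (q - q^`())).
exact: is_derive_flat.
Qed.

Definition flat_exp : R -> R := flat 1.

Lemma flat_exp_ge0 x : 0 <= flat_exp x.
Proof. by rewrite /flat_exp /flat; case: ifP => // _; rewrite hornerC mul1r expR_ge0. Qed.

Lemma flat_exp_le1 x : flat_exp x <= 1.
Proof.
rewrite /flat_exp /flat; case: ifP => // x0.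
by rewrite hornerC mul1r expR_le1 oppr_le0 invr_ge0 ltW.
Qed.

Lemma flat_exp0 x : x <= 0 -> flat_exp x = 0.
Proof. by rewrite /flat_exp /flat leNgt => /negbTE ->. Qed.

Lemma flat_exp_gt0 x : 0 < x -> flat_exp x = expR (- x^-1).
Proof. by move=> x0; rewrite /flat_exp /flat x0 hornerC mul1r. Qed.

Lemma flat_exp_cvg x : 0 < x -> flat_exp (n.+1%:R * x) @[n --> \oo] --> (1 : R).
Proof.
move=> x0.
have -> : (fun n => flat_exp (n.+1%:R * x)) = (fun n => expR (- (n.+1%:R^-1 * x^-1))).
  by apply/funext => n; rewrite flat_exp_gt0 ?invfM// mulr_gt0.
rewrite -[X in _ --> X]expR0.
apply: continuous_cvg; first exact: continuous_expR.
rewrite -[X in _ --> X]oppr0; apply: cvgN.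
rewrite -(mul0r x^-1); apply: cvgMl; exact: cvg_harmonic.
Qed.

(** Positive on [`]a, b[] only, and tends to the indicator of that interval as [n]
    grows. *)
Definition smooth_bump (a b : R) (n : nat) x :=
  flat_exp (n.+1%:R * (x - a)) * flat_exp (n.+1%:R * (b - x)).

Lemma smooth1_bump a b n : smooth1 (smooth_bump a b n).
Proof.
rewrite (_ : smooth_bump a b n = (fun x => flat_exp (n.+1%:R * x + (- n.+1%:R * a))) \*
  (fun x => flat_exp (- n.+1%:R * x + n.+1%:R * b))).
  by apply: smooth1M; apply: smooth1_affine; exact: smooth1_flat.
apply/funext => x; rewrite /smooth_bump /=; congr (flat_exp _ * flat_exp _); lra.
Qed.

Lemma bump_ge0 a b n x : 0 <= smooth_bump a b n x.
Proof. by rewrite mulr_ge0 ?flat_exp_ge0. Qed.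

Lemma bump_le1 a b n x : smooth_bump a b n x <= 1.
Proof. by rewrite mulr_ile1 ?flat_exp_ge0 ?flat_exp_le1. Qed.

Lemma bump_out a b n x : ~~ (a < x < b) -> smooth_bump a b n x = 0.
Proof.
rewrite negb_and -!leNgt => /orP[xa|bx]; rewrite /smooth_bump.
  by rewrite flat_exp0 ?mul0r// mulr_ge0_le0// subr_le0.
by rewrite [X in _ * X]flat_exp0 ?mulr0// mulr_ge0_le0// subr_le0.
Qed.

Lemma bump_gt0 a b n x : a < x < b -> 0 < smooth_bump a b n x.
Proof.
by move=> /andP[ax xb]; rewrite mulr_gt0// flat_exp_gt0 ?expR_gt0// mulr_gt0// subr_gt0.
Qed.

Lemma bump_cvg a b x : (fun n => smooth_bump a b n x) @ \oo --> ((a < x < b)%R%:R : R).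
Proof.
case: (boolP (a < x < b)) => [/andP[ax xb]|xab].
  rewrite /= -[X in _ --> X]mul1r.
  by apply: cvgM; apply: flat_exp_cvg; rewrite subr_gt0.
rewrite (_ : (fun n => _) = fun=> 0); first exact: cvg_cst.
by apply/funext => n; exact: bump_out.
Qed.

Local Notation mu1 := (@lebesgue_measure R).

Lemma bump_measurable a b n D : measurable_fun D (smooth_bump a b n : measurableTypeR R -> measurableTypeR R).
Proof. by apply: measurable_funTS; apply: continuous_measurable_fun; exact/smooth1_continuous/smooth1_bump. Qed.

Lemma bump_patch a b n : smooth_bump a b n = smooth_bump a b n \_ `[a, b].
Proof.
apply/funext => x; rewrite patchE; case: ifPn => //.
rewrite notin_setE/= in_itv/= => /negP xab; apply: bump_out.
by apply: contra xab => /andP[/ltW -> /ltW ->].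
Qed.

Lemma bump_integrable a b n D : measurable D -> mu1.-integrable D (EFin \o smooth_bump a b n).
Proof.
move=> mD; apply: (@integrableS _ _ _ _ setT) => //.
rewrite bump_patch -restrict_EFin -integrable_mkcond//.
apply: continuous_compact_integrable; first exact: segment_compact.
by apply: continuous_subspaceT; exact/smooth1_continuous/smooth1_bump.
Qed.

Definition bump_total a b n : R := (\int[mu1]_(t in `[a, b]) smooth_bump a b n t)%R.
Definition bump_primitive a b n x : R := (\int[mu1]_(t in `]-oo, x]) smooth_bump a b n t)%R.

Lemma is_derive_bump_primitive a b n x :
  is_derive x 1 (bump_primitive a b n) (smooth_bump a b n x).
Proof.
have xu : x < x + 1 by lra.
have cb : {for x, continuous (smooth_bump a b n)} by exact: (smooth1_continuous (smooth1_bump a b n)).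
have [] := @continuous_FTC1 _ (smooth_bump a b n) -oo%O x _ xu (bump_integrable a b n (measurable_itv _)) _ cb.
  by rewrite /= ltNyr.
move=> D1 D2; apply: (DeriveDef D1); rewrite -derive1E; exact: D2.
Qed.

Lemma bump_primitive_le a b n x : x <= a -> bump_primitive a b n x = 0.
Proof.
move=> xa; transitivity (\int[mu1]_(t in `]-oo, x]) (0 : R))%R.
  apply: eq_Rintegral => y; rewrite inE/= in_itv/= => yx; apply: bump_out.
  by rewrite negb_and -leNgt (le_trans yx xa).
by rewrite /Rintegral integral0.
Qed.

Lemma bump_primitive_ge a b n x : b <= x -> bump_primitive a b n x = bump_total a b n.
Proof.
move=> bx; rewrite /bump_primitive /bump_total Rintegral_mkcond [RHS]Rintegral_mkcond.
apply: eq_Rintegral => y _; rewrite !patchE !mem_setE !in_itv/=.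
have [yx|xy] := leP y x.
  case: ifPn => // yab; apply: bump_out; apply: contra yab => /andP[/ltW -> /ltW ->//].
by rewrite [y <= b]leNgt (le_lt_trans bx xy) andbF.
Qed.

Lemma bump_primitive_ge0 a b n x : 0 <= bump_primitive a b n x.
Proof. by apply: Rintegral_ge0 => y _; exact: bump_ge0. Qed.

Lemma bump_primitive_le_total a b n x : bump_primitive a b n x <= bump_total a b n.
Proof.
have [bx|xb] := leP b x; first by rewrite bump_primitive_ge.
rewrite -(@bump_primitive_ge a b n b)// /bump_primitive.
rewrite Rintegral_mkcond [leRHS]Rintegral_mkcond.
apply: le_Rintegral => //.
- by rewrite -restrict_EFin -integrable_mkcond//; exact: bump_integrable.
- by rewrite -restrict_EFin -integrable_mkcond//; exact: bump_integrable.
move=> y _; rewrite !patchE !mem_setE !in_itv/=.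
case: ifPn => [yx|_]; last by case: ifPn => // _; exact: bump_ge0.
by rewrite (le_trans yx (ltW xb)).
Qed.

Lemma bump_total_gt0 a b n : a < b -> 0 < bump_total a b n.
Proof.
move=> ab; have [||c] := @MVT _ (bump_primitive a b n) (smooth_bump a b n) a b ab.
- by move=> x _; exact: is_derive_bump_primitive.
- apply: continuous_subspaceT => x; apply/differentiable_continuous/derivable1_diffP.
  by have := is_derive_bump_primitive a b n x => -[].
rewrite in_itv/= (bump_primitive_le _ _ (lexx a)) bump_primitive_ge// subr0 => cab ->.
by rewrite mulr_gt0 ?bump_gt0// subr_gt0.
Qed.

Lemma bump_total_cvg a b : a < b -> (fun n => bump_total a b n) @ \oo --> b - a.
Proof.
move=> ab.
have mI : measurable (`[a, b]%classic : set (measurableTypeR R)) by [].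
have [] := @dominated_convergence _ _ _ mu1 `[a, b] mI
  (fun n x => (smooth_bump a b n x)%:E) (fun x => ((a < x < b)%R%:R)%:E) (cst 1%E).
- by move=> n; apply/measurable_EFinP; exact: bump_measurable.
- apply/measurable_EFinP; rewrite (_ : (fun x => _) = \1_(`]a, b[%classic : set (measurableTypeR R))).
    exact: measurable_indic.
  by apply/funext => x; rewrite indicE mem_setE in_itv.
- by apply: aeW => x _; apply: cvg_EFin; [exact: nearW|exact: bump_cvg].
- apply: (@continuous_compact_integrable _ (fun=> 1)); first exact: segment_compact.
  by apply: continuous_subspaceT => x; exact: cst_continuous.
- by apply: aeW => x n _; rewrite lee_fin ger0_norm ?bump_ge0 ?bump_le1.
move=> _ _.
have -> : (\int[mu1]_(x in `[a, b]) ((a < x < b)%R%:R)%:E = (b - a)%:E)%E.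
  transitivity (\int[mu1]_(x in `[a, b]) (\1_(`]a, b[%classic : set (measurableTypeR R)) x)%:E)%E.
    by apply: eq_integral => x _; rewrite indicE mem_setE in_itv.
  rewrite integral_indic//= setIidl; last exact: subset_itvW.
  by rewrite lebesgue_measure_itv/= lte_fin ab.
move=> /fine_cvgP[_]; rewrite /=.
by under eq_fun do rewrite /=.
Qed.

(** A smooth step from 0 (left of [a]) to 1 (right of [b]), whose derivative is the
    bump divided by its integral. *)
Definition transition a b n x : R := bump_primitive a b n x / bump_total a b n.

Lemma is_derive_transition a b n x :
  is_derive x 1 (transition a b n) (smooth_bump a b n x / bump_total a b n).
Proof.
rewrite (_ : transition a b n = (bump_total a b n)^-1 \*: bump_primitive a b n).
  apply: (is_derive_change (is_deriveZ _ (is_derive_bump_primitive a b n x))).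
  by rewrite /GRing.scale/= mulrC.
by apply/funext => y; rewrite /transition mulrC.
Qed.

Lemma smooth1_transition a b n : smooth1 (transition a b n).
Proof.
apply: (smooth1_primitive (is_derive_transition a b n)).
exact: (smooth1M (smooth1_bump a b n) (smooth1_cst (bump_total a b n)^-1)).
Qed.

Lemma transition_le a b n x : x <= a -> transition a b n x = 0.
Proof. by move=> xa; rewrite /transition bump_primitive_le// mul0r. Qed.

Lemma transition_ge a b n x : a < b -> b <= x -> transition a b n x = 1.
Proof.
by move=> ab bx; rewrite /transition bump_primitive_ge// divff// gt_eqF// bump_total_gt0.
Qed.

Lemma transition_itv a b n x : a < b -> 0 <= transition a b n x <= 1.
Proof.
move=> ab; have I0 := bump_total_gt0 n ab.
rewrite /transition; apply/andP; split.
  by apply: divr_ge0; [exact: bump_primitive_ge0|exact: ltW].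
by rewrite ler_pdivrMr// mul1r bump_primitive_le_total.
Qed.

End smooth1.

(** * Products of bumps as test functions *)

Section Rintegral_linear.
Context (R : realType) (d : measure_display) (T : measurableType d) (mu : {measure set T -> \bar R}).
Local Open Scope ring_scope.

Lemma integrableZr_EFin (D : set T) (f : T -> R) (k : R) : measurable D ->
  mu.-integrable D (EFin \o f) -> mu.-integrable D (EFin \o (fun x => f x * k)).
Proof.
move=> mD If; rewrite (_ : _ \o _ = fun x => (f x)%:E * k%:E)%E; first exact: integrableZr.
by apply/funext => x /=; rewrite EFinM.
Qed.

Lemma Rintegral_combination (D : set T) (f g : T -> R) (k l : R) : measurable D ->
  mu.-integrable D (EFin \o f) -> mu.-integrable D (EFin \o g) ->
  (\int[mu]_(x in D) (f x * k - g x * l) =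
   (\int[mu]_(x in D) f x) * k - (\int[mu]_(x in D) g x) * l)%R.
Proof.
move=> mD If Ig.
by rewrite RintegralB ?RintegralZr//; exact: integrableZr_EFin.
Qed.

End Rintegral_linear.

Section product_functions.
Variables (R : realType) (d : nat).
Local Notation rV := 'rV[R]_d.
Local Notation T := (lebesgue_space R d).
Local Notation mu := (@leb R d).
Implicit Types (phi : 'I_d -> R -> R) (x : rV).

Definition product_fun phi x : R := \prod_(i < d) phi i (x ord0 i).

Definition replace (i : 'I_d) (f : R -> R) phi : 'I_d -> R -> R :=
  fun j => if j == i then f else phi j.

Lemma product_funD1 (i : 'I_d) phi x :
  product_fun phi x = phi i (x ord0 i) * \prod_(j < d | j != i) phi j (x ord0 j).
Proof. by rewrite /product_fun (bigD1 i). Qed.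

Lemma product_fun_replace (i : 'I_d) f phi x :
  product_fun (replace i f phi) x = f (x ord0 i) * \prod_(j < d | j != i) phi j (x ord0 j).
Proof.
rewrite (product_funD1 i) /replace eqxx; congr (_ * _).
by apply: eq_bigr => j /negbTE ->.
Qed.

Lemma continuous_product_fun phi : (forall i, continuous (phi i)) -> continuous (product_fun phi).
Proof.
move=> cphi; rewrite /product_fun.
elim: (index_enum 'I_d) => [|i s IH].
  have -> : (fun x : rV => \prod_(i <- [::]) phi i (x ord0 i)) = fun=> 1.
    by apply/funext => x; rewrite big_nil.
  by move=> x; exact: cst_continuous.
rewrite (_ : (fun x : rV => _) = fun x => phi i (x ord0 i) * \prod_(j <- s) phi j (x ord0 j)).
  move=> x.
  have cx : {for x, continuous (fun x : rV => phi i (x ord0 i))}.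
    by apply: (@continuous_comp _ _ _ (fun x : rV => x ord0 i)); [exact: coord_continuous|exact: cphi].
  exact: (cvgM cx (IH x)).
by apply/funext => x; rewrite big_cons.
Qed.

Lemma is_derive_product_fun (i : 'I_d) phi x (l : R) :
  is_derive (x ord0 i) 1 (phi i) l ->
  is_derive x (delta_mx ord0 i) (product_fun phi)
    (l * \prod_(j < d | j != i) phi j (x ord0 j)).
Proof.
move=> [df dl]; set c := \prod_(j < d | _) _.
have cv : h^-1 *: (phi i (h *: 1 + x ord0 i) - phi i (x ord0 i)) @[h --> 0^'] --> l.
  by rewrite -dl; exact: df.
have cv' : h^-1 *: (product_fun phi (h *: delta_mx ord0 i + x) - product_fun phi x) @[h --> 0^'] --> l * c.
  rewrite (_ : (fun h => _) = fun h => h^-1 *: (phi i (h *: 1 + x ord0 i) - phi i (x ord0 i)) * c).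
    by apply: cvgMl.
  apply/funext => h; rewrite !(product_funD1 i) -/c.
  rewrite (eq_bigr (fun j => phi j (x ord0 j))) -/c; last first.
    by move=> j ji; rewrite !mxE eqxx (negbTE ji) mulr0 add0r.
  by rewrite !mxE !eqxx /GRing.scale/= mulr1; ring.
apply: DeriveDef; first by apply/cvg_ex; exists (l * c); exact: cv'.
by apply/cvg_lim => //; exact: cv'.
Qed.

(** The partial derivatives of a product of smooth functions of one coordinate are
    of the same form. *)
Lemma smooth_product_fun phi : (forall i, smooth1 (phi i)) -> smooth (product_fun phi).
Proof.
move=> sphi s.
have [psi spsi ->] : exists2 psi, (forall i, smooth1 (psi i)) &
    foldr (@partial R d) (product_fun phi) s = product_fun psi.
  elim: s => [|i s [psi spsi IH]] /=; first by exists phi.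
  have [f' sf' ff'] := smooth1_derive (spsi i).
  exists (replace i f' psi); first by move=> j; rewrite /replace; case: ifP.
  rewrite IH; apply/funext => x; rewrite product_fun_replace /partial.
  exact: (derive_val (is_derive := is_derive_product_fun (ff' (x ord0 i)))).
split; first by apply: continuous_product_fun => i; exact: smooth1_continuous.
move=> i x; have [f' sf' ff'] := smooth1_derive (spsi i).
exact: (ex_derive (is_derive := is_derive_product_fun (ff' (x ord0 i)))).
Qed.

Lemma compact_closed_box (a b : rV) : compact (closed_box a b).
Proof.
have := @rV_compact R d (fun i => `[a ord0 i, b ord0 i]%classic) (fun i => @segment_compact _ _ _).
congr compact; apply/seteqP; split => x H i; have := H i; rewrite /= in_itv//.
Qed.

Lemma test_product_fun phi (a b : rV) : (forall i, smooth1 (phi i)) ->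
  (forall i t, ~~ (a ord0 i <= t <= b ord0 i) -> phi i t = 0) ->
  test_function (product_fun phi).
Proof.
move=> sphi phi0; split; first exact: smooth_product_fun.
have cK := compact_closed_box (a := a) (b := b).
have clK : closed (closed_box a b) by apply: compact_closed => //; exact: norm_hausdorff.
apply: (subclosed_compact (@closed_closure _ _) cK).
rewrite [X in _ `<=` X](closure_id (closed_box a b)).1//.
apply: closure_subset => x /= /eqP x0 i.
apply: contraPT (x0) => xi.
by rewrite (product_funD1 i) phi0// mul0r => /(_ erefl).
Qed.

Definition box_integrable (f : rV -> R) : Prop :=
  measurable_fun [set: T] (f : T -> _) /\
  forall a b : rV, mu.-integrable (closed_box a b) (EFin \o f).

Lemma loc_integrable_box f : loc_integrable f -> box_integrable f.
Proof.
move=> [mf fK]; split => // a b; apply/integrableP; split.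
  by apply/measurable_EFinP; exact: measurable_funS mf.
exact: fK (compact_closed_box (a := a) (b := b)).
Qed.

Lemma box_integrable_sub f (a b : rV) (A : set rV) : box_integrable f ->
  measurable (A : set T) -> A `<=` closed_box a b -> mu.-integrable A (EFin \o f).
Proof.
move=> [_ If] mA AB; apply: (@integrableS _ _ _ mu (closed_box a b)) => //.
exact: measurable_closed_box.
Qed.

Definition bumps (a b : rV) n : 'I_d -> R -> R := fun i => smooth_bump (a ord0 i) (b ord0 i) n.

Lemma product_bumps_cvg (a b : rV) x :
  product_fun (bumps a b n) x @[n --> \oo] --> (\1_(open_box a b) x : R).
Proof.
have -> : \1_(open_box a b) x = \prod_(i < d) (a ord0 i < x ord0 i < b ord0 i)%R%:R :> R.
  rewrite indicE; case: (pselect (open_box a b x)) => h.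
    by rewrite mem_set// big1// => i _; rewrite h.
  rewrite memNset//; case: (pselect (exists i, ~~ (a ord0 i < x ord0 i < b ord0 i))).
    by move=> [i /negbTE xi]; rewrite (bigD1 i)//= xi mul0r.
  by move=> H; exfalso; apply: h => i; apply: contrapT => /negP xi; apply: H; exists i.
rewrite /product_fun; elim: (index_enum 'I_d) => [|i s IH].
  by rewrite big_nil; under eq_fun do rewrite big_nil; exact: cvg_cst.
rewrite big_cons; under eq_fun do rewrite big_cons.
by apply: cvgM => //; exact: bump_cvg.
Qed.

Lemma product_bumps_ge0 (a b : rV) n x : 0 <= product_fun (bumps a b n) x.
Proof. by apply: prodr_ge0 => i _; exact: bump_ge0. Qed.

Lemma product_bumps_le1 (a b : rV) n x : product_fun (bumps a b n) x <= 1.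
Proof. by apply: prodr_ile1 => i _; rewrite bump_ge0 bump_le1. Qed.

Lemma product_fun0 phi (a b : rV) x : (forall i t, ~~ (a ord0 i < t < b ord0 i) -> phi i t = 0) ->
  ~ open_box a b x -> product_fun phi x = 0.
Proof.
move=> phi0 xab; have [i xi] : exists i, ~~ (a ord0 i < x ord0 i < b ord0 i).
  apply: contrapT => H; apply: xab => i; apply: contrapT => /negP xi; apply: H; exists i => //.
by rewrite (product_funD1 i) phi0// mul0r.
Qed.

Lemma measurable_product_fun phi : (forall i, smooth1 (phi i)) ->
  measurable_fun [set: T] (product_fun phi : T -> measurableTypeR R).
Proof.
move=> sphi; apply: measurable_continuous; apply: continuous_product_fun => i.
exact: smooth1_continuous.
Qed.

Lemma integral_bumps_cvg U (a b : rV) : box_integrable U ->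
  (\int[mu]_x (U x * product_fun (bumps a b n) x))%R @[n --> \oo] -->
  (\int[mu]_(x in box a b) U x)%R.
Proof.
move=> [mU IU].
have mB n : measurable_fun [set: T] (product_fun (bumps a b n) : T -> measurableTypeR R).
  by apply: measurable_product_fun => i; exact: smooth1_bump.
have mO := measurable_open_box a b.
have IO : mu.-integrable (open_box a b) (EFin \o U).
  apply: (box_integrable_sub (a := a) (b := b)) => //.
  by move=> x H i; have /andP[/ltW -> /ltW ->] := H i.
have [] := @dominated_convergence _ _ _ mu [set: T] measurableT
  (fun n x => (U x * product_fun (bumps a b n) x)%:E)
  (fun x => (U x * \1_(open_box a b) x)%:E)
  (fun x => (`|U x| * \1_(open_box a b) x)%:E).
- by move=> n; apply/measurable_EFinP; apply: measurable_funM; [exact: mU|exact: mB].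
- by apply/measurable_EFinP; apply: measurable_funM; [exact: mU|exact: measurable_indic].
- apply: aeW => x _; apply: cvg_EFin; first exact: nearW.
  by apply: cvgMr; exact: product_bumps_cvg.
- have := integrable_norm IO; rewrite (integrable_mkcond _ mO).
  apply: eq_integrable => // x _; rewrite patchE indicE; case: ifPn => _; rewrite ?mulr1 ?mulr0//.
- apply: aeW => x n _; rewrite lee_fin normrM ler_wpM2l// ger0_norm ?product_bumps_ge0// indicE.
  case: (boolP (x \in open_box a b)) => [_|]; first exact: product_bumps_le1.
  rewrite notin_setE => xab; rewrite (product_fun0 (a := a) (b := b))// => i t; exact: bump_out.
move=> _ _.
rewrite /Rintegral (integral_box_open_box a b (f := EFin \o U)); last exact/measurable_EFinP.
have -> : (\int[mu]_x (U x * \1_(open_box a b) x)%:E = \int[mu]_(x in open_box a b) (U x)%:E)%E.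
  rewrite [RHS]integral_mkcond; apply: eq_integral => x _.
  by rewrite patchE indicE; case: ifPn => _; rewrite ?mulr1 ?mulr0.
move=> H; apply: fine_cvg; rewrite fineK//.
exact: integrable_fin_num.
Qed.

Lemma box_integrable_mul U (phi : rV -> R) (M : R) (a b : rV) : box_integrable U ->
  measurable_fun [set: T] (phi : T -> measurableTypeR R) ->
  (forall x, `|phi x| <= M) -> (forall x, ~ open_box a b x -> phi x = 0) ->
  mu.-integrable [set: T] (fun x => (U x * phi x)%:E).
Proof.
move=> IU mphi phiM phi0.
have mO := measurable_open_box a b.
have IO : mu.-integrable (open_box a b) (EFin \o U).
  apply: (box_integrable_sub (a := a) (b := b)) => //.
  by move=> x H i; have /andP[/ltW -> /ltW ->] := H i.
have : mu.-integrable setT ((fun x => M%:E * (`|U x|)%:E)%E \_ (open_box a b)).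
  by rewrite -integrable_mkcond//; apply: integrableZl => //; exact: integrable_norm.
apply: le_integrable; first exact: measurableT.
  by apply/measurable_EFinP; apply: measurable_funM; [exact: IU.1|exact: mphi].
move=> x _; rewrite patchE; case: ifPn => [_|].
  rewrite -EFinM !abse_EFin lee_fin normrM mulrC normrM normr_id ler_wpM2r//.
  exact: le_trans (phiM x) (ler_norm _).
by rewrite notin_setE => /phi0 ->; rewrite mulr0.
Qed.

Lemma unit_distance (u v : R) : 0 <= u <= 1 -> 0 <= v <= 1 -> `|u - v| <= 1.
Proof. by rewrite ler_norml; lra. Qed.

Section shrink.
Variables (U g : rV -> R) (i : 'I_d).
Hypotheses (IU : box_integrable U) (Ig : box_integrable g).
Hypothesis weak : forall phi : rV -> R, test_function phi ->
  (\int[mu]_x (U x * partial i phi x) = - \int[mu]_x (g x * phi x))%R.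

Lemma integral_norm_test (phi : rV -> R) (a b : rV) :
  measurable_fun [set: T] (phi : T -> measurableTypeR R) ->
  (forall x, `|phi x| <= 1) -> (forall x, ~ open_box a b x -> phi x = 0) ->
  `|\int[mu]_x (g x * phi x)|%R <= (\int[mu]_(x in box a b) `|g x|)%R.
Proof.
move=> mphi phi1 phi0.
have Igp := box_integrable_mul Ig mphi phi1 phi0.
have mO := measurable_open_box a b.
have IO : mu.-integrable (open_box a b) (EFin \o g).
  apply: (box_integrable_sub (a := a) (b := b)) => //.
  by move=> x H j; have /andP[/ltW -> /ltW ->] := H j.
apply: (le_trans (le_normr_Rintegral measurableT Igp)).
have -> : (\int[mu]_(x in box a b) `|g x| = \int[mu]_(x in open_box a b) `|g x|)%R.
  rewrite /Rintegral; congr fine.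
  apply: (integral_box_open_box a b (f := fun x => `|g x|%:E)).
  by apply/measurable_EFinP; exact: (measurableT_comp (@normr_measurable R setT) Ig.1).
rewrite [leRHS]Rintegral_mkcond; apply: le_Rintegral => //.
- exact: integrable_norm.
- by rewrite -restrict_EFin -integrable_mkcond//; exact: integrable_norm.
move=> x _; rewrite patchE normrM; case: ifPn => [_|].
  by rewrite ler_piMr.
by rewrite notin_setE => /phi0 ->; rewrite normr0 mulr0.
Qed.

(** Shrinking one side of a box changes the mean of [U] by at most the integral of
    the i-th weak derivative. The identity is tested against the product of bumps
    in the coordinates [j != i] and of the difference of two smooth steps in the
    coordinate [i]: the derivative of that difference tends to the difference of
    the normalised indicators of the two sides, while its values stay between -1
    and 1. *)
Lemma shrink_side (a b a' b' : rV) :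
  (forall j, j != i -> a' ord0 j = a ord0 j /\ b' ord0 j = b ord0 j) ->
  a ord0 i <= a' ord0 i -> a' ord0 i < b' ord0 i -> b' ord0 i <= b ord0 i ->
  `| (\int[mu]_(x in box a' b') U x)%R / (b' ord0 i - a' ord0 i) -
     (\int[mu]_(x in box a b) U x)%R / (b ord0 i - a ord0 i) |
  <= (\int[mu]_(x in box a b) `|g x|)%R.
Proof.
move=> same aa' ab' bb'.
have ab : a ord0 i < b ord0 i by lra.
pose h n (t : R) := transition (a' ord0 i) (b' ord0 i) n t - transition (a ord0 i) (b ord0 i) n t.
pose phi n := replace i (h n) (bumps a b n).
have sh n : smooth1 (h n).
  apply: smooth1D; first exact: smooth1_transition.
  have := smooth1M (smooth1_cst (-1)) (smooth1_transition (a ord0 i) (b ord0 i) n).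
  by congr smooth1; apply/funext => t /=; rewrite mulN1r.
have sphi n j : smooth1 (phi n j).
  by rewrite /phi /replace; case: ifP => // _; exact: smooth1_bump.
have phi0 n j t : ~~ (a ord0 j < t < b ord0 j) -> phi n j t = 0.
  rewrite /phi /replace; case: eqVneq => [->|_]; last exact: bump_out.
  rewrite negb_and -!leNgt /h => /orP[ta|bt].
    by rewrite !transition_le ?subr0// (le_trans ta).
  by rewrite !transition_ge ?subrr// (le_trans bb').
have phi1 n x : `|product_fun (phi n) x| <= 1.
  rewrite normr_prod; apply: prodr_ile1 => j _; rewrite normr_ge0/=.
  rewrite /phi /replace; case: eqVneq => [->|_]; last by rewrite ger0_norm ?bump_ge0 ?bump_le1.
  exact: unit_distance (transition_itv n (x ord0 i) ab') (transition_itv n (x ord0 i) ab).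
have tphi n : test_function (product_fun (phi n)).
  apply: (test_product_fun (a := a) (b := b)) => // j t tab; apply: phi0.
  by apply: contra tab => /andP[/ltW -> /ltW ->].
have Dphi n x : partial i (product_fun (phi n)) x =
    product_fun (bumps a' b' n) x / bump_total (a' ord0 i) (b' ord0 i) n -
    product_fun (bumps a b n) x / bump_total (a ord0 i) (b ord0 i) n.
  have dh (t : R) : is_derive t (1 : R) (h n) (smooth_bump (a' ord0 i) (b' ord0 i) n t / bump_total (a' ord0 i) (b' ord0 i) n
      - smooth_bump (a ord0 i) (b ord0 i) n t / bump_total (a ord0 i) (b ord0 i) n).
    exact: is_deriveB (is_derive_transition _ _ _ _) (is_derive_transition _ _ _ _).
  have dh' : is_derive (x ord0 i) 1 (phi n i) (smooth_bump (a' ord0 i) (b' ord0 i) n (x ord0 i) / bump_total (a' ord0 i) (b' ord0 i) n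
      - smooth_bump (a ord0 i) (b ord0 i) n (x ord0 i) / bump_total (a ord0 i) (b ord0 i) n).
    by rewrite /phi /replace eqxx; exact: dh.
  rewrite /partial (derive_val (is_derive := is_derive_product_fun dh')).
  rewrite !(product_funD1 i) /bumps.
  rewrite (eq_bigr (fun j => smooth_bump (a ord0 j) (b ord0 j) n (x ord0 j))); last first.
    by move=> j /negbTE ji; rewrite /phi /replace ji.
  rewrite [X in _ = _ * X / _ - _](eq_bigr (fun j => smooth_bump (a ord0 j) (b ord0 j) n (x ord0 j))); last first.
    by move=> j ji; have [-> ->] := same j ji.
  ring.
have mB (c e : rV) n : measurable_fun [set: T] (product_fun (bumps c e n) : T -> measurableTypeR R).
  by apply: measurable_product_fun => j; exact: smooth1_bump.
have IB (c e : rV) n : mu.-integrable [set: T] (fun x => (U x * product_fun (bumps c e n) x)%:E).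
  apply: (box_integrable_mul (M := 1) (a := c) (b := e)) => //.
    by move=> x; rewrite ger0_norm ?product_bumps_ge0 ?product_bumps_le1.
  by move=> x; apply: product_fun0 => j t; exact: bump_out.
have key n : `| (\int[mu]_x (U x * product_fun (bumps a' b' n) x))%R / bump_total (a' ord0 i) (b' ord0 i) n -
    (\int[mu]_x (U x * product_fun (bumps a b n) x))%R / bump_total (a ord0 i) (b ord0 i) n |
    <= (\int[mu]_(x in box a b) `|g x|)%R.
  have -> : (\int[mu]_x (U x * product_fun (bumps a' b' n) x))%R / bump_total (a' ord0 i) (b' ord0 i) n -
    (\int[mu]_x (U x * product_fun (bumps a b n) x))%R / bump_total (a ord0 i) (b ord0 i) n =
    (\int[mu]_x (U x * partial i (product_fun (phi n)) x))%R.
    rewrite -(Rintegral_combination _ _ measurableT (IB a' b' n) (IB a b n)).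
    by apply: eq_Rintegral => x _; rewrite Dphi; ring.
  rewrite weak// normrN; apply: integral_norm_test; [exact: measurable_product_fun|exact: phi1|].
  by move=> x; apply: product_fun0 => j t; exact: phi0.
have cv : (fun n => `| (\int[mu]_x (U x * product_fun (bumps a' b' n) x))%R / bump_total (a' ord0 i) (b' ord0 i) n -
    (\int[mu]_x (U x * product_fun (bumps a b n) x))%R / bump_total (a ord0 i) (b ord0 i) n |)
    @ \oo --> `| (\int[mu]_(x in box a' b') U x)%R / (b' ord0 i - a' ord0 i) -
     (\int[mu]_(x in box a b) U x)%R / (b ord0 i - a ord0 i) |.
  apply: cvg_norm; apply: cvgB; apply: cvgM; try exact: integral_bumps_cvg;
    apply: cvgV; try (exact: bump_total_cvg); rewrite gt_eqF// subr_gt0//.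
by apply: (cvgr_to_le cv); exact: nearW.
Qed.

End shrink.

End product_functions.

(** * Telescoping along a tree of sets *)

Section tree.
Context (R : realType) (disp : measure_display) (T : measurableType disp) (mu : {measure set T -> \bar R}).
Variables (I : finType) (Q : seq I -> set T).
Hypothesis mQ : forall s, measurable (Q s).
Hypothesis Q_children : forall s, Q s = \bigcup_(i in [set: I]) Q (i :: s).
Hypothesis Q_disjoint : forall s i j x, Q (i :: s) x -> Q (j :: s) x -> i = j.
Variable m : seq I -> R.

(** On [Q s], the step function equal to the value of [m] at the node that lies [k]
    generations below [s]; a conditional expectation when [m] lists means. *)
Fixpoint tree_fun k s x : R :=
  if k is k'.+1 then \sum_i \1_(Q (i :: s)) x * tree_fun k' (i :: s) x else m s.

Lemma child_sub i s : Q (i :: s) `<=` Q s.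
Proof. by move=> x Qx; rewrite (Q_children s); exists i. Qed.

Lemma tree_fun_child k i s x : Q (i :: s) x -> tree_fun k.+1 s x = tree_fun k (i :: s) x.
Proof.
move=> Qx; rewrite /= (bigD1 i)//= indicE mem_set// mul1r big1 ?addr0// => j ji.
rewrite indicE memNset ?mul0r// => Qj; move/eqP : ji; apply.
exact: Q_disjoint Qj Qx.
Qed.

Lemma measurable_tree_fun k s : measurable_fun [set: T] (tree_fun k s).
Proof.
elim: k s => [|k IH] s /=; first exact: measurable_cst.
apply: measurable_sum => i; apply: measurable_funM; last exact: IH.
exact: measurable_indic.
Qed.

Lemma integral_children s (f : T -> R) : measurable_fun [set: T] f ->
  (\int[mu]_(x in Q s) (f x)%:E = \sum_(i : I) \int[mu]_(x in Q (i :: s)) (f x)%:E)%E.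
Proof.
move=> mf.
have E : Q s = \big[setU/set0]_(i <- enum I) Q (i :: s).
  rewrite -bigcup_seq Q_children; apply/seteqP; split => x [i _ Qi]; exists i => //=.
  by rewrite mem_enum.
rewrite [in LHS]E -big_enum/= integral_bigsetU_EFin ?enum_uniq//.
  move=> i j _ _ [x [Qi Qj]]; exact: Q_disjoint Qi Qj.
by apply/measurable_EFinP; exact: measurable_funS mf.
Qed.

Section step.
Variables (W F : T -> R) (c : R).
Hypotheses (mW : measurable_fun [set: T] W) (mF : measurable_fun [set: T] F).
Hypotheses (W0 : forall x, 0 <= W x) (F0 : forall x, 0 <= F x) (c0 : 0 <= c).
Hypothesis step : forall s,
  (\sum_(i : I) `|m (i :: s) - m s|%:E * \int[mu]_(x in Q (i :: s)) (W x)%:E <=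
   (c / 2 ^+ size s)%:E * \int[mu]_(x in Q s) (F x)%:E)%E.

Lemma tree_step k s :
  (\int[mu]_(x in Q s) (`|tree_fun k.+1 s x - tree_fun k s x| * W x)%:E <=
   (c / 2 ^+ (k + size s))%:E * \int[mu]_(x in Q s) (F x)%:E)%E.
Proof.
have mG k' s' : measurable_fun [set: T] (fun x => `|tree_fun k'.+1 s' x - tree_fun k' s' x| * W x).
  apply: measurable_funM => //; apply: measurableT_comp => //.
  by apply: measurable_funB; exact: measurable_tree_fun.
elim: k s => [|k IH] s; rewrite [leLHS]integral_children//.
  apply: le_trans (step s); apply: lee_sum => i _.
  rewrite -ge0_integralZl_EFin//; last 2 first.
  - by move=> x _; rewrite lee_fin.
  - by apply/measurable_EFinP; exact: measurable_funS mW.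
  apply: le_of_eq.
  by apply: eq_integral => x /set_mem Qx; rewrite (tree_fun_child _ Qx) -EFinM.
apply: (@le_trans _ _ (\sum_(i : I) (c / 2 ^+ (k + size (i :: s)))%:E * \int[mu]_(x in Q (i :: s)) (F x)%:E)%E).
  apply: lee_sum => i _; apply: le_trans (IH (i :: s)).
  apply: le_of_eq.
  by apply: eq_integral => x /set_mem Qx; rewrite !(tree_fun_child _ Qx).
rewrite (integral_children s mF) ge0_sume_distrr; last first.
  by move=> i _; apply: integral_ge0 => x _; rewrite lee_fin.
by apply: lee_sum => i _ /=; rewrite addnS addSn.
Qed.

End step.

Section mean.
Variable U : T -> R.
Hypothesis mU : measurable_fun [set: T] U.
Hypothesis IU : mu.-integrable (Q [::]) (EFin \o U).
Hypothesis mean : forall s, ((m s)%:E * mu (Q s) = \int[mu]_(x in Q s) (U x)%:E)%E.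
Hypothesis Qfin : (mu (Q [::]) < +oo)%E.

Lemma tree_fun_integral k s : (\int[mu]_(x in Q s) (tree_fun k s x)%:E = \int[mu]_(x in Q s) (U x)%:E)%E.
Proof.
elim: k s => [|k IH] s; first by rewrite -mean /= integral_cst.
rewrite integral_children; last exact: measurable_tree_fun.
rewrite [RHS](integral_children _ mU); apply: eq_bigr => i _; rewrite -IH.
by apply: eq_integral => x /set_mem Qx; rewrite (tree_fun_child _ Qx).
Qed.

Lemma descendant_sub t s : Q (t ++ s) `<=` Q s.
Proof. by elim: t => [//|i t IH] /=; apply: subset_trans IH; exact: child_sub. Qed.

Lemma tree_fun_descendant k t s x : Q (t ++ s) x -> tree_fun (k + size t) s x = tree_fun k (t ++ s) x.
Proof.
elim/last_ind: t s => [|t i IH] s; first by rewrite addn0.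
rewrite cat_rcons size_rcons addnS => Qx.
rewrite (@tree_fun_child _ i); last exact: descendant_sub Qx.
exact: IH.
Qed.

Lemma tree_fun_integral_descendant k t : 
  (\int[mu]_(x in Q t) (tree_fun (k + size t) [::] x)%:E = \int[mu]_(x in Q t) (U x)%:E)%E.
Proof.
rewrite -[RHS](tree_fun_integral k); apply: eq_integral => x /set_mem Qx.
by rewrite tree_fun_descendant ?cats0.
Qed.

(** This makes the nodes a pi-system. *)
Lemma tree_setI s t : Q s `&` Q t = set0 \/ Q s `&` Q t = Q s \/ Q s `&` Q t = Q t.
Proof.
have key a b u : size a = size b -> a != b -> Q (a ++ u) `&` Q (b ++ u) = set0.
  elim/last_ind: a b u => [|a i IH] b u; first by case: b.
  case/lastP: b => [|b j]; first by rewrite size_rcons.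
  rewrite !size_rcons => -[sab] ne; rewrite !cat_rcons.
  have [ij|ij] := eqVneq i j.
    by rewrite -ij; apply: IH => //; apply: contra ne => /eqP ->; rewrite ij.
  apply/seteqP; split => // x [/descendant_sub Qi /descendant_sub Qj].
  by move/eqP : ij; apply; exact: Q_disjoint Qi Qj.
wlog st : s t / (size s <= size t)%N.
  move=> H; have [|/ltnW] := leqP (size s) (size t); first exact: H.
  by move=> /H; rewrite setIC => -[|[|]]; tauto.
have Et : t = take (size t - size s) t ++ drop (size t - size s) t by rewrite cat_take_drop.
have sd : size (drop (size t - size s) t) = size s by rewrite size_drop subKn.
have [Es|ne] := eqVneq s (drop (size t - size s) t).
  right; right; apply/setIidPr; rewrite [in X in X `<=` _]Et -Es; exact: descendant_sub.
left; have := key s (drop (size t - size s) t) [::] (esym sd) ne; rewrite !cats0 => H.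
apply/seteqP; split => // x [Qs Qt].
suff : (Q s `&` Q (drop (size t - size s) t)) x by rewrite H.
by split => //; move: Qt; rewrite {1}Et; exact: descendant_sub.
Qed.

Variables (c : R) (G : T -> R).
Hypotheses (c0 : 0 <= c) (mG : measurable_fun [set: T] G) (G0 : forall x, 0 <= G x).
Hypothesis IG : (\int[mu]_(x in Q [::]) (G x)%:E < +oo)%E.
Hypothesis stepG : forall s,
  (\sum_(i : I) `|m (i :: s) - m s|%:E * mu (Q (i :: s)) <=
   (c / 2 ^+ size s)%:E * \int[mu]_(x in Q s) (G x)%:E)%E.

Let D n x : R := `|tree_fun n.+1 [::] x - tree_fun n [::] x|.
(* The total variation of the means along the branch through [x]. *)
Let S x : \bar R := (\sum_(n <oo) (D n x)%:E)%E.

Let D0 n x : 0 <= D n x. Proof. exact: normr_ge0. Qed.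

Let mD n : measurable_fun [set: T] (D n).
Proof.
by apply: measurableT_comp => //; apply: measurable_funB; exact: measurable_tree_fun.
Qed.

Let S0 x : (0 <= S x)%E. Proof. by apply: nneseries_ge0 => n _ _; rewrite lee_fin. Qed.

Let mS : measurable_fun [set: T] S.
Proof.
apply: ge0_emeasurable_sum => [n x _ _|n _]; first by rewrite lee_fin.
by apply/measurable_EFinP.
Qed.

(** A generation contributes half as much as the one before it, so that the bound
    on one generation is summable. *)
Lemma integral_series (W F : T -> R) : measurable_fun [set: T] W ->
  measurable_fun [set: T] F -> (forall x, 0 <= W x) -> (forall x, 0 <= F x) ->
  (forall s, (\sum_(i : I) `|m (i :: s) - m s|%:E * \int[mu]_(x in Q (i :: s)) (W x)%:E <=
   (c / 2 ^+ size s)%:E * \int[mu]_(x in Q s) (F x)%:E)%E) ->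
  (\int[mu]_(x in Q [::]) (S x * (W x)%:E) <= (2 * c)%:E * \int[mu]_(x in Q [::]) (F x)%:E)%E.
Proof.
move=> mW mF W0 F0 step.
have F0' : (0 <= \int[mu]_(x in Q [::]) (F x)%:E)%E by apply: integral_ge0 => x _; rewrite lee_fin.
rewrite (eq_integral (fun x => \sum_(n <oo) (D n x * W x)%:E)%E); last first.
  move=> x _; rewrite muleC -nneseriesZl//; last by move=> n _; rewrite lee_fin.
  by apply: eq_eseriesr => n _; rewrite muleC.
rewrite integral_nneseries//; last 2 first.
- move=> n; apply/measurable_EFinP; apply: measurable_funM; first exact: measurable_funS (mD n).
  exact: measurable_funS mW.
- by move=> n x _; rewrite lee_fin mulr_ge0.
apply: (@le_trans _ _ (\sum_(n <oo) (c / 2 ^+ n)%:E * \int[mu]_(x in Q [::]) (F x)%:E)%E).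
  apply: lee_nneseries => [n _ _|n _].
    by apply: integral_ge0 => x _; rewrite lee_fin mulr_ge0.
  by have := tree_step mW mF W0 F0 step n [::]; rewrite addn0.
apply: lime_le.
  by apply: is_cvg_nneseries => n _ _; rewrite mule_ge0// lee_fin divr_ge0// exprn_ge0.
apply: nearW => n; rewrite -ge0_sume_distrl; last first.
  by move=> i _; rewrite lee_fin divr_ge0// exprn_ge0.
rewrite lee_wpmul2r// sumEFin lee_fin.
have -> : \sum_(0 <= i < n) c / 2 ^+ i = 2 * c - 2 * c / 2 ^+ n.
  elim: n => [|n IH]; first by rewrite big_geq// expr0 divr1 subrr.
  rewrite big_nat_recr//= IH exprS; field.
  by rewrite expf_neq0.
by rewrite gerBl divr_ge0 ?exprn_ge0// mulr_ge0.
Qed.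

Let IS : mu.-integrable (Q [::]) S.
Proof.
apply/integrableP; split; first exact: measurable_funS mS.
rewrite (eq_integral S); last by move=> x _; rewrite gee0_abs.
rewrite (eq_integral (fun x => S x * 1%:E)%E); last by move=> x _; rewrite mule1.
apply: (@le_lt_trans _ _ ((2 * c)%:E * \int[mu]_(x in Q [::]) (G x)%:E)%E).
  apply: (integral_series (W := fun=> 1) (F := G)) => //.
  move=> s; apply: le_trans (stepG s); apply: lee_sum => i _.
  by rewrite integral_cst// mul1e.
by rewrite lte_mul_pinfty ?lee_fin ?mulr_ge0.
Qed.

Let S_ae : {ae mu, forall x, Q [::] x -> S x \is a fin_num}.
Proof. exact: integrable_ae. Qed.

Lemma tree_fun_sub_le n k x : (`|tree_fun (n + k) [::] x - tree_fun k [::] x|%:E <= S x)%E.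
Proof.
apply: (@le_trans _ _ (\sum_(0 <= i < n + k) (D i x)%:E)%E); last first.
  by apply: nneseries_lim_ge => i _ _; rewrite lee_fin.
rewrite sumEFin lee_fin (@big_cat_nat _ _ _ k)//= ?leq_addl//.
apply: ler_wpDl; first exact: sumr_ge0.
rewrite -(@telescope_sumr _ k (n + k) (fun i => tree_fun i [::] x)) ?leq_addl//.
exact: ler_norm_sum.
Qed.

Let cvg_tree x : S x \is a fin_num -> cvgn (fun n => tree_fun n [::] x).
Proof.
move=> Sx.
have cvgD : cvgn (series (fun n => tree_fun n.+1 [::] x - tree_fun n [::] x)).
  apply: normed_cvg; apply: (@nondecreasing_is_cvgn _ _).
    have E n : [normed series (fun n => tree_fun n.+1 [::] x - tree_fun n [::] x)] n =
      \sum_(0 <= k < n) D k x by [].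
    by apply/nondecreasing_seqP => n; rewrite !E big_nat_recr//= lerDl.
  exists (fine (S x)) => _ [n _ <-]; rewrite -lee_fin fineK// /series/=.
  rewrite -sumEFin; apply: nneseries_lim_ge => i _ _; by rewrite lee_fin.
rewrite (_ : (fun n => _) = fun n => tree_fun 0 [::] x + series (fun n => tree_fun n.+1 [::] x - tree_fun n [::] x) n).
  by apply: is_cvgD => //; exact: is_cvg_cst.
by apply/funext => n; rewrite seriesEnat/= telescope_sumr// addrC subrK.
Qed.

(* Wherever [S x] is finite the step functions converge. Their limit has the same
   integral as [U] over every node, hence over the sigma-algebra that the nodes
   generate, hence it equals [U] almost everywhere. *)
Let v x : \bar R := limn_esup (fun n => (tree_fun n [::] x)%:E).

Let mv : measurable_fun [set: T] v.
Proof.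
by apply: measurable_fun_limn_esup => n; apply/measurable_EFinP; exact: measurable_tree_fun.
Qed.

Let tree_v x : S x \is a fin_num -> (tree_fun n [::] x)%:E @[n --> \oo] --> v x.
Proof.
move=> /cvg_tree cx.
have H : (tree_fun n [::] x)%:E @[n --> \oo] --> (limn (fun n => tree_fun n [::] x))%:E.
  by apply: cvg_EFin => //; exact: nearW.
by rewrite /v (cvg_limn_einf_sup H).2.
Qed.

Let dom E : measurable E -> E `<=` Q [::] -> mu.-integrable E v /\
  (\int[mu]_(x in E) (tree_fun n [::] x)%:E)%E @[n --> \oo] --> (\int[mu]_(x in E) v x)%E.
Proof.
move=> mE EQ.
have [] := @dominated_convergence _ _ _ mu E mE (fun n x => (tree_fun n [::] x)%:E) v
  (fun x => `|m [::]|%:E + S x)%E.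
- by move=> n; apply/measurable_EFinP; exact: measurable_funS (measurable_tree_fun n [::]).
- exact: measurable_funS mv.
- apply: filterS S_ae => x Sx Ex; apply: tree_v; apply: Sx; exact: EQ.
- apply: (@integrableS _ _ _ mu (Q [::])) => //; apply: integrableD => //.
  apply/integrableP; split; first exact: measurable_cst.
  by rewrite integral_cst//= lte_mul_pinfty.
- apply: aeW => x n Ex.
  have := tree_fun_sub_le n 0 x; rewrite addn0 => H.
  apply: le_trans (leeD2l _ H); rewrite -EFinD lee_fin.
  by have := ler_normD (m [::]) (tree_fun n [::] x - m [::]); rewrite addrC subrK.
by move=> Iv _ cv.
Qed.

Let v_descendant t : (\int[mu]_(x in Q t) v x = \int[mu]_(x in Q t) (U x)%:E)%E.
Proof.
have tQ : Q t `<=` Q [::] by have := @descendant_sub t [::]; rewrite cats0.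
have [_ cv] := dom (mQ t) tQ.
apply: (cvg_unique _ cv) => //.
have H : (fun n => \int[mu]_(x in Q t) (tree_fun (n + size t) [::] x)%:E)%E @ \oo -->
    (\int[mu]_(x in Q t) (U x)%:E)%E.
  by under eq_fun do rewrite tree_fun_integral_descendant; exact: cvg_cst.
by rewrite (@cvg_shiftn (size t) _ (fun n => \int[mu]_(x in Q t) (tree_fun n [::] x)%:E)%E) in H.
Qed.

Definition tree_sets : set (set T) := range Q `|` [set set0; setT].

Hypothesis hull : forall A : set T, measurable A -> A `<=` Q [::] ->
  exists B : set T, [/\ <<s tree_sets >> B, A `<=` B & mu (B `\` A) = 0%E].

Lemma tree_sets_setI : setI_closed tree_sets.
Proof.
move=> A B [[s _ <-]|[->|->]] [[t _ <-]|[->|->]]; rewrite ?setI0 ?set0I ?setTI ?setIT.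
- by case: (tree_setI s t) => [->|[->|->]]; [right; left|left; exists s|left; exists t].
all: try (by right; left).
all: try (by right; right).
all: try (by left; exists t).
by left; exists s.
Qed.

Let v_sigma (A : set T) : <<s tree_sets >> A -> measurable A /\
  (\int[mu]_(x in A `&` Q [::]) v x = \int[mu]_(x in A `&` Q [::]) (U x)%:E)%E.
Proof.
have Iv : mu.-integrable (Q [::]) v by have [] := dom (mQ [::]) (@subset_refl _ _).
have mt : <<s tree_sets >> `<=` measurable.
  apply: smallest_sub; first exact: sigma_algebra_measurable.
  by move=> B [[s _ <-]|[->|->]]; [exact: mQ|exact: measurable0|exact: measurableT].
move=> sA; split; first exact: mt.
move: A sA.
apply: (@dynkin_induction _ (g_sigma_algebraType tree_sets) tree_sets
  (fun A => (\int[mu]_(x in A `&` Q [::]) v x = \int[mu]_(x in A `&` Q [::]) (U x)%:E)%E)) => //.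
- exact: tree_sets_setI.
- by rewrite !setTI v_descendant.
- move=> B [[s _ <-]|[->|->]]; rewrite ?setTI ?set0I ?integral_set0 ?v_descendant//.
  by rewrite setIidl ?v_descendant//; have := @descendant_sub s [::]; rewrite cats0.
- move=> B /mt mB EB.
  have split f : measurable_fun [set: T] f -> mu.-integrable (Q [::]) f ->
      (\int[mu]_(x in ~` B `&` Q [::]) f x = \int[mu]_(x in Q [::]) f x - \int[mu]_(x in B `&` Q [::]) f x)%E.
    move=> mf If.
    have mBQ := measurableI _ _ mB (mQ [::]).
    have mBQ' := measurableI _ _ (measurableC mB) (mQ [::]).
    have E : Q [::] = (B `&` Q [::]) `|` (~` B `&` Q [::]) by rewrite -setIUl setUv setTI.
    rewrite [in X in (_ = X - _)%E]E integral_setU//; last 2 first.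
    + exact: measurable_funS mf.
    + by apply/disj_setPS => x [[? _] []].
    rewrite addeAC subee ?add0e//; apply: integrable_fin_num => //.
    by apply: (@integrableS _ _ _ mu (Q [::])) => //; exact: subIsetr.
  rewrite !split//; last exact/measurable_EFinP.
  by rewrite EB v_descendant.
- move=> F mF tF PF.
  have mF' n := measurableI _ _ (mt _ (mF n)) (mQ [::]).
  rewrite setI_bigcupl.
  have tF' : trivIset setT (fun n => F n `&` Q [::]).
    move=> i j _ _ [x [[Fi _] [Fj _]]]; apply: tF => //; by exists x.
  have sub : \bigcup_n (F n `&` Q [::]) `<=` Q [::] by move=> x [n _ []].
  rewrite !integral_bigcup//.
  + by apply: eq_eseriesr => n _; exact: PF.
  + by apply: (@integrableS _ _ _ mu (Q [::])) => //; exact: bigcupT_measurable.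
  + by apply: (@integrableS _ _ _ mu (Q [::])) => //; exact: bigcupT_measurable.
Qed.

Let v_ae : ae_eq mu (Q [::]) v (EFin \o U).
Proof.
have Iv : mu.-integrable (Q [::]) v by have [] := dom (mQ [::]) (@subset_refl _ _).
apply: integral_ae_eq => //; first by apply/measurable_EFinP; exact: measurable_funS mU.
move=> E EQ mE; have [B [sB EB BE0]] := hull mE EQ.
have [mB EvU] := v_sigma sB.
have key f : measurable_fun [set: T] f -> (\int[mu]_(x in E) f x = \int[mu]_(x in B `&` Q [::]) f x)%E.
  move=> mf; have mBQ : measurable (B `&` Q [::]) by exact: measurableI.
  have EBQ : E = (B `&` Q [::]) `\` ((B `&` Q [::]) `\` E).
    rewrite setDD; apply/seteqP; split => [x Ex|x []//]; split => //; split; [exact: EB|exact: EQ].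
  rewrite [in LHS]EBQ; have mN : measurable ((B `&` Q [::]) `\` E) by exact: measurableD.
  have N0 : mu ((B `&` Q [::]) `\` E) = 0%E.
    apply/eqP; rewrite -measure_le0 -BE0; apply: le_measure; rewrite ?inE//; first exact: measurableD.
    by move=> x [[]].
  rewrite integralE [RHS]integralE; congr (_ - _)%E; symmetry.
    apply: ge0_negligible_integral => //; exact: measurable_funS (measurable_funepos mf).
  apply: ge0_negligible_integral => //; exact: measurable_funS (measurable_funeneg mf).
by rewrite key// key//; exact/measurable_EFinP.
Qed.

(** The distance from [U] to the mean at the root is at most the total variation of
    the means along the branch, whose integral is bounded generation by
    generation. The unweighted bound [stepG] serves for the convergence, the
    bound with the weight [W] for the estimate. *)
Theorem tree_poincare (W F : T -> R) : measurable_fun [set: T] W ->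
  measurable_fun [set: T] F -> (forall x, 0 <= W x) -> (forall x, 0 <= F x) ->
  (forall s, (\sum_(i : I) `|m (i :: s) - m s|%:E * \int[mu]_(x in Q (i :: s)) (W x)%:E <=
   (c / 2 ^+ size s)%:E * \int[mu]_(x in Q s) (F x)%:E)%E) ->
  (\int[mu]_(x in Q [::]) (`|U x - m [::]| * W x)%:E <= (2 * c)%:E * \int[mu]_(x in Q [::]) (F x)%:E)%E.
Proof.
move=> mW mF W0 F0 step; apply: le_trans (integral_series mW mF W0 F0 step).
apply: ae_ge0_le_integral => //.
- by move=> x _; rewrite lee_fin mulr_ge0.
- apply/measurable_EFinP; apply: measurable_funM; last exact: measurable_funS mW.
  apply: measurableT_comp => //; apply: measurable_funB => //; exact: measurable_funS mU.
- by move=> x _; rewrite mule_ge0// lee_fin.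
- apply: emeasurable_funM; first exact: measurable_funS mS.
  by apply/measurable_EFinP; exact: measurable_funS mW.
apply: filterS2 S_ae v_ae => x Sx vx Qx.
have Sfin := Sx Qx; have := tree_v Sfin; rewrite (vx Qx)/= => cU.
rewrite EFinM lee_wpmul2r ?lee_fin// -(fineK Sfin) lee_fin.
have cU' : tree_fun n [::] x @[n --> \oo] --> U x by have /fine_cvg := cU.
have cUm : `|tree_fun n [::] x - m [::]| @[n --> \oo] --> `|U x - m [::]|.
  by apply: cvg_norm; apply: cvgB => //; exact: cvg_cst.
apply: (cvgr_to_le cUm); apply: nearW => n; rewrite -lee_fin fineK//.
by have := tree_fun_sub_le n 0 x; rewrite addn0.
Qed.

End mean.
End tree.

(** * Means over cubes and the weighted Poincare inequality *)

Section cubes.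
Variables (R : realType) (d : nat).
Local Notation rV := 'rV[R]_d.
Local Notation T := (lebesgue_space R d).
Local Notation mu := (@leb R d).

Definition qbox (a : rV) (l : R) : set rV := box a (\row_j (a ord0 j + l)).

Lemma qboxP (a : rV) (l : R) (x : rV) :
  qbox a l x <-> forall i, a ord0 i <= x ord0 i < a ord0 i + l.
Proof. by split => H i; have := H i; rewrite mxE. Qed.

Lemma measurable_qbox (a : rV) (l : R) : measurable (qbox a l : set T).
Proof. exact: measurable_box. Qed.

Lemma leb_qbox (a : rV) (l : R) : 0 <= l -> mu (qbox a l) = (l ^+ d)%:E.
Proof.
move=> l0; rewrite leb_box; last by move=> i; rewrite mxE lerDl.
congr (_%:E); rewrite (eq_bigr (fun=> l)); last by move=> i _; rewrite mxE addrAC subrr add0r.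
by rewrite prodr_const card_ord.
Qed.

Lemma qbox_sub (a a' : rV) (l l' : R) : (forall i, a ord0 i <= a' ord0 i) ->
  (forall i, a' ord0 i + l' <= a ord0 i + l) -> qbox a' l' `<=` qbox a l.
Proof.
move=> aa' ll' x /qboxP H; apply/qboxP => i.
by have := H i; have := aa' i; have := ll' i; lra.
Qed.

Lemma box_integrable_box (f : rV -> R) (a b : rV) : box_integrable f ->
  mu.-integrable (box a b) (EFin \o f).
Proof.
move=> If; apply: (@box_integrable_sub _ _ _ a b _ If (measurable_box a b)).
move=> x H i; by have /andP[-> /ltW ->] := H i.
Qed.

Lemma box_integrable_qbox (f : rV -> R) (a : rV) l : box_integrable f ->
  mu.-integrable (qbox a l) (EFin \o f).
Proof. exact: box_integrable_box. Qed.

Definition mean (U : rV -> R) (a : rV) (l : R) : R :=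
  (\int[mu]_(x in qbox a l) U x)%R / l ^+ d.

Section poincare.
Variables (U : rV -> R) (g : 'I_d -> rV -> R) (G : rV -> R).
Hypotheses (IU : box_integrable U) (Ig : forall i, box_integrable (g i)) (IG : box_integrable G).
Hypothesis gG : forall i x, `|g i x| <= G x.
Hypothesis weak : forall i (phi : rV -> R), test_function phi ->
  (\int[mu]_x (U x * partial i phi x) = - \int[mu]_x (g i x * phi x))%R.

Let G0 (i : 'I_d) x : 0 <= G x. Proof. exact: le_trans (normr_ge0 (g i x)) (gG i x). Qed.

Lemma Rintegral_sub (f : rV -> R) (A B : set rV) : (forall x, 0 <= f x) ->
  measurable (A : set T) -> measurable (B : set T) -> A `<=` B ->
  mu.-integrable B (EFin \o f) -> (\int[mu]_(x in A) f x <= \int[mu]_(x in B) f x)%R.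
Proof.
move=> f0 mA mB AB IB.
have IA : mu.-integrable A (EFin \o f) by exact: integrableS IB.
rewrite -lee_fin /Rintegral !fineK; [|exact: integrable_fin_num..].
apply: ge0_subset_integral => //; first by have /integrableP[] := IB.
by move=> x _; rewrite lee_fin.
Qed.

(** The sides are shrunk one after the other; after [k] steps the first [k] sides
    are those of the smaller cube. *)
Lemma mean_sub (a a' : rV) (l l' : R) : 0 < l' -> (forall i, a ord0 i <= a' ord0 i) ->
  (forall i, a' ord0 i + l' <= a ord0 i + l) ->
  `|mean U a' l' - mean U a l| <= d%:R / l' ^+ d.-1 * (\int[mu]_(x in qbox a l) G x)%R.
Proof.
move=> l'0 aa' ll'.
pose lo k : rV := \row_j (if (j < k)%N then a' ord0 j else a ord0 j).
pose hi k : rV := \row_j (if (j < k)%N then a' ord0 j + l' else a ord0 j + l).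
pose MM (a b : rV) := (\int[mu]_(x in box a b) U x)%R / \prod_(j < d) (b ord0 j - a ord0 j).
pose M k := MM (lo k) (hi k).
have meanE b e : mean U b e = MM b (\row_j (b ord0 j + e)).
  rewrite /mean /MM; congr (_ / _); rewrite (eq_bigr (fun=> e)).
    by rewrite prodr_const card_ord.
  by move=> j _; rewrite mxE addrAC subrr add0r.
have M0 : M 0%N = mean U a l.
  by rewrite meanE /M; congr MM; apply/rowP => j; rewrite !mxE.
have Md : M d = mean U a' l'.
  by rewrite meanE /M; congr MM; apply/rowP => j; rewrite !mxE ltn_ord.
have len k (j : 'I_d) : l' <= hi k ord0 j - lo k ord0 j.
  by rewrite !mxE; case: ifP => _; have := aa' j; have := ll' j; lra.
have sub k : box (lo k) (hi k) `<=` qbox a l.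
  move=> x H; apply/qboxP => j; have := H j; rewrite !mxE.
  by have := aa' j; have := ll' j; case: ifP => _; lra.
set I := (\int[mu]_(x in qbox a l) G x)%R.
have step k : (k < d)%N -> `|M k.+1 - M k| <= I / l' ^+ d.-1.
  move=> kd; pose i := Ordinal kd.
  have same j : j != i -> lo k.+1 ord0 j = lo k ord0 j /\ hi k.+1 ord0 j = hi k ord0 j.
    move=> ji; rewrite !mxE ltnS leq_eqVlt.
    have -> : (nat_of_ord j == k) = false by apply/negbTE; apply: contra ji => /eqP jk; apply/eqP/val_inj.
    by [].
  have [loi hii lo'i hi'i] : [/\ lo k ord0 i = a ord0 i, hi k ord0 i = a ord0 i + l,
      lo k.+1 ord0 i = a' ord0 i & hi k.+1 ord0 i = a' ord0 i + l'].
    by rewrite !mxE /= ltnn ltnSn.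
  have := shrink_side IU (Ig i) (weak i) (a := lo k) (b := hi k) (a' := lo k.+1) (b' := hi k.+1) same.
  rewrite loi hii lo'i hi'i => /(_ (aa' i)) /(_ ltac:(rewrite ltrDl; exact: l'0)) /(_ (ll' i)).
  set P := \prod_(j < d | j != i) (hi k ord0 j - lo k ord0 j).
  have Pl : l' ^+ d.-1 <= P.
    have -> : l' ^+ d.-1 = \prod_(j < d | j != i) l'.
      rewrite prodr_const; congr (_ ^+ _).
      by rewrite -[in LHS](card_ord d) (cardC1 i).
    by apply: ler_prod => j _; rewrite len ltW.
  have P0 : 0 < P by apply: lt_le_trans Pl; exact: exprn_gt0.
  have -> : M k.+1 = (\int[mu]_(x in box (lo k.+1) (hi k.+1)) U x)%R / (a' ord0 i + l' - a' ord0 i) / P.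
    rewrite /M /MM (bigD1 i)//= hi'i lo'i invfM mulrA; congr (_ / _).
    by apply: eq_bigr => j ji; have [-> ->] := same j ji.
  have -> : M k = (\int[mu]_(x in box (lo k) (hi k)) U x)%R / (a ord0 i + l - a ord0 i) / P.
    by rewrite /M /MM (bigD1 i)//= hii loi invfM mulrA.
  have Pi : 0 <= P^-1 by rewrite invr_ge0 ltW.
  rewrite -mulrBl normrM (ger0_norm Pi) => H.
  have H2 : (\int[mu]_(x in box (lo k) (hi k)) `|g i x|)%R <= I.
    apply: (@le_trans _ _ (\int[mu]_(x in box (lo k) (hi k)) G x)%R).
      apply: le_Rintegral; first exact: measurable_box.
      - by apply: integrable_norm; exact: box_integrable_box.
      - exact: box_integrable_box.
      - by move=> x _; exact: gG.
    apply: Rintegral_sub; [exact: G0 i|exact: measurable_box|exact: measurable_qbox|exact: sub|].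
    exact: box_integrable_qbox.
  apply: ler_pM => //; first exact: le_trans H H2.
  by rewrite lef_pV2 ?posrE// exprn_gt0.
rewrite -M0 -Md.
have -> : M d - M 0%N = \sum_(0 <= k < d) (M k.+1 - M k) by rewrite telescope_sumr.
apply: (le_trans (ler_norm_sum _ _ _)); rewrite big_mkord.
apply: (@le_trans _ _ (\sum_(k < d) I / l' ^+ d.-1)).
  by apply: ler_sum => k _; exact: step.
by rewrite sumr_const card_ord -[_ *+ d]mulr_natl; lra.
Qed.

Section dyadic.
Variables (a : rV) (l : R).
Hypothesis l0 : 0 < l.

(** An address in the dyadic tree of a cube lists the halvings that lead to a
    subcube, the most recent one first; each halving chooses a half in every
    coordinate. *)
Definition bits := {ffun 'I_d -> bool}.

Definition node_edge (s : seq bits) : R := l / 2 ^+ size s.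

Fixpoint node_corner (s : seq bits) : rV :=
  if s is v :: s' then \row_j (node_corner s' ord0 j + (if v j then node_edge s else 0))
  else a.

Definition node s : set rV := qbox (node_corner s) (node_edge s).

Lemma node_edge_gt0 s : 0 < node_edge s.
Proof. by rewrite divr_gt0// exprn_gt0. Qed.

Lemma node_edge_cons v s : node_edge s = 2 * node_edge (v :: s).
Proof. by rewrite /node_edge /= exprS; field; rewrite expf_neq0. Qed.

Lemma measurable_node s : measurable (node s : set T).
Proof. exact: measurable_qbox. Qed.

Lemma node_child_corner v s i : node_corner s ord0 i <= node_corner (v :: s) ord0 i /\
  node_corner (v :: s) ord0 i + node_edge (v :: s) <= node_corner s ord0 i + node_edge s.
Proof.
have e0 := node_edge_gt0 (v :: s); rewrite (node_edge_cons v s) [node_corner (v :: s)]/= mxE.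
by case: ifP => _; lra.
Qed.

Lemma node_children s : node s = \bigcup_(v in [set: bits]) node (v :: s).
Proof.
apply/seteqP; split => [x /qboxP xs|x [v _]]; last first.
  by apply: qbox_sub => i; have [] := node_child_corner v s i.
pose v : bits := [ffun i => node_corner s ord0 i + node_edge s / 2 <= x ord0 i].
exists v => //; apply/qboxP => i; rewrite [node_corner (v :: s)]/= mxE ffunE.
have := xs i; rewrite (node_edge_cons v s).
have -> : 2 * node_edge (v :: s) / 2 = node_edge (v :: s) by lra.
case: (lerP (node_corner s ord0 i + node_edge (v :: s)) (x ord0 i)) => h; lra.
Qed.

Lemma node_disjoint s v v' x : node (v :: s) x -> node (v' :: s) x -> v = v'.
Proof.
move=> /qboxP xv /qboxP xv'; apply/ffunP => i; have := xv i; have := xv' i.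
rewrite [node_corner (v :: s)]/= [node_corner (v' :: s)]/= !mxE.
have -> : node_edge (v' :: s) = node_edge (v :: s) by [].
by case: (v i); case: (v' i) => //; lra.
Qed.

Lemma node_sub s : node s `<=` qbox a l.
Proof.
elim: s => [|v s IH]; first by rewrite /node /= /node_edge expr0 divr1.
by apply: subset_trans IH; rewrite (node_children s) => x vx; exists v.
Qed.

Lemma node0 : node [::] = qbox a l.
Proof. by rewrite /node /= /node_edge expr0 divr1. Qed.

Lemma node_deep k x : node [::] x -> exists2 s, size s = k & node s x.
Proof.
move=> x0; elim: k => [|k [s sk xs]]; first by exists [::].
by move: xs; rewrite node_children => -[v _ xv]; exists (v :: s) => //=; rewrite sk.
Qed.

Local Notation sets := (tree_sets (node : seq bits -> set T)).

(** A half-space meets the cube in the union of the nodes that it contains, since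
    the edges of the nodes tend to 0. *)
Lemma node_sigma (B : set (borel_rV R d)) : measurable B -> <<s sets >> (node [::] `&` B).
Proof.
have mN s : (<<s sets >>) (node s) by apply: sub_sigma_algebra; left; exists s.
pose H : set (set rV) := [set A | <<s sets >> (node [::] `&` A)].
have sH : sigma_algebra setT H.
  split.
  - by rewrite /H /= setI0; apply: sub_sigma_algebra; right; left.
  - move=> A HA; rewrite /H /= setTD.
    rewrite (_ : _ `&` ~` A = node [::] `\` (node [::] `&` A)); last first.
      by rewrite setDIr setDv set0U.
    have mA : measurable (node [::] `&` A : set (g_sigma_algebraType sets)) by exact: HA.
    have m0 : measurable (node [::] : set (g_sigma_algebraType sets)) by exact: mN.
    exact: (measurableD m0 mA).
  - move=> F HF; rewrite /H /= setI_bigcupr.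
    exact: (@bigcupT_measurable _ (g_sigma_algebraType sets) _ HF).
suff sub : cylinders (n := d) `<=` H by move=> mB; exact: (smallest_sub sH sub mB).
move=> _ [i [C [mC ->]]].
pose f : g_sigma_algebraType sets -> measurableTypeR R := fun x => x ord0 i.
suff mf : measurable_fun (node [::] : set (g_sigma_algebraType sets)) f.
  exact: (mf (mN [::]) C mC).
apply: (measurability _ (RGenInftyO.measurableE R)).
move=> _ [_ [t ->] <-].
rewrite (_ : _ `&` _ = \bigcup_(s in [set s | node s `<=` node [::] `&` [set x | x ord0 i < t]]) node s).
  rewrite bigcup_mkcond; apply: countable_bigcupT_measurable; first exact: countableP.
  move=> s; case: ifP => _; first exact: mN.
  exact: (@measurable0 _ (g_sigma_algebraType sets)).
apply/seteqP; split => [x [x0]|x [s /= ss sx]]; last first.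
  by have [x0 xt] := ss _ sx; split => //; rewrite /f/= in_itv/=.
rewrite /f/= in_itv/= => xt.
have [k kl] : exists k, l / 2 ^+ k < t - x ord0 i.
  have tx : 0 < t - x ord0 i by rewrite subr_gt0.
  exists (Num.truncn (l / (t - x ord0 i))).+1; set N := (Num.truncn _).+1.
  rewrite ltr_pdivrMr ?exprn_gt0// mulrC -ltr_pdivrMr//.
  apply: (lt_trans (truncnS_gt _)).
  by rewrite -natrX ltr_nat; exact: ltn_expl.
have [s sk xs] := node_deep k x0.
exists s => //= y ys; split.
  by rewrite node0; exact: node_sub ys.
have /qboxP/(_ i) := ys; have /qboxP/(_ i) := xs.
by rewrite /node_edge sk; lra.
Qed.

Lemma node_hull (A : set T) : measurable A -> A `<=` node [::] ->
  exists B : set T, [/\ <<s sets >> B, A `<=` B & mu (B `\` A) = 0%E].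
Proof.
move=> mA A0.
have Afin : (mu A < +oo)%E.
  apply: (@le_lt_trans _ _ (mu (node [::]))); last by rewrite leb_qbox ?ltry// ltW// node_edge_gt0.
  by apply: le_measure; rewrite ?inE//; exact: measurable_node.
have [B [mB AB BA]] := borel_hull Afin.
have mB' := borel_lebesgue mB.
exists (node [::] `&` B); split; first exact: node_sigma.
  by move=> x Ax; split; [exact: A0|exact: AB].
have H : mu (B `\` A) = 0%E.
  rewrite measureD//; last by rewrite [X in (X < _)%E]BA.
  rewrite [X in (X - _)%E]BA (setIidr AB) subee// ge0_fin_numE//; exact: measure_ge0.
apply/eqP; rewrite -measure_le0 -H; apply: le_measure; rewrite ?inE.
- by apply: measurableD => //; apply: measurableI => //; exact: measurable_node.
- exact: measurableD.
- by move=> x [[]].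
Qed.

Definition poincare_const : R := d%:R * 2 ^+ d.-1.

Hypothesis d0 : (0 < d)%N.

Lemma node_step (W F : rV -> R) : measurable_fun [set: T] (W : T -> measurableTypeR R) ->
  (forall x, 0 <= W x) ->
  (forall b e, 0 < e -> qbox b e `<=` qbox a l ->
    ((\int[mu]_(x in qbox b e) (W x)%:E) * (\int[mu]_(x in qbox b e) (G x)%:E) <=
      (e ^+ d)%:E * \int[mu]_(x in qbox b e) (F x)%:E)%E) ->
  forall s, (\sum_(v : bits) `|mean U (node_corner (v :: s)) (node_edge (v :: s)) - mean U (node_corner s) (node_edge s)|%:E
     * \int[mu]_(x in node (v :: s)) (W x)%:E <=
   (poincare_const * l / 2 ^+ size s)%:E * \int[mu]_(x in node s) (F x)%:E)%E.
Proof.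
move=> mW W0 WF s.
have e0 := node_edge_gt0 s.
set I := (\int[mu]_(x in node s) G x)%R.
have I0 : 0 <= I by apply: Rintegral_ge0 => x _; exact: G0 (Ordinal d0) x.
have IE : (\int[mu]_(x in node s) (G x)%:E = I%:E)%E.
  by rewrite /I /Rintegral fineK//; apply: integrable_fin_num; [exact: measurable_node|exact: box_integrable_qbox].
set k := poincare_const / node_edge s ^+ d.-1.
have k0 : 0 <= k by rewrite divr_ge0 ?mulr_ge0 ?exprn_ge0// ltW.
have bound v : `|mean U (node_corner (v :: s)) (node_edge (v :: s)) - mean U (node_corner s) (node_edge s)| <= k * I.
  apply: le_trans (mean_sub (node_edge_gt0 (v :: s)) _ _) _.
  - by move=> i; have [] := node_child_corner v s i.
  - by move=> i; have [] := node_child_corner v s i.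
  rewrite ler_wpM2r// /k /poincare_const (node_edge_cons v s).
  have e1 := node_edge_gt0 (v :: s); move: (node_edge (v :: s)) e1 => e1 e10.
  rewrite exprMn; apply: le_of_eq; field.
  by rewrite !expf_neq0// gt_eqF.
have Wint v : (0 <= \int[mu]_(x in node (v :: s)) (W x)%:E)%E by apply: integral_ge0 => x _; rewrite lee_fin.
apply: (@le_trans _ _ (\sum_(v : bits) (k * I)%:E * \int[mu]_(x in node (v :: s)) (W x)%:E)%E).
  by apply: lee_sum => v _; apply: lee_wpmul2r => //; rewrite lee_fin.
rewrite -ge0_sume_distrr//.
rewrite -(@integral_children R _ T mu bits node measurable_node node_children node_disjoint s W mW).
have sub : qbox (node_corner s) (node_edge s) `<=` qbox a l.
  exact: node_sub.
have := WF (node_corner s) (node_edge s) e0 sub.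
rewrite -/(node s) IE => H.
rewrite EFinM -muleA [(I%:E * _)%E]muleC.
apply: (le_trans (lee_wpmul2l _ H)); first by rewrite lee_fin.
rewrite muleA -EFinM; apply: le_of_eq; congr (_%:E * _)%E.
have -> : node_edge s ^+ d = node_edge s * node_edge s ^+ d.-1 by rewrite -exprS prednK.
rewrite /k mulrA.
have -> : poincare_const / node_edge s ^+ d.-1 * node_edge s * node_edge s ^+ d.-1 = poincare_const * node_edge s.
  by field; rewrite expf_neq0// gt_eqF.
by rewrite /node_edge mulrA.
Qed.

(** A weighted Poincare inequality. The means over a cube and over its halves differ
    by a multiple of the edge times the mean of [G] ([mean_sub]); the product with
    the weight [W] is controlled by [F] by assumption, and the edges halve from one
    generation to the next. *)
Theorem cube_poincare (W F : rV -> R) : measurable_fun [set: T] (W : T -> measurableTypeR R) ->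
  measurable_fun [set: T] (F : T -> measurableTypeR R) ->
  (forall x, 0 <= W x) -> (forall x, 0 <= F x) ->
  (forall b e, 0 < e -> qbox b e `<=` qbox a l ->
    ((\int[mu]_(x in qbox b e) (W x)%:E) * (\int[mu]_(x in qbox b e) (G x)%:E) <=
      (e ^+ d)%:E * \int[mu]_(x in qbox b e) (F x)%:E)%E) ->
  (\int[mu]_(x in qbox a l) (`|U x - mean U a l| * W x)%:E <=
    (2 * (poincare_const * l))%:E * \int[mu]_(x in qbox a l) (F x)%:E)%E.
Proof.
move=> mW mF W0 F0 WF.
have Q0 := node0.
have m0 : mean U (node_corner [::]) (node_edge [::]) = mean U a l by rewrite /= /node_edge expr0 divr1.
have c0 : 0 <= poincare_const * l by rewrite mulr_ge0 ?mulr_ge0 ?exprn_ge0// ltW.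
have G0' x : 0 <= G x by exact: G0 (Ordinal d0) x.
rewrite -m0 -Q0 -[2 * _]/(2 * (poincare_const * l)).
apply: (@tree_poincare R _ T mu bits node measurable_node node_children node_disjoint
  (fun s => mean U (node_corner s) (node_edge s)) U IU.1 _ _ _
  (poincare_const * l) G c0 IG.1 G0' _ _ _ W F mW mF W0 F0).
- exact: box_integrable_qbox.
- move=> s; have e0 := node_edge_gt0 s.
  rewrite [X in (_ * X)%E](_ : _ = (node_edge s ^+ d)%:E); last exact: leb_qbox (ltW e0).
  rewrite -EFinM /mean divfK ?expf_neq0 ?gt_eqF//.
  by rewrite /Rintegral fineK//; apply: integrable_fin_num; [exact: measurable_qbox|exact: box_integrable_qbox].
- by rewrite [X in (X < _)%E](_ : _ = (l ^+ d)%:E) ?ltry// Q0; exact: leb_qbox (ltW l0).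
- by rewrite -ge0_fin_numE ?integral_ge0// => [|x _]; [apply: integrable_fin_num; [exact: measurable_qbox|exact: box_integrable_qbox]|rewrite lee_fin (G0 (Ordinal d0))].
- move=> s; have := @node_step (fun=> 1) G _ _ _ s.
  rewrite (eq_bigr (fun v => `|mean U (node_corner (v :: s)) (node_edge (v :: s)) - mean U (node_corner s) (node_edge s)|%:E * mu (node (v :: s)))%E); last first.
    by move=> v _; rewrite integral_cst ?mul1e//; exact: measurable_node.
  apply => //.
  move=> b e e0 _; rewrite integral_cst; last exact: measurable_qbox.
  rewrite mul1e [X in (X * _)%E](_ : _ = (e ^+ d)%:E) ?lexx//; exact: leb_qbox (ltW e0).
- exact: node_hull.
- exact: node_step.
Qed.

End dyadic.
End poincare.
End cubes.

(** * Muckenhoupt weights on cubes *)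

Section abstract_muckenhoupt.
Context (R : realType) (disp : measure_display) (T : measurableType disp) (mu : {measure set T -> \bar R}).
Variable p : R.

Lemma powR_inv_sub (x : R) : 0 <= x -> x `^ (1 - p) = x^-1 `^ (p - 1).
Proof. by move=> x0; rewrite -[in RHS]powR_inv1// -powRrM mulN1r opprB. Qed.

(** Trivial if [t <= s]; otherwise [t <= t * (t / s) `^ (p - 1)]. *)
Lemma young_scaling (s t : R) : 1 <= p -> 0 < s -> 0 <= t -> t <= s + s `^ (1 - p) * t `^ p.
Proof.
move=> p1 s0 t0; have [ts|st] := leP t s.
  by rewrite (le_trans ts)// lerDl mulr_ge0// powR_ge0.
have t0' : 0 < t by exact: lt_trans st.
rewrite -[leLHS]add0r lerD// ?(ltW s0)//.
have -> : s `^ (1 - p) * t `^ p = t * (t / s) `^ (p - 1).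
  rewrite powRM ?invr_ge0 ?(ltW s0)// mulrA mulr_powRB1//; last by lra.
  rewrite mulrC; congr (_ * _).
  by rewrite powR_inv_sub// ltW.
rewrite ler_peMr//.
rewrite -[leLHS](_ : 1 `^ (p - 1) = 1); last by rewrite powR1.
apply: ge0_ler_powR; rewrite ?nnegrE ?subr_ge0 ?divr_ge0// ?(ltW s0)//.
by rewrite ler_pdivlMr// mul1r ltW.
Qed.

Lemma integral_combination (Q : set T) (w f : T -> R) (lam k : R) : measurable Q ->
  measurable_fun [set: T] w -> measurable_fun [set: T] f ->
  (forall x, 0 <= w x) -> (forall x, 0 <= f x) -> 0 <= lam -> 0 <= k ->
  (\int[mu]_(x in Q) (lam * w x + k * f x)%:E =
   lam%:E * \int[mu]_(x in Q) (w x)%:E + k%:E * \int[mu]_(x in Q) (f x)%:E)%E.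
Proof.
move=> mQ mw mf w0 f0 lam0 k0.
have i1 : measurable_fun Q (fun x => (w x)%:E) by apply/measurable_EFinP; exact: measurable_funS mw.
have i2 : measurable_fun Q (fun x => (f x)%:E) by apply/measurable_EFinP; exact: measurable_funS mf.
under eq_integral do rewrite EFinD !EFinM.
rewrite ge0_integralD//; last 4 first.
- by move=> x _; rewrite -EFinM lee_fin mulr_ge0.
- exact: measurable_funeM.
- by move=> x _; rewrite -EFinM lee_fin mulr_ge0.
- exact: measurable_funeM.
rewrite ge0_integralZl_EFin//; last by move=> x _; rewrite lee_fin.
by rewrite ge0_integralZl_EFin//; move=> x _; rewrite lee_fin.
Qed.

(** Young's inequality with [s] a multiple of [w `^ (- (p - 1)^-1)], for which
    [s `^ (1 - p)] is a multiple of [w]; the multiple is the one that makes the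
    first term integrate to at most [lam * q]. *)
Lemma young_integral (Q : set T) (w f : T -> R) (S q lam : R) : 1 <= p -> measurable Q ->
  measurable_fun [set: T] w -> measurable_fun [set: T] f ->
  (forall x, 0 <= w x) -> (forall x, 0 <= f x) -> {ae mu, forall x, 0 < w x} ->
  p != 1 -> 0 < q -> 0 < S -> 0 < lam -> (\int[mu]_(x in Q) (w x `^ (- (p - 1)^-1))%:E <= S%:E)%E ->
  (\int[mu]_(x in Q) (f x)%:E <= (lam * q)%:E +
    (lam `^ (1 - p) * (S / q) `^ (p - 1))%:E * \int[mu]_(x in Q) (f x `^ p * w x)%:E)%E.
Proof.
move=> p1 mQ mw mf w0 f0 wpos pN q0 S0 lam0 sgS.
set sg := fun x => w x `^ (- (p - 1)^-1) in sgS *.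
have msg : measurable_fun [set: T] sg by exact: (measurableT_comp (measurable_powR _) mw).
have mp : measurable_fun [set: T] (fun x => f x `^ p * w x).
  by apply: measurable_funM => //; exact: (measurableT_comp (measurable_powR _) mf).
have sg0 x : 0 <= sg x by exact: powR_ge0.
have fp0 x : 0 <= f x `^ p * w x by rewrite mulr_ge0 ?powR_ge0.
pose tau := lam * (q / S).
have qS : 0 <= q / S by rewrite divr_ge0 ?ltW.
have t0 : 0 < tau by rewrite !mulr_gt0// invr_gt0.
have tp : tau `^ (1 - p) = lam `^ (1 - p) * (S / q) `^ (p - 1).
  by rewrite /tau (powRM _ (ltW lam0) qS) (powR_inv_sub qS) invf_div.
have key : {ae mu, forall x, Q x -> ((f x)%:E <= (tau * sg x + tau `^ (1 - p) * (f x `^ p * w x))%:E)%E}.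
  apply: filterS wpos => x wx _; rewrite lee_fin.
  have sx : 0 < tau * sg x by rewrite mulr_gt0// powR_gt0.
  apply: (le_trans (young_scaling p1 sx (f0 x))).
  rewrite lerD2l powRM ?powR_ge0 ?(ltW t0)// -mulrA ler_wpM2l ?powR_ge0//.
  rewrite /sg -powRrM mulNr -mulrN opprB mulVf ?subr_eq0// powRr1 ?(ltW wx)//.
  by rewrite mulrC.
apply: (@le_trans _ _ (\int[mu]_(x in Q) (tau * sg x + tau `^ (1 - p) * (f x `^ p * w x))%:E)%E).
  apply: ae_ge0_le_integral => //.
  - by move=> x _; rewrite lee_fin.
  - by apply/measurable_EFinP; exact: measurable_funS mf.
  - by move=> x _; rewrite lee_fin addr_ge0// mulr_ge0// ?powR_ge0// ltW.
  - apply/measurable_EFinP; apply: (measurable_funS measurableT) => //.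
    by apply: measurable_funD; apply: measurable_funM => //; exact: measurable_cst.
rewrite (integral_combination mQ msg mp sg0 fp0 (ltW t0) (powR_ge0 _ _)) tp.
apply: leeD => //; apply: (le_trans (lee_wpmul2l _ sgS)); first by rewrite lee_fin ltW.
by rewrite -EFinM lee_fin /tau -mulrA divfK ?gt_eqF.
Qed.

Lemma integral_ae_gt0 (Q : set T) (w : T -> R) : measurable Q -> (0 < mu Q)%E ->
  measurable_fun [set: T] w -> (forall x, 0 <= w x) -> {ae mu, forall x, 0 < w x} ->
  (0 < \int[mu]_(x in Q) (w x)%:E)%E.
Proof.
move=> mQ Q0 mw w0 wpos.
have I0 : (0 <= \int[mu]_(x in Q) (w x)%:E)%E by apply: integral_ge0 => x _; rewrite lee_fin.
rewrite lt_neqAle I0 andbT; apply/eqP => E.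
have E0 : (\int[mu]_(x in Q) `|(w x)%:E| = 0)%E.
  by rewrite E; apply: eq_integral => x _; rewrite gee0_abs ?lee_fin.
have mw' : measurable_fun Q (EFin \o w) by apply/measurable_EFinP; exact: measurable_funS mw.
have /(ae_eq_integral_abs _ mQ mw') w00 := E0.
have [N [mN N0 HN]] : {ae mu, forall x, ~ Q x}.
  apply: filterS2 wpos w00 => x wx H Qx; have [w0x] := H Qx.
  by move: wx; rewrite w0x ltxx.
move: Q0; rewrite ltNge => /negP; apply; rewrite -N0.
by apply: le_measure; rewrite ?inE// => x Qx; apply: HN => /= /(_ Qx).
Qed.

(** Passes from the A_p condition on the set [B], in applications a ball, to a
    subset [Q] of comparable measure; [kap] bounds the ratio of the measures. *)
Lemma muckenhoupt_sets (Q B : set T) (w f : T -> R) (beta q kap C lam : R) :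
  1 <= p -> measurable Q -> measurable B -> Q `<=` B ->
  measurable_fun [set: T] w -> measurable_fun [set: T] f ->
  (forall x, 0 <= w x) -> (forall x, 0 <= f x) -> {ae mu, forall x, 0 < w x} ->
  mu.-integrable B (EFin \o w) -> mu Q = q%:E -> 0 < q -> mu B = beta%:E -> beta <= kap * q ->
  0 < C -> 0 < lam ->
  (if p == 1 then {ae mu, forall y, B y -> (\int[mu]_(x in B) (w x)%:E / mu B <= C%:E * (w y)%:E)%E}
   else ((\int[mu]_(x in B) (w x)%:E / mu B) *
     (\int[mu]_(x in B) (w x `^ (- (p - 1)^-1))%:E / mu B) `^ (p - 1) <= C%:E)%E) ->
  ((\int[mu]_(x in Q) (w x)%:E) * (\int[mu]_(x in Q) (f x)%:E) <=
    q%:E * \int[mu]_(x in Q) (lam * w x + C * kap `^ p * lam `^ (1 - p) * (f x `^ p * w x))%:E)%E.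
Proof.
move=> p1 mQ mB QB mw mf w0 f0 wpos IB muQ q0 muB bk C0 lam0 HC.
have b0 : 0 < beta.
  rewrite -lte_fin -muB; apply: (@lt_le_trans _ _ (mu Q)); first by rewrite muQ lte_fin.
  by apply: le_measure; rewrite ?inE.
have kap0 : 0 < kap by rewrite -(pmulr_lgt0 _ q0) (lt_le_trans b0).
have IQ : mu.-integrable Q (EFin \o w) by exact: integrableS IB.
set Wb := (\int[mu]_(x in B) w x)%R; set Wq := (\int[mu]_(x in Q) w x)%R.
have WbE : (\int[mu]_(x in B) (w x)%:E = Wb%:E)%E by rewrite /Wb /Rintegral fineK//; exact: integrable_fin_num.
have WqE : (\int[mu]_(x in Q) (w x)%:E = Wq%:E)%E by rewrite /Wq /Rintegral fineK//; exact: integrable_fin_num.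
have WQ0 : 0 < Wq by rewrite -lte_fin -WqE; apply: integral_ae_gt0; rewrite ?muQ ?lte_fin.
have WQ : Wq <= Wb.
  rewrite -lee_fin -WqE -WbE; apply: ge0_subset_integral => //; first by apply/measurable_EFinP; exact: measurable_funS mw.
  by move=> x _; rewrite lee_fin.
have W0 : 0 < Wb by exact: lt_le_trans WQ.
have invb : ((mu B)^-1 = (beta^-1)%:E)%E by rewrite muB inver gt_eqF.
have mfp : measurable_fun [set: T] (fun x => f x `^ p * w x).
  by apply: measurable_funM => //; exact: (measurableT_comp (measurable_powR _) mf).
set X := (\int[mu]_(x in Q) (f x `^ p * w x)%:E)%E.
have X0 : (0 <= X)%E by apply: integral_ge0 => x _; rewrite lee_fin mulr_ge0// powR_ge0.
have i1 : measurable_fun Q (fun x => (w x)%:E) by apply/measurable_EFinP; exact: measurable_funS mw.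
have i2 : measurable_fun Q (fun x => (f x `^ p * w x)%:E) by apply/measurable_EFinP; exact: measurable_funS mfp.
have i3 : measurable_fun Q (fun x => (f x)%:E) by apply/measurable_EFinP; exact: measurable_funS mf.
have RHS : (\int[mu]_(x in Q) (lam * w x + C * kap `^ p * lam `^ (1 - p) * (f x `^ p * w x))%:E
    = (lam * Wq)%:E + (C * kap `^ p * lam `^ (1 - p))%:E * X)%E.
  have c0 : 0 <= C * kap `^ p * lam `^ (1 - p) by rewrite !mulr_ge0 ?powR_ge0// ltW.
  have fp0 x : 0 <= f x `^ p * w x by rewrite mulr_ge0// powR_ge0.
  by rewrite (integral_combination mQ mw mfp w0 fp0 (ltW lam0) c0) WqE -EFinM.
rewrite RHS WqE.
case: (eqVneq p 1) HC => [pE|pN] HC.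
- have H : (\int[mu]_(x in Q) (f x)%:E * Wb%:E <= (C * beta)%:E * X)%E.
    rewrite muleC -ge0_integralZl_EFin//; last 2 first.
    - by move=> x _; rewrite lee_fin.
    - exact: ltW.
    rewrite /X -ge0_integralZl_EFin//; last 2 first.
    - by move=> x _; rewrite lee_fin mulr_ge0// powR_ge0.
    - by rewrite mulr_ge0// ltW.
    apply: ae_ge0_le_integral => //.
    - by move=> x _; rewrite -EFinM lee_fin mulr_ge0// ltW.
    - exact: measurable_funeM.
    - by move=> x _; rewrite -EFinM lee_fin !mulr_ge0 ?powR_ge0// ltW.
    - exact: measurable_funeM.
    apply: filterS HC => x + Qx => /(_ (QB _ Qx)).
    rewrite WbE invb -!EFinM !lee_fin ler_pdivrMr// => H.
    rewrite pE powRr1//; have := ler_wpM2r (f0 x) H; lra.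
  rewrite pE subrr powRr0 mulr1 powRr1 ?(ltW kap0)//.
  have fint : (0 <= \int[mu]_(x in Q) (f x)%:E)%E by apply: integral_ge0 => x _; rewrite lee_fin.
  rewrite muleC; apply: (@le_trans _ _ (\int[mu]_(x in Q) (f x)%:E * Wb%:E)%E).
    by rewrite lee_wpmul2l// lee_fin.
  apply: (le_trans H).
  apply: (@le_trans _ _ (q%:E * ((C * kap)%:E * X))%E).
    rewrite muleA -EFinM lee_wpmul2r// lee_fin.
    by rewrite mulrCA ler_wpM2l ?(ltW C0)// mulrC.
  by rewrite lee_wpmul2l ?lee_fin ?(ltW q0)// leeDr// lee_fin mulr_ge0// ltW.
- have p1' : 0 < p - 1 by rewrite subr_gt0 lt_neqAle eq_sym pN.
  move: HC; rewrite !invb WbE -EFinM; set X' := (\int[mu]_(x in B) _)%E => HC.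
  have msg : measurable_fun [set: T] (fun x => w x `^ (- (p - 1)^-1)).
    exact: (measurableT_comp (measurable_powR _) mw).
  have X'0 : (0 < X')%E.
    apply: integral_ae_gt0 => //; first by rewrite muB lte_fin.
      by move=> x; exact: powR_ge0.
    by apply: filterS wpos => x wx; exact: powR_gt0.
  have X'fin : X' \is a fin_num.
    rewrite ge0_fin_numE ?(ltW X'0)// ltey; apply/eqP => Xoo; move: HC; rewrite Xoo.
    by rewrite gt0_mulye ?lte_fin ?invr_gt0// poweRyr ?gt_eqF// gt0_muley ?lte_fin ?divr_gt0.
  move: HC; rewrite -(fineK X'fin); set S := fine X'.
  have S0 : 0 < S by rewrite /S fine_gt0// X'0/= ltey_eq X'fin.
  rewrite -(EFinM S) poweR_EFin -EFinM lee_fin => HC.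
  have sgS : (\int[mu]_(x in Q) (w x `^ (- (p - 1)^-1))%:E <= S%:E)%E.
    rewrite fineK//; apply: ge0_subset_integral => //.
      by apply/measurable_EFinP; exact: measurable_funS msg.
    by move=> x _; rewrite lee_fin powR_ge0.
  have := @young_integral Q w f S q lam p1 mQ mw mf w0 f0 wpos pN q0 S0 lam0 sgS.
  rewrite -/X => H; have Wq0 := ltW WQ0.
  apply: (le_trans (lee_wpmul2l _ H)); first by rewrite lee_fin.
  set c1 := lam `^ (1 - p) * (S / q) `^ (p - 1).
  have c10 : 0 <= c1 by rewrite !mulr_ge0 ?powR_ge0.
  have c20 : 0 <= C * kap `^ p * lam `^ (1 - p) by rewrite !mulr_ge0 ?powR_ge0// ltW.
  have d1 : (0 <= (lam * q)%:E)%E by rewrite lee_fin; exact: mulr_ge0 (ltW lam0) (ltW q0).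
  have d2 : (0 <= (lam * Wq)%:E)%E by rewrite lee_fin; exact: mulr_ge0 (ltW lam0) Wq0.
  have d3 : (0 <= c1%:E * X)%E by apply: mule_ge0 X0.
  have d4 : (0 <= (C * kap `^ p * lam `^ (1 - p))%:E * X)%E by apply: mule_ge0 X0; rewrite lee_fin.
  rewrite (ge0_muleDr _ d1 d3) (ge0_muleDr _ d2 d4) -!EFinM; apply: leeD.
    by rewrite lee_fin; apply: le_of_eq; ring.
  rewrite !muleA -!EFinM lee_wpmul2r// lee_fin.
  have Sb : 0 <= S / beta by rewrite divr_ge0 ?ltW.
  have bq : 0 <= beta / q by rewrite divr_ge0 ?ltW.
  rewrite /c1 (_ : S / q = S / beta * (beta / q)); last by field; rewrite !gt_eqF.
  rewrite (powRM _ Sb bq).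
  have step : Wq * (S / beta) `^ (p - 1) <= C * beta.
    apply: (@le_trans _ _ (Wb / beta * (S / beta) `^ (p - 1) * beta)); last by rewrite ler_pM2r.
    by rewrite mulrAC divfK ?gt_eqF// ler_wpM2r ?powR_ge0.
  have H2 : beta * (beta / q) `^ (p - 1) <= q * kap `^ p.
    rewrite -[X in X * _ <= _](divfK (lt0r_neq0 q0)) (mulrC _ q) -mulrA.
    rewrite mulr_powRB1 ?(lt_le_trans ltr01)// ler_pM2l//.
    by apply: ge0_ler_powR; rewrite ?nnegrE ?(ltW kap0) ?ler_pdivrMr//; exact: le_trans ler01 p1.
  have l1 : 0 <= lam `^ (1 - p) by exact: powR_ge0.
  have := ler_wpM2l l1 (ler_wpM2r (powR_ge0 (beta / q) (p - 1)) step).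
  have := ler_wpM2l l1 (ler_wpM2l (ltW C0) H2).
  lra.
Qed.

Lemma integral_indic_mul (Q A : set T) (w : T -> R) : measurable Q -> measurable A -> A `<=` Q ->
  (\int[mu]_(x in Q) (\1_A x * w x)%:E = \int[mu]_(x in A) (w x)%:E)%E.
Proof.
move=> mQ mA AQ; rewrite integral_mkcond [in RHS]integral_mkcond.
apply: eq_integral => x _; rewrite !patchE indicE.
have [xA|xA] := boolP (x \in A).
  by rewrite ifT ?mul1r//; move: xA; rewrite !inE => /AQ.
by rewrite mul0r if_same.
Qed.

Lemma integral_indic_sub (Q A : set T) : measurable Q -> measurable A -> A `<=` Q ->
  (\int[mu]_(x in Q) (\1_A x)%:E = mu A)%E.
Proof. by move=> mQ mA AQ; rewrite integral_indic// (setIidl AQ). Qed.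
End abstract_muckenhoupt.

Section abstract_Lp.
Context (R : realType) (disp : measure_display) (T : measurableType disp) (mu : {measure set T -> \bar R}).

Lemma ae_finite_integral (Q : set T) (u : T -> \bar R) (w : T -> R) (q : R) : 0 < q -> measurable Q ->
  measurable_fun [set: T] u -> measurable_fun [set: T] w ->
  (forall x, 0 <= w x) -> {ae mu, forall x, 0 < w x} ->
  (\int[mu]_(x in Q) (`|u x| `^ q * (w x)%:E) < +oo)%E -> {ae mu, forall x, Q x -> u x \is a fin_num}.
Proof.
move=> q0 mQ mu_ mw w0 wpos Ioo.
pose F x := (`|u x| `^ q * (w x)%:E)%E.
have mF : measurable_fun [set: T] F.
  apply: emeasurable_funM; last exact/measurable_EFinP.
  by apply: (measurableT_comp (measurable_poweR _)); exact: measurableT_comp.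
have IF : mu.-integrable Q F.
  apply/integrableP; split; first exact: measurable_funS mF.
  rewrite (eq_integral F)// => x _; rewrite gee0_abs// mule_ge0 ?poweR_ge0//.
  by rewrite lee_fin.
have := integrable_ae mQ IF; apply: filterS2 wpos => x wx H /H; rewrite /F.
case: (u x) => [r _//| |]; rewrite /= gt_eqF// mulyr gtr0_sg// mul1e//.
Qed.

Lemma integral_fine_le (Q : set T) (u : T -> \bar R) (w : T -> R) (q : R) : 0 < q -> measurable Q ->
  measurable_fun [set: T] u -> measurable_fun [set: T] w -> (forall x, 0 <= w x) ->
  (\int[mu]_(x in Q) (`|fine (u x)| `^ q * w x)%:E <= \int[mu]_(x in Q) (`|u x| `^ q * (w x)%:E))%E.
Proof.
move=> q0 mQ mu_ mw w0.
have mF : measurable_fun [set: T] (fun x => `|u x| `^ q * (w x)%:E)%E.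
  apply: emeasurable_funM; last exact/measurable_EFinP.
  by apply: (measurableT_comp (measurable_poweR _)); exact: measurableT_comp.
have mf : measurable_fun [set: T] (fun x => `|fine (u x)| `^ q * w x).
  apply: measurable_funM => //; apply: (measurableT_comp (measurable_powR _)).
  by apply: measurableT_comp => //; exact: measurableT_comp.
apply: ge0_le_integral => //.
- by move=> x _; rewrite lee_fin mulr_ge0// powR_ge0.
- by apply/measurable_EFinP; exact: measurable_funS mf.
- exact: measurable_funS mF.
- move=> x _; case: (u x) => [r| |] /=.
  + by rewrite -EFinM.
  + by rewrite normr0 powR0 ?gt_eqF// mul0r mule_ge0 ?poweR_ge0// lee_fin.
  + by rewrite normr0 powR0 ?gt_eqF// mul0r mule_ge0 ?poweR_ge0// lee_fin.
Qed.

Lemma ae_countable_cover (Q : nat -> set T) (P : T -> Prop) : (forall n, {ae mu, forall x, Q n x -> P x}) ->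
  (forall x, exists n, Q n x) -> {ae mu, forall x, P x}.
Proof.
move=> H cov.
have N0 n : mu.-negligible (~` [set x | Q n x -> P x]) by exact: H.
apply: (negligibleS _ (negligible_bigcup N0)) => x nP.
by have [n xn] := cov x; exists n => //= h; apply: nP; exact: h.
Qed.

End abstract_Lp.

Section muckenhoupt.
Variables (R : realType) (d : nat).
Local Notation rV := 'rV[R]_d.
Local Notation T := (lebesgue_space R d).
Local Notation mu := (@leb R d).

Lemma enorm_sub (y z : rV) : enorm (y - z) = Num.sqrt (\sum_(i < d) (y ord0 i - z ord0 i) ^+ 2).
Proof. by rewrite /enorm; congr Num.sqrt; apply: eq_bigr => i _; rewrite !mxE. Qed.

Lemma measurable_eball (z : rV) (r : R) : measurable (eball z r : set T).
Proof.
have mf : measurable_fun [set: T] ((fun y => enorm (y - z)) : T -> measurableTypeR R).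
  rewrite (_ : (fun y => _) = (Num.sqrt : R -> R) \o (fun y : rV => \sum_(i < d) (y ord0 i - z ord0 i) ^+ 2)).
    apply: measurableT_comp; first by apply: continuous_measurable_fun; exact: sqrt_continuous.
    apply: measurable_sum => i; apply: measurable_funX; apply: measurable_funB; [exact: measurable_coordinate|exact: measurable_cst].
  by apply/funext => y; rewrite enorm_sub.
have := mf measurableT _ (measurable_itv `]-oo, r[); rewrite setTI.
by congr measurable; apply/seteqP; split => y; rewrite /eball /= in_itv.
Qed.

Lemma coord_le_enorm (x : rV) i : `|x ord0 i| <= enorm x.
Proof.
rewrite /enorm -sqrtr_sqr ler_wsqrtr// (bigD1 i)//= lerDl.
by apply: sumr_ge0 => j _; exact: sqr_ge0.
Qed.

Lemma eball_sub_qbox (z : rV) (r : R) : eball z r `<=` qbox (\row_i (z ord0 i - r)) (2 * r).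
Proof.
move=> y yr; apply/qboxP => i; have := le_lt_trans (coord_le_enorm (y - z) i) yr.
by rewrite !mxE ltr_norml; lra.
Qed.

Lemma enorm_le (x : rV) (m : R) : 0 <= m -> (forall i, `|x ord0 i| <= m) -> enorm x <= d%:R * m.
Proof.
move=> m0 H; rewrite /enorm -[leRHS]ger0_norm ?mulr_ge0// -sqrtr_sqr ler_wsqrtr//.
apply: (@le_trans _ _ (\sum_(i < d) m ^+ 2)).
  apply: ler_sum => i _; rewrite -[X in X <= _]real_normK ?num_real//.
  by rewrite ler_pXn2r ?nnegrE.
rewrite sumr_const card_ord exprMn -[_ *+ d]mulr_natl; apply: ler_wpM2r; first exact: sqr_ge0.
rewrite -natrX ler_nat.
by case: d => // n; rewrite leq_pmull.
Qed.

Lemma qbox_sub_eball (a : rV) (l : R) : 0 < l -> qbox a l `<=` eball a (d.+1%:R * l).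
Proof.
move=> l0 x /qboxP H; rewrite /eball /=.
apply: (@le_lt_trans _ _ (d%:R * l)); last by rewrite ltr_pM2r// ltr_nat.
apply: enorm_le; first exact: ltW.
by move=> i; rewrite !mxE ler_norml; have := H i; lra.
Qed.

Variables (p : R) (w : rV -> R).
Hypotheses (p1 : 1 <= p) (hw : muckenhoupt p w).

Lemma muckenhoupt_ge0 x : 0 <= w x. Proof. by have [] := hw. Qed.

Lemma muckenhoupt_box_integrable : box_integrable w.
Proof. by apply: loc_integrable_box; have [] := hw. Qed.

Definition wmass (a : rV) (l : R) : R := (\int[mu]_(x in qbox a l) w x)%R.

Lemma wmassE a l : (\int[mu]_(x in qbox a l) (w x)%:E = (wmass a l)%:E)%E.
Proof.
rewrite /wmass /Rintegral fineK//; apply: integrable_fin_num; first exact: measurable_qbox.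
exact: box_integrable_qbox muckenhoupt_box_integrable.
Qed.

Lemma wmass_gt0 a l : 0 < l -> 0 < wmass a l.
Proof.
move=> l0; have [w0 _ wpos _] := hw; rewrite -lte_fin -wmassE.
apply: integral_ae_gt0 => //; first exact: measurable_qbox.
  rewrite [X in (_ < X)%E](_ : _ = (l ^+ d)%:E); last exact: leb_qbox (ltW l0).
  by rewrite lte_fin exprn_gt0.
exact: muckenhoupt_box_integrable.1.
Qed.

(** The A_p inequality in a form that is linear in [f `^ p * w], hence additive
    over disjoint cubes, as the summation over the dyadic tree of a cube requires.
    Minimising in [lam] gives back, up to a constant, a bound of Hoelder type. *)
Definition averaging_constant (K : R) := forall a l, 0 < l ->
  forall (f : rV -> R) lam, measurable_fun [set: T] (f : T -> measurableTypeR R) ->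
  (forall x, 0 <= f x) -> 0 < lam ->
  ((\int[mu]_(x in qbox a l) (w x)%:E) * (\int[mu]_(x in qbox a l) (f x)%:E) <=
    (l ^+ d)%:E * \int[mu]_(x in qbox a l) (lam * w x + K * lam `^ (1 - p) * (f x `^ p * w x))%:E)%E.

Lemma muckenhoupt_qbox : exists2 K, 0 < K & averaging_constant K.
Proof.
have [w0 _ wpos [C C1 HC]] := hw.
have C0 : 0 < C by lra.
pose kap : R := (2 * d.+1%:R) ^+ d.
have kap0 : 0 < kap by rewrite exprn_gt0// mulr_gt0.
exists (C * kap `^ p); first by rewrite mulr_gt0// powR_gt0.
move=> a l l0 f lam mf f0 lam0.
set r := d.+1%:R * l; have r0 : 0 < r by rewrite mulr_gt0.
set B := eball a r.
have mB : measurable (B : set T) by exact: measurable_eball.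
have QB : qbox a l `<=` B by exact: qbox_sub_eball.
have mQ := measurable_qbox a l.
have Q2 := eball_sub_qbox (z := a) (r := r).
set a2 := \row_i (a ord0 i - r) in Q2.
have bfin : (mu B <= (kap * l ^+ d)%:E)%E.
  apply: (@le_trans _ _ (mu (qbox a2 (2 * r)))).
    by apply: le_measure; rewrite ?inE//; exact: measurable_qbox.
  rewrite [X in (X <= _)%E](_ : _ = ((2 * r) ^+ d)%:E); last by apply: leb_qbox; rewrite mulr_ge0// ltW.
  by rewrite lee_fin /r mulrA exprMn.
have Bfin : mu B \is a fin_num by rewrite ge0_fin_numE; [exact: le_lt_trans bfin (ltry _)|exact: measure_ge0].
have ld0 : 0 < l ^+ d by rewrite exprn_gt0.
have IB : mu.-integrable B (EFin \o w).
  apply: (@integrableS _ _ _ mu (qbox a2 (2 * r)) B _ (measurable_qbox a2 (2 * r)) mB Q2).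
  exact: box_integrable_qbox muckenhoupt_box_integrable.
apply: (@muckenhoupt_sets R _ T mu p (qbox a l) B w f (fine (mu B)) (l ^+ d) kap C lam p1
  mQ mB QB muckenhoupt_box_integrable.1 mf w0 f0 wpos IB _ ld0 _ _ C0 lam0).
- exact: leb_qbox (ltW l0).
- by rewrite fineK.
- by rewrite -lee_fin fineK.
- exact: HC a r r0.
Qed.

Section mass.
Variable K : R.
Hypothesis K0 : 0 < K.
Hypothesis HK : averaging_constant K.

Lemma qbox_integral_combination a l (f : rV -> R) (lam k : R) :
  measurable_fun [set: T] (f : T -> measurableTypeR R) -> (forall x, 0 <= f x) -> 0 <= lam -> 0 <= k ->
  (\int[mu]_(x in qbox a l) (lam * w x + k * f x)%:E =
   (lam * wmass a l)%:E + k%:E * \int[mu]_(x in qbox a l) (f x)%:E)%E.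
Proof.
move=> mf f0 lam0 k0.
rewrite EFinM -wmassE.
exact: (@integral_combination R _ T mu (qbox a l) w f lam k (measurable_qbox a l)
  muckenhoupt_box_integrable.1 mf muckenhoupt_ge0 f0 lam0 k0).
Qed.

(** The averaging inequality for the indicator of the smaller cube, with [lam] equal
    to half the ratio of the volumes so that the first term is absorbed. *)
Lemma wmass_doubling a l a' l' : 0 < l -> 0 < l' -> qbox a' l' `<=` qbox a l ->
  ((l' / l) ^+ d / 2) `^ p * wmass a l <= K * wmass a' l'.
Proof.
move=> l0 l'0 QQ.
pose f : rV -> R := \1_(qbox a' l').
have mf : measurable_fun [set: T] (f : T -> measurableTypeR R).
  by apply: measurable_indic; exact: measurable_qbox.
have f0 x : 0 <= f x by rewrite /f indicE.
have mfw : measurable_fun [set: T] ((fun x => f x * w x) : T -> measurableTypeR R).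
  by apply: measurable_funM => //; exact: muckenhoupt_box_integrable.1.
set lam := (l' / l) ^+ d / 2.
have lam0 : 0 < lam by rewrite divr_gt0// exprn_gt0// divr_gt0.
have c0 : 0 <= K * lam `^ (1 - p) by rewrite mulr_ge0 ?powR_ge0// ltW.
have p0 : p != 0 by rewrite gt_eqF// (lt_le_trans ltr01 p1).
have := HK a l0 mf f0 lam0.
have -> : (\int[mu]_(x in qbox a l) (lam * w x + K * lam `^ (1 - p) * (f x `^ p * w x))%:E =
  (lam * wmass a l + K * lam `^ (1 - p) * wmass a' l')%:E)%E.
  transitivity (\int[mu]_(x in qbox a l) (lam * w x + K * lam `^ (1 - p) * (f x * w x))%:E)%E.
    apply: eq_integral => x _; congr (_ + _ * (_ * _))%:E.
    by rewrite /f indicE; case: (_ \in _); rewrite ?powR1// powR0.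
  rewrite qbox_integral_combination ?(ltW lam0)//; last by move=> x; rewrite mulr_ge0// muckenhoupt_ge0.
  rewrite [RHS]EFinD (EFinM (K * _) (wmass a' l')) -(wmassE a' l'); congr (_ + _ * _)%E.
  exact: (@integral_indic_mul R _ T mu (qbox a l) (qbox a' l') w (measurable_qbox a l) (measurable_qbox a' l') QQ).
have -> : (\int[mu]_(x in qbox a l) (f x)%:E = (l' ^+ d)%:E)%E.
  rewrite -(leb_qbox a' (ltW l'0)).
  exact: (@integral_indic_sub R _ T mu (qbox a l) (qbox a' l') (measurable_qbox a l) (measurable_qbox a' l') QQ).
rewrite wmassE -!EFinM lee_fin => H.
have ld : 0 < l ^+ d by rewrite exprn_gt0.
have E : l' ^+ d = 2 * lam * l ^+ d by rewrite /lam expr_div_n; field; rewrite gt_eqF.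
have H2 : lam * wmass a l <= K * lam `^ (1 - p) * wmass a' l'.
  rewrite -(ler_pM2l ld); move: H; rewrite E mulrDr; lra.
have := ler_wpM2l (powR_ge0 lam (p - 1)) H2.
rewrite (_ : K * lam `^ (1 - p) * wmass a' l' = lam `^ (1 - p) * (K * wmass a' l')); last by ring.
clear H; clearbody lam.
have E1 : lam `^ (p - 1) * lam `^ (1 - p) = 1.
  have E0 : p - 1 + (1 - p) = 0 by ring.
  by rewrite -powRD E0 ?powRr0// eqxx gt_eqF.
have E2 : lam * lam `^ (p - 1) = lam `^ p by rewrite mulr_powRB1 ?(ltW lam0)// (lt_le_trans ltr01 p1).
by rewrite (mulrA _ lam) (mulrC _ lam) E2 (mulrA _ (lam `^ (1 - p))) E1 mul1r.
Qed.

End mass.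

Lemma closed_box_sub_qbox (a b : rV) : exists2 l, 0 < l & closed_box a b `<=` qbox a l.
Proof.
pose l := 1 + \sum_(i < d) `|b ord0 i - a ord0 i|.
exists l => [|x abx]; first by rewrite ltr_pwDl// sumr_ge0.
apply/qboxP => i; have /andP[-> /= h] := abx i.
apply: (le_lt_trans h); rewrite -ltrBlDl.
apply: (@le_lt_trans _ _ `|b ord0 i - a ord0 i|); first exact: ler_norm.
by rewrite /l (bigD1 i)//= addrCA ltrDl ltr_pwDl// sumr_ge0.
Qed.

Lemma box_integrable_of_qbox (f : rV -> R) : measurable_fun [set: T] (f : T -> measurableTypeR R) ->
  (forall a l, 0 < l -> (\int[mu]_(x in qbox a l) `|f x|%:E < +oo)%E) -> box_integrable f.
Proof.
move=> mf H; split=> // a b.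
have [l l0 sub] := closed_box_sub_qbox a b.
apply: (@integrableS _ _ _ mu (qbox a l) _ _ (measurable_qbox a l) (measurable_closed_box a b) sub).
apply/integrableP; split; last exact: H.
by apply/measurable_EFinP; exact: measurable_funS mf.
Qed.

Lemma ae_of_qbox (P : T -> Prop) : (forall n : nat, {ae mu, forall x, qbox (\row__ (- n%:R)) (2 * n%:R) x -> P x}) ->
  {ae mu, forall x, P x}.
Proof.
move=> H; apply: (@ae_countable_cover R _ T mu (fun n => qbox (\row__ (- n%:R)) (2 * n%:R)) P H).
move=> x; exists (Num.truncn (\sum_(i < d) `|x ord0 i|)).+1; apply/qboxP => i; rewrite mxE.
have xi : `|x ord0 i| < (Num.truncn (\sum_(i < d) `|x ord0 i|)).+1%:R.
  apply: le_lt_trans (truncnS_gt _); rewrite (bigD1 i)//= lerDl sumr_ge0//.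
by move: xi; rewrite ltr_norml => /andP[h1 h2]; rewrite ltW//=; lra.
Qed.

Section Lp.
Variable u : rV -> \bar R.
Hypothesis hu : Lp_loc p w u.

Let mu_ : measurable_fun [set: T] (u : T -> \bar R) := hu.1.
Let mw : measurable_fun [set: T] (w : T -> measurableTypeR R) := muckenhoupt_box_integrable.1.
Let p0 : 0 < p := lt_le_trans ltr01 p1.

Lemma Lp_loc_qbox a l : (\int[mu]_(x in qbox a l) (`|u x| `^ p * (w x)%:E) < +oo)%E.
Proof.
have := hu.2 _ (@compact_closed_box R d a (\row_j (a ord0 j + l))).
apply: le_lt_trans; apply: ge0_subset_integral.
- exact: measurable_qbox.
- exact: measurable_closed_box.
- apply: emeasurable_funM; last by apply/measurable_EFinP; exact: measurable_funS mw.
  by apply: (measurableT_comp (measurable_poweR _)); apply: measurableT_comp => //; exact: measurable_funS mu_.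
- by move=> x _; rewrite mule_ge0 ?poweR_ge0// lee_fin muckenhoupt_ge0.
- by move=> x xb i; have := xb i; rewrite !mxE => /andP[-> /ltW].
Qed.

(** A positive weight makes the integrand infinite where [u] is. *)
Lemma Lp_loc_finite : {ae mu, forall x, u x \is a fin_num}.
Proof.
have [_ _ wpos _] := hw; apply: ae_of_qbox => n.
exact: (@ae_finite_integral R _ T mu _ u w p p0 (measurable_qbox _ _) mu_ mw muckenhoupt_ge0 wpos (Lp_loc_qbox _ _)).
Qed.

(** Muckenhoupt weights are such that [L^p_loc(w)] embeds into [L^1_loc]. *)
Lemma Lp_loc_box_integrable : box_integrable (fine \o u).
Proof.
have [K K0 HK] := muckenhoupt_qbox.
have mU : measurable_fun [set: T] (fine \o u : T -> measurableTypeR R).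
  exact: measurableT_comp.
have mf : measurable_fun [set: T] ((fun x => `|fine (u x)|) : T -> measurableTypeR R).
  exact: (measurableT_comp (@normr_measurable R setT) mU).
have mfw : measurable_fun [set: T] ((fun x => `|fine (u x)| `^ p * w x) : T -> measurableTypeR R).
  by apply: measurable_funM; [exact: (measurableT_comp (measurable_powR _) mf)|exact: mw].
have f0 x : 0 <= `|fine (u x)| by [].
apply: (box_integrable_of_qbox mU) => a l l0.
have := HK a l l0 _ 1 mf f0 ltr01.
rewrite powR1 mulr1 qbox_integral_combination ?(ltW K0)//; last first.
  by move=> x; rewrite mulr_ge0 ?powR_ge0 ?muckenhoupt_ge0.
have fin := le_lt_trans (@integral_fine_le R _ T mu _ u w p p0 (measurable_qbox a l) mu_ mw muckenhoupt_ge0) (Lp_loc_qbox a l).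
have W0 := wmass_gt0 a l0.
rewrite wmassE; case: (\int[mu]_(x in qbox a l) `|fine (u x)|%:E)%E => [r| |]; rewrite ?ltry ?ltNyr//.
rewrite gt0_muley ?lte_fin// leye_eq => /eqP E; exfalso; move: E.
apply/eqP; rewrite lt_eqF// lte_mul_pinfty ?lee_fin ?exprn_ge0 ?(ltW l0)//.
by rewrite lte_add_pinfty ?ltry// lte_mul_pinfty ?lee_fin// ltW.
Qed.

End Lp.

End muckenhoupt.

(** * Means over large or distant cubes *)

Section chains.
Variable R : realType.

Lemma geometric_chain (M : nat -> R) (B rho : R) n : 0 <= B -> 0 <= rho -> rho < 1 ->
  (forall k, (k < n)%N -> `|M k.+1 - M k| <= B * rho ^+ k) -> `|M n - M 0%N| <= B / (1 - rho).
Proof.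
move=> B0 r0 r1 H.
have r1' : 0 < 1 - rho by rewrite subr_gt0.
suff : forall m, (m <= n)%N -> `|M m - M 0%N| <= B * (1 - rho ^+ m) / (1 - rho).
  move=> /(_ n (leqnn n)) /le_trans; apply.
  by rewrite ler_pM2r ?invr_gt0// ler_piMr// lerBlDr lerDl exprn_ge0.
elim=> [_|m IH mn]; first by rewrite subrr normr0 expr0 subrr mulr0 mul0r.
rewrite (_ : M m.+1 - M 0%N = (M m.+1 - M m) + (M m - M 0%N)); last by ring.
apply: (le_trans (ler_normD _ _)); apply: (le_trans (lerD (H m mn) (IH (ltnW mn)))).
by apply: le_of_eq; rewrite exprS; field; rewrite gt_eqF.
Qed.

Lemma geometric_chain_cvg (M : nat -> R) (B rho : R) : 0 <= B -> 0 <= rho -> rho < 1 ->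
  (forall k, `|M k.+1 - M k| <= B * rho ^+ k) -> cvgn M.
Proof.
move=> B0 r0 r1 H.
have H1 : cvgn (series (telescope M)).
  apply: normed_cvg; apply: (series_le_cvg _ _ H); first by move=> n /=.
    by move=> n /=; rewrite mulr_ge0// exprn_ge0.
  exact: (@is_cvg_geometric_series R B rho (eq_ind_r (fun t => t < 1) r1 (ger0_norm r0))).
rewrite (_ : M = (fun n => M 0%N + series (telescope M) n)); last first.
  by apply/funext => n; exact: eq_sum_telescope.
by apply: is_cvgD => //; exact: is_cvg_cst.
Qed.

Lemma geometric_chain_lim (M : nat -> R) (B rho c : R) : 0 <= B -> 0 <= rho -> rho < 1 ->
  (forall k, `|M k.+1 - M k| <= B * rho ^+ k) -> M @ \oo --> c -> `|M 0%N - c| <= B / (1 - rho).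
Proof.
move=> B0 r0 r1 H Mc.
have H1 : `|M 0%N - M n| @[n --> \oo] --> `|M 0%N - c| by apply: cvg_norm; apply: cvgB => //; exact: cvg_cst.
apply: (cvgr_to_le H1); apply: nearW => n; rewrite distrC.
by apply: geometric_chain => // k _.
Qed.

Lemma doubling_edge (l : R) : 1 <= l -> exists k : nat, 2 ^+ k <= l < 2 ^+ k.+1.
Proof.
move=> l1; set P := fun n => l < 2 ^+ n.+1.
have exP : exists n, P n.
  exists (Num.truncn l); rewrite /P (lt_le_trans (truncnS_gt l))//.
  by rewrite -natrX ler_nat ltnW// ltn_expl.
case: (ex_minnP exP) => -[|k] Pk min; first by exists 0%N; rewrite expr0 l1.
exists k.+1; rewrite (Pk : l < _) andbT leNgt; apply/negP => h.
by have := min k h; rewrite ltnn.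
Qed.

End chains.

Section abstract_average.
Context (R : realType) (disp : measure_display) (T : measurableType disp) (mu : {measure set T -> \bar R}).

(** The weighted average of [U - m] is at most that of its absolute value. *)
Lemma weighted_average_bound (Q : set T) (U w : T -> R) (m B W : R) : measurable Q ->
  measurable_fun [set: T] U -> measurable_fun [set: T] w -> (forall x, 0 <= w x) ->
  (\int[mu]_(x in Q) (w x)%:E = W%:E)%E -> 0 < W ->
  (\int[mu]_(x in Q) (`|U x - m| * w x)%:E <= (B * W)%:E)%E ->
  mu.-integrable Q (EFin \o (fun x => U x * w x)) /\
  `|(\int[mu]_(x in Q) (U x * w x))%R / W - m| <= B.
Proof.
move=> mQ mU mw w0 WE W0 H.
have mUm : measurable_fun [set: T] (fun x => (U x - m) * w x).
  by apply: measurable_funM => //; apply: measurable_funB => //; exact: measurable_cst.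
have Iw : mu.-integrable Q (EFin \o w).
  apply/integrableP; split; first by apply/measurable_EFinP; exact: measurable_funS mw.
  rewrite (eq_integral (fun x => (w x)%:E)) ?WE ?ltry// => x _.
  by rewrite /= ger0_norm.
have IU : mu.-integrable Q (EFin \o (fun x => (U x - m) * w x)).
  apply/integrableP; split; first by apply/measurable_EFinP; exact: measurable_funS mUm.
  apply: le_lt_trans (ltry (B * W)); apply: le_trans H; apply: le_of_eq.
  by apply: eq_integral => x _ /=; rewrite normrM (ger0_norm (w0 x)).
have IwN := integrableZr_EFin (- m) mQ Iw.
have E : (fun x => U x * w x) = (fun x => ((U x - m) * w x) * 1 - (w x * - m) * 1).
  by apply/funext => x; ring.
have IUw : mu.-integrable Q (EFin \o (fun x => U x * w x)).
  rewrite E (_ : _ \o _ = ((EFin \o (fun x => ((U x - m) * w x)%R)) \- (EFin \o (fun x => (w x * - m)%R)))%E).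
    exact: integrableB.
  by apply/funext => x /=; rewrite !mulr1 EFinB.
split=> //.
have WR : (\int[mu]_(x in Q) w x)%R = W by rewrite /Rintegral WE.
have E2 : (\int[mu]_(x in Q) (U x * w x))%R = (\int[mu]_(x in Q) ((U x - m) * w x))%R + m * W.
  by rewrite E Rintegral_combination// RintegralZr// WR; ring.
rewrite E2 (_ : _ / W - m = (\int[mu]_(x in Q) ((U x - m) * w x))%R / W); last by field; rewrite gt_eqF.
rewrite normrM (gtr0_norm (_ : 0 < W^-1)) ?invr_gt0// ler_pdivrMr//.
apply: (le_trans (le_normr_Rintegral mQ IU)).
rewrite -lee_fin /Rintegral fineK.
  apply: le_trans H; apply: le_of_eq.
  by apply: eq_integral => x _ /=; rewrite normrM (ger0_norm (w0 x)).
by apply: integrable_fin_num => //; exact: (integrable_norm IU).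
Qed.

Lemma integral_tail (f : T -> R) (D : nat -> set T) (e : R) : (forall n, measurable (D n)) ->
  (forall x, 0 <= f x) -> mu.-integrable [set: T] (EFin \o f) ->
  (forall x, \forall n \near \oo, D n x) -> 0 < e ->
  exists n, (\int[mu]_(x in ~` D n) f x <= e)%R.
Proof.
move=> mD f0 If covD e0.
have mf : measurable_fun [set: T] f by apply/measurable_EFinP; have /integrableP[] := If.
have mDC n : measurable (~` D n) by exact: measurableC.
have [] := @dominated_convergence _ _ _ mu [set: T] measurableT
  (fun n x => (f x * \1_(~` D n) x)%:E) (cst 0%E) (EFin \o f).
- by move=> n; apply/measurable_EFinP; apply: measurable_funM => //; exact: measurable_indic.
- exact: measurable_cst.
- apply: aeW => x _; apply: cvg_near_cst; have [N _ HN] := covD x; exists N => // n Nn.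
  by rewrite indicE memNset ?mulr0// => /(_ (HN n Nn)).
- exact: If.
- apply: aeW => x n _; rewrite lee_fin normrM (ger0_norm (f0 x)) ler_piMr// indicE.
  by case: (_ \in _); rewrite ?normr1 ?normr0.
move=> _ _; rewrite integral0 => H.
have H2 n : (\int[mu]_x (f x * \1_(~` D n) x)%:E = \int[mu]_(x in ~` D n) (f x)%:E)%E.
  rewrite [RHS]integral_mkcond; apply: eq_integral => x _.
  by rewrite patchE indicE; case: ifPn => _; rewrite ?mulr1 ?mulr0.
have : (\int[mu]_(x in ~` D n) f x)%R @[n --> \oo] --> (0 : R).
  apply: fine_cvg; apply: cvg_trans H; apply: near_eq_cvg.
  by apply: nearW => n; rewrite -H2.
move=> /cvgrPdist_le /(_ _ e0)[N _ HN]; exists N.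
by have := HN N (leqnn N); rewrite sub0r normrN; apply: le_trans; exact: ler_norm.
Qed.

End abstract_average.

Section mass_growth.
Variables (R : realType) (d : nat).
Local Notation rV := 'rV[R]_d.
Local Notation T := (lebesgue_space R d).
Local Notation mu := (@leb R d).
Variables (p : R) (w : rV -> R).
Hypotheses (p1 : 1 <= p) (hw : muckenhoupt p w).

Let mw : measurable_fun [set: T] (w : T -> measurableTypeR R) := (muckenhoupt_box_integrable hw).1.

Lemma wmass_sub a l a' l' : qbox a' l' `<=` qbox a l -> wmass w a' l' <= wmass w a l.
Proof.
move=> sub; apply: (Rintegral_sub (muckenhoupt_ge0 hw) (measurable_qbox a' l') (measurable_qbox a l) sub).
exact: box_integrable_qbox (muckenhoupt_box_integrable hw).
Qed.

(** A cube is tiled by [2 ^ d] cubes of half its edge. *)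
Lemma wmass_double_edge (m l : R) : 0 < l -> (forall a, m <= wmass w a l) ->
  forall a, m * 2 ^+ d <= wmass w a (2 * l).
Proof.
move=> l0 H a.
have E : wmass w a (2 * l) = \sum_(v : bits d) wmass w (node_corner a (2 * l) [:: v]) l.
  apply: EFin_inj; rewrite -(wmassE hw) -(node0 a (2 * l)).
  transitivity (\sum_(v : bits d) \int[mu]_(x in node a (2 * l) [:: v]) (w x)%:E)%E.
    have l20 : 0 < 2 * l by exact: mulr_gt0.
    exact: (@integral_children R _ T mu (bits d) (node a (2 * l)) (@measurable_node R d a (2 * l))
      (@node_children R d a (2 * l) l20) (@node_disjoint R d a (2 * l)) [::] w mw).
  rewrite -sumEFin; apply: eq_bigr => v _; rewrite -(wmassE hw) /node.
  by rewrite (_ : node_edge _ [:: v] = l)// /node_edge /= expr1; field.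
rewrite E; apply: (@le_trans _ _ (\sum_(v : bits d) m)); last exact: ler_sum.
rewrite sumr_const (_ : #|_| = (2 ^ d)%N); last by rewrite card_ffun card_bool card_ord.
by rewrite -(mulr_natr m) natrX.
Qed.

(** Tilings by unit cubes give growth of order [l ^+ d] for [1 <= l]; the doubling
    inequality takes care of the edges between [delta] and 1. *)
Lemma wmass_growth (m delta : R) : 0 < m -> 0 < delta -> (forall a, m <= wmass w a 1) ->
  exists2 c, 0 < c & forall a l, delta <= l -> c * l ^+ d <= wmass w a l.
Proof.
move=> m0 delta0 H; have [K K0 HK] := muckenhoupt_qbox p1 hw.
have H2 k a : m * (2 ^+ k) ^+ d <= wmass w a (2 ^+ k).
  elim: k a => [|k IH] a; first by rewrite expr0 expr1n mulr1.
  rewrite exprS exprMn mulrCA mulrC.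
  by apply: wmass_double_edge => //; rewrite exprn_gt0.
set c1 := m / 2 ^+ d; set c2 := (delta ^+ d / 2) `^ p / K * m.
have c10 : 0 < c1 by rewrite divr_gt0// exprn_gt0.
have c20 : 0 < c2 by rewrite mulr_gt0// divr_gt0// powR_gt0// divr_gt0// exprn_gt0.
exists (Num.min c1 c2); first by rewrite lt_min c10.
move=> a l dl; have l0 : 0 < l by exact: lt_le_trans dl.
have [l1|l1] := leP 1 l.
  apply: (@le_trans _ _ (c1 * l ^+ d)).
    by rewrite ler_wpM2r ?exprn_ge0 ?(ltW l0)// ge_min lexx.
  have [k /andP[k1 k2]] := doubling_edge l1.
  apply: (@le_trans _ _ (m * (2 ^+ k) ^+ d)).
    rewrite /c1 -mulrA ler_wpM2l ?(ltW m0)// ler_pdivrMl ?exprn_gt0//.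
    by rewrite -exprMn -exprS; apply: lerXn2r; rewrite ?nnegrE ?exprn_ge0 ?(ltW l0) ?(ltW k2).
  apply: (le_trans (H2 k a)); apply: wmass_sub; apply: qbox_sub => // i.
  by rewrite lerD2l.
apply: (@le_trans _ _ c2).
  apply: (@le_trans _ _ (c2 * l ^+ d)).
    by rewrite ler_wpM2r ?exprn_ge0 ?(ltW l0)// ge_min lexx orbT.
  by rewrite ler_piMr ?(ltW c20)// exprn_ile1 ?ltW.
have := wmass_doubling p1 hw K0 HK ltr01 l0 (@qbox_sub R d a a 1 l _ _).
rewrite divr1 => D.
rewrite /c2 -mulrA mulrC -mulrA ler_pdivrMl// mulrC.
apply: le_trans (D _ _); last 2 first.
- by [].
- by move=> i; rewrite lerD2l ltW.
apply: ler_pM; rewrite ?powR_ge0 ?(ltW m0)//.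
apply: ge0_ler_powR; rewrite ?nnegrE ?divr_ge0 ?exprn_ge0 ?(ltW delta0) ?(ltW l0)//.
  exact: le_trans ler01 p1.
rewrite ler_pM2r ?invr_gt0//; apply: lerXn2r; rewrite ?nnegrE ?(ltW l0) ?(ltW delta0)//.
Qed.

End mass_growth.

Section limit.
Variables (R : realType) (d : nat).
Local Notation rV := 'rV[R]_d.
Local Notation T := (lebesgue_space R d).
Local Notation mu := (@leb R d).
Variables (p : R) (w : rV -> R).
Hypotheses (p1 : 1 <= p) (pd : p < d%:R) (hw : muckenhoupt p w).
Variables (U : rV -> R) (g : 'I_d -> rV -> R) (G : rV -> R).
Hypotheses (IU : box_integrable U) (Ig : forall i, box_integrable (g i)) (IG : box_integrable G).
Hypothesis gG : forall i x, `|g i x| <= G x.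
Hypothesis weak : forall i (phi : rV -> R), test_function phi ->
  (\int[mu]_x (U x * partial i phi x) = - \int[mu]_x (g i x * phi x))%R.
Hypothesis IE : mu.-integrable [set: T] (EFin \o (fun x => G x `^ p * w x)).

Let p0 : 0 < p. Proof. exact: lt_le_trans ltr01 p1. Qed.
Let d0 : (0 < d)%N. Proof. by rewrite -(ltr_nat R); exact: lt_trans pd. Qed.
Let G0 x : 0 <= G x. Proof. exact: le_trans (normr_ge0 (g (Ordinal d0) x)) (gG _ x). Qed.
Let w0 := muckenhoupt_ge0 hw.
Let mw : measurable_fun [set: T] (w : T -> measurableTypeR R) := (muckenhoupt_box_integrable hw).1.
Let mE : measurable_fun [set: T] ((fun x => G x `^ p * w x) : T -> measurableTypeR R).
Proof. by apply/measurable_EFinP; have /integrableP[] := IE. Qed.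
Let E0 x : 0 <= G x `^ p * w x. Proof. by rewrite mulr_ge0 ?powR_ge0. Qed.

Definition energy (A : set rV) : R := (\int[mu]_(x in A) (G x `^ p * w x))%R.

Lemma energyE (A : set rV) : measurable (A : set T) ->
  (\int[mu]_(x in A) (G x `^ p * w x)%:E = (energy A)%:E)%E.
Proof.
move=> mA; rewrite /energy /Rintegral fineK//; apply: integrable_fin_num => //.
exact: (integrableS measurableT mA (@subsetT _ _) IE).
Qed.

Lemma energy_ge0 A : 0 <= energy A.
Proof. by apply: Rintegral_ge0 => x _; exact: E0. Qed.

Lemma energy_sub (A B : set rV) : measurable (A : set T) -> measurable (B : set T) -> A `<=` B ->
  energy A <= energy B.
Proof.
move=> mA mB AB; apply: (Rintegral_sub E0 mA mB AB).
exact: (integrableS measurableT mB (@subsetT _ _) IE).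
Qed.

Let K : R := projT1 (cid2 (muckenhoupt_qbox p1 hw)).
Let K0 : 0 < K. Proof. by rewrite /K; case: cid2. Qed.
Let HK : averaging_constant p w K.
Proof. by rewrite /K; case: cid2. Qed.

(** The right-hand side of the averaging inequality for [G], when [lam] is at least
    the p-th root of the mean of [G `^ p] with respect to [w]. *)
Lemma energy_combination a l lam : 0 < lam -> energy (qbox a l) <= lam `^ p * wmass w a l ->
  (\int[mu]_(x in qbox a l) (lam * w x + K * lam `^ (1 - p) * (G x `^ p * w x))%:E <=
    ((1 + K) * lam * wmass w a l)%:E)%E.
Proof.
move=> lam0 H.
rewrite (@qbox_integral_combination R d p w hw a l (fun x => G x `^ p * w x) lam (K * lam `^ (1 - p)) mE E0 (ltW lam0));
  last by rewrite mulr_ge0 ?powR_ge0// ltW.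
rewrite (energyE (measurable_qbox a l)) -EFinM -EFinD lee_fin.
have E1 : lam `^ (1 - p) * lam `^ p = lam.
  by rewrite -powRD subrK ?powRr1 ?ltW// oner_eq0.
have := ler_wpM2l (_ : 0 <= K * lam `^ (1 - p)) H; rewrite mulr_ge0 ?powR_ge0 ?(ltW K0)// => /(_ isT).
rewrite (_ : K * lam `^ (1 - p) * (lam `^ p * wmass w a l) = K * (lam `^ (1 - p) * lam `^ p) * wmass w a l); last by ring.
rewrite E1; lra.
Qed.

Lemma gradient_integral a l lam : 0 < l -> 0 < lam -> energy (qbox a l) <= lam `^ p * wmass w a l ->
  (\int[mu]_(x in qbox a l) G x)%R <= (1 + K) * lam * l ^+ d.
Proof.
move=> l0 lam0 H.
have := HK a l0 IG.1 G0 lam0.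
have -> : (\int[mu]_(x in qbox a l) (G x)%:E = (\int[mu]_(x in qbox a l) G x)%R%:E)%E.
  by rewrite /Rintegral fineK//; apply: integrable_fin_num; [exact: measurable_qbox|exact: box_integrable_qbox].
rewrite (wmassE hw) => /le_trans /(_ (lee_wpmul2l _ (energy_combination lam0 H))).
rewrite lee_fin exprn_ge0 ?(ltW l0)// => /(_ isT).
rewrite -!EFinM lee_fin => h; rewrite -(ler_pM2l (wmass_gt0 hw a l0)); apply: (le_trans h).
by apply: le_of_eq; ring.
Qed.

Lemma mean_step kappa (a : rV) l (a' : rV) l' lam : 0 < l' -> l <= kappa * l' -> 0 < l -> 0 < lam ->
  (forall i, a ord0 i <= a' ord0 i) -> (forall i, a' ord0 i + l' <= a ord0 i + l) ->
  energy (qbox a l) <= lam `^ p * wmass w a l ->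
  `|mean U a' l' - mean U a l| <= d%:R * kappa ^+ d.-1 * (1 + K) * (l * lam).
Proof.
move=> l'0 lk l0 lam0 aa ll H.
have := mean_sub IU Ig IG gG weak l'0 aa ll => /le_trans; apply.
have c0 : 0 <= d%:R / l' ^+ d.-1 by rewrite divr_ge0// exprn_ge0// ltW.
apply: (le_trans (ler_wpM2l c0 (gradient_integral l0 lam0 H))).
have -> : l ^+ d = l * l ^+ d.-1 by rewrite -exprS prednK.
have ld : l ^+ d.-1 <= kappa ^+ d.-1 * l' ^+ d.-1.
  by rewrite -exprMn; apply: lerXn2r; rewrite ?nnegrE ?(ltW l0)// (le_trans (ltW l0) lk).
have -> : d%:R / l' ^+ d.-1 * ((1 + K) * lam * (l * l ^+ d.-1)) = (d%:R * (1 + K) * (l * lam)) * (l ^+ d.-1 / l' ^+ d.-1) by ring.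
rewrite (_ : d%:R * kappa ^+ d.-1 * (1 + K) * (l * lam) = (d%:R * (1 + K) * (l * lam)) * kappa ^+ d.-1); last by ring.
apply: ler_wpM2l; last by rewrite ler_pdivrMr// exprn_gt0.
by rewrite !mulr_ge0 ?addr_ge0 ?(ltW K0) ?(ltW l0) ?(ltW lam0).
Qed.

(** The weighted Poincare inequality bounds the gap between the weighted average
    and the mean. *)
Lemma average_step a l lam : 0 < l -> 0 < lam -> energy (qbox a l) <= lam `^ p * wmass w a l ->
  mu.-integrable (qbox a l) (EFin \o (fun x => U x * w x)) /\
  `|(\int[mu]_(x in qbox a l) (U x * w x))%R / wmass w a l - mean U a l| <=
    2 * poincare_const R d * (1 + K) * (l * lam).
Proof.
move=> l0 lam0 H.
pose F x := lam * w x + K * lam `^ (1 - p) * (G x `^ p * w x).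
have F0 x : 0 <= F x by rewrite addr_ge0 ?mulr_ge0 ?powR_ge0 ?(ltW lam0) ?(ltW K0).
have mF : measurable_fun [set: T] (F : T -> measurableTypeR R).
  by apply: measurable_funD; apply: measurable_funM; [exact: measurable_cst|exact: mw|exact: measurable_cst|exact: mE].
have P := @cube_poincare R d U g G IU Ig IG gG weak a l l0 d0 w F mw mF w0 F0
  (fun b e e0 _ => HK b e0 IG.1 G0 lam0).
apply: (@weighted_average_bound R _ T mu (qbox a l) U w (mean U a l) _ (wmass w a l) (measurable_qbox a l)
  IU.1 mw w0 (wmassE hw a l) (wmass_gt0 hw a l0)).
apply: (le_trans P).
have c0 : 0 <= 2 * (poincare_const R d * l).
  by rewrite !mulr_ge0 ?exprn_ge0 ?(ltW l0).
apply: (le_trans (lee_wpmul2l _ (energy_combination lam0 H))); first by rewrite lee_fin.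
by rewrite -EFinM lee_fin; apply: le_of_eq; ring.
Qed.

(* Positive because [p < d]: all gaps decay like [l `^ (- sigma)]. *)
Let sigma : R := d%:R / p - 1.
Let sigma0 : 0 < sigma. Proof. by rewrite subr_gt0 ltr_pdivlMr// mul1r. Qed.

Section scale.
Variables (delta c1 : R).
Hypotheses (delta0 : 0 < delta) (c10 : 0 < c1).
Hypothesis Hc1 : forall a l, delta <= l -> c1 * l ^+ d <= wmass w a l.

(** By the growth of the mass, this is an admissible [lam] for a cube of edge [l]
    whose energy is at most [eta `^ p]. *)
Definition oscillation (eta l : R) : R := eta * c1 `^ (- p^-1) * l `^ (- (d%:R / p)).

Lemma oscillation_gt0 eta l : 0 < eta -> 0 < l -> 0 < oscillation eta l.
Proof. by move=> e0 l0; rewrite !mulr_gt0// powR_gt0. Qed.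

Lemma oscillation_energy eta a l : 0 < eta -> delta <= l -> energy (qbox a l) <= eta `^ p ->
  energy (qbox a l) <= oscillation eta l `^ p * wmass w a l.
Proof.
move=> e0 dl /le_trans; apply; have l0 : 0 < l by exact: lt_le_trans dl.
rewrite /oscillation !powRM ?mulr_ge0 ?powR_ge0 ?(ltW e0)// -!powRrM.
have -> : - p^-1 * p = -1 by field; rewrite gt_eqF.
have -> : - (d%:R / p) * p = - d%:R by field; rewrite gt_eqF.
rewrite powR_inv1 ?(ltW c10)// powRN powR_mulrn ?(ltW l0)//.
rewrite -!mulrA ler_peMr ?powR_ge0// mulrA -invfM mulrC ler_pdivlMr ?mulr_gt0 ?exprn_gt0// mul1r.
exact: Hc1.
Qed.

Lemma edge_oscillation eta l : 0 < l -> l * oscillation eta l = eta * c1 `^ (- p^-1) * l `^ (- sigma).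
Proof.
move=> l0; rewrite /oscillation mulrCA; congr (_ * _).
have -> : - sigma = 1 + - (d%:R / p) by rewrite /sigma; ring.
by rewrite powRD ?powRr1 ?(ltW l0)// (gt_eqF l0) implybT.
Qed.

Definition step_const kappa : R := d%:R * kappa ^+ d.-1 * (1 + K) * c1 `^ (- p^-1).

Lemma mean_decay kappa (a : rV) l (a' : rV) l' eta : 0 < eta -> 0 < l' -> l <= kappa * l' -> delta <= l ->
  (forall i, a ord0 i <= a' ord0 i) -> (forall i, a' ord0 i + l' <= a ord0 i + l) ->
  energy (qbox a l) <= eta `^ p ->
  `|mean U a' l' - mean U a l| <= step_const kappa * eta * l `^ (- sigma).
Proof.
move=> e0 l'0 lk dl aa ll H; have l0 : 0 < l by exact: lt_le_trans dl.
have := mean_step l'0 lk l0 (oscillation_gt0 e0 l0) aa ll (oscillation_energy e0 dl H).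
by rewrite edge_oscillation// /step_const; congr (_ <= _); ring.
Qed.

Lemma average_decay (a : rV) l eta : 0 < eta -> delta <= l -> energy (qbox a l) <= eta `^ p ->
  mu.-integrable (qbox a l) (EFin \o (fun x => U x * w x)) /\
  `|(\int[mu]_(x in qbox a l) (U x * w x))%R / wmass w a l - mean U a l| <=
    2 * step_const 2 * eta * l `^ (- sigma).
Proof.
move=> e0 dl H; have l0 : 0 < l by exact: lt_le_trans dl.
have [-> H2] := average_step l0 (oscillation_gt0 e0 l0) (oscillation_energy e0 dl H); split=> //.
by move: H2; rewrite edge_oscillation// /step_const /poincare_const; congr (_ <= _); ring.
Qed.

Let rho : R := 2 `^ (- sigma).
Let rho0 : 0 <= rho. Proof. exact: powR_ge0. Qed.
Let rho1 : rho < 1.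
Proof.
rewrite /rho powRN invf_lt1 ?powR_gt0//.
have := @gt0_ltr_powR R sigma sigma0 1 2; rewrite !nnegrE powR1 /=.
by apply=> //; exact: ltr1n.
Qed.

Lemma scale_powR (l : R) k : 0 <= l -> (2 ^+ k * l) `^ (- sigma) = rho ^+ k * l `^ (- sigma).
Proof.
move=> l0; rewrite powRM// ?exprn_ge0//; congr (_ * _).
by rewrite -powR_mulrn// -powRrM mulrC powRrM powR_mulrn// powR_ge0.
Qed.

Lemma doubling_step (a : rV) l eta k : 0 < eta -> delta <= l ->
  energy (qbox a (2 ^+ k.+1 * l)) <= eta `^ p ->
  `|mean U a (2 ^+ k.+1 * l) - mean U a (2 ^+ k * l)| <= step_const 2 * eta * l `^ (- sigma) * rho ^+ k.
Proof.
move=> e0 dl H; have l0 : 0 < l by exact: lt_le_trans dl.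
have lk : 0 < 2 ^+ k * l by rewrite mulr_gt0// exprn_gt0.
have E : 2 ^+ k.+1 * l = 2 * (2 ^+ k * l) by rewrite exprS mulrA.
have C0 : 0 <= step_const 2 * eta * l `^ (- sigma).
  by rewrite !mulr_ge0 ?powR_ge0 ?exprn_ge0 ?addr_ge0 ?(ltW K0) ?(ltW e0).
rewrite distrC; apply: (le_trans (@mean_decay 2 a (2 ^+ k.+1 * l) a (2 ^+ k * l) eta e0 lk _ _ _ _ H)).
- by rewrite E.
- by apply: (le_trans dl); rewrite -[leLHS]mul1r ler_wpM2r ?(ltW l0)// exprn_ege1// ler1n.
- by [].
- by move=> i; rewrite lerD2l E; lra.
rewrite scale_powR ?(ltW l0)// (_ : _ * (_ * _) = step_const 2 * eta * l `^ (- sigma) * rho ^+ k.+1); last by ring.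
by rewrite ler_wpM2l// exprS ler_piMl ?exprn_ge0// ltW.
Qed.

Hypothesis delta1 : delta <= 1.

Definition total_scale : R := (energy [set: rV] + 1) `^ p^-1.

Let eta0_gt0 : 0 < total_scale.
Proof. by rewrite powR_gt0// ltr_wpDl// energy_ge0. Qed.

Lemma energy_total a l : energy (qbox a l) <= total_scale `^ p.
Proof.
have E1 : 0 <= energy [set: rV] + 1 by rewrite addr_ge0// energy_ge0.
rewrite /total_scale -powRrM mulVf ?gt_eqF// powRr1//.
apply: (@le_trans _ _ (energy [set: rV])); last by rewrite lerDl.
by apply: energy_sub => //; exact: measurable_qbox.
Qed.

Let step_const_ge0 kappa : 0 <= kappa -> 0 <= step_const kappa.
Proof. by move=> k0; rewrite !mulr_ge0 ?powR_ge0 ?exprn_ge0 ?addr_ge0 ?(ltW K0). Qed.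

Let decay_ge0 (eta l : R) : 0 <= eta -> 0 <= step_const 2 * eta * l `^ (- sigma).
Proof.
by move=> e0; apply: mulr_ge0 (powR_ge0 _ _); apply: mulr_ge0 e0; exact: step_const_ge0.
Qed.

(** Both cubes lie in a cube around the origin whose edge is comparable with
    theirs. *)
Lemma mean_comparison (a b : rV) l m : delta <= l -> delta <= m -> exists B, forall n,
  `|mean U a (2 ^+ n * l) - mean U b (2 ^+ n * m)| <= B * rho ^+ n.
Proof.
move=> dl dm; have l0 : 0 < l by exact: lt_le_trans dl. have m0' : 0 < m by exact: lt_le_trans dm.
pose t := l + m + \sum_(i < d) (`|a ord0 i| + `|b ord0 i|).
have t0 : 0 < t by rewrite ltr_pwDl ?addr_gt0// sumr_ge0// => i _; rewrite addr_ge0.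
have ti i : `|a ord0 i| + `|b ord0 i| <= t.
  rewrite /t (bigD1 i)//= addrCA lerDl; apply: addr_ge0; first by rewrite addr_ge0 ?(ltW l0) ?(ltW m0').
  by apply: sumr_ge0 => j _; exact: addr_ge0.
have lmt : l + m <= t by rewrite /t lerDl sumr_ge0// => i _; rewrite addr_ge0.
pose big n := mean U (\row__ (- (2 ^+ n * t))) (2 ^+ n * (3 * t)).
have compare (c : rV) (e : R) : delta <= e -> e <= t -> (forall i, `|c ord0 i| <= t) -> exists B, forall n,
    `|mean U c (2 ^+ n * e) - big n| <= B * rho ^+ n.
  move=> de et ct; have e0 : 0 < e by exact: lt_le_trans de.
  exists (step_const (3 * t / e) * total_scale * (3 * t) `^ (- sigma)) => n.
  have n1 : 1 <= 2 ^+ n :> R by rewrite exprn_ege1// ler1n.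
  have n0 : 0 < 2 ^+ n :> R by rewrite exprn_gt0.
  have tn : t <= 2 ^+ n * t by rewrite ler_peMl// ltW.
  apply: (@le_trans _ _ (step_const (3 * t / e) * total_scale * (2 ^+ n * (3 * t)) `^ (- sigma))).
    apply: mean_decay => //.
    - exact: mulr_gt0.
    - by apply: le_of_eq; field; rewrite gt_eqF.
    - lra.
    - by move=> i; rewrite mxE; have := ct i; rewrite ler_norml; lra.
    - move=> i; rewrite mxE; have := ct i; rewrite ler_norml => /andP[_ h].
      have : 2 ^+ n * e <= 2 ^+ n * t by rewrite ler_pM2l.
      lra.
    - exact: energy_total.
  by rewrite scale_powR ?mulr_ge0 ?(ltW t0)//; apply: le_of_eq; ring.
have [] := compare a l dl; first lra.
  by move=> i; apply: le_trans (ti i); rewrite lerDl.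
move=> B1 H1; have [] := compare b m dm; first lra.
  by move=> i; apply: le_trans (ti i); rewrite lerDr.
move=> B2 H2; exists (B1 + B2) => n; rewrite mulrDl.
apply: le_trans (lerD (H1 n) (H2 n)).
by rewrite [X in _ <= _ + X]distrC -[X in `|X| <= _](subrKA (big n)) ler_normD.
Qed.

Lemma mean_cvg (a : rV) l : delta <= l -> cvgn (fun n => mean U a (2 ^+ n * l)).
Proof.
move=> dl; have l0 : 0 < l by exact: lt_le_trans dl.
apply: (@geometric_chain_cvg R _ (step_const 2 * total_scale * l `^ (- sigma)) rho) => //.
  by apply: decay_ge0; exact: ltW.
by move=> k; apply: doubling_step => //; exact: energy_total.
Qed.

(** By [mean_comparison], any other cube would give the same limit. *)
Definition limit_mean : R := limn (fun n => mean U 0 (2 ^+ n * 1)).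

Lemma mean_cvg_limit (a : rV) l : delta <= l -> mean U a (2 ^+ n * l) @[n --> \oo] --> limit_mean.
Proof.
move=> dl; have [B HB] := mean_comparison a 0 dl delta1.
have H0 : mean U 0 (2 ^+ n * 1) @[n --> \oo] --> limit_mean by exact: mean_cvg.
have Hd : (mean U a (2 ^+ n * l) - mean U 0 (2 ^+ n * 1)) @[n --> \oo] --> (0 : R).
  apply/cvgr0Pnorm_le => e e0.
  have : geometric B rho n @[n --> \oo] --> (0 : R) by apply: cvg_geometric; rewrite ger0_norm.
  move=> /cvgr0Pnorm_le /(_ e e0); apply: filterS => n; apply: le_trans.
  by apply: (le_trans (HB n)); exact: ler_norm.
rewrite (_ : (fun n => _) = (fun n => (mean U a (2 ^+ n * l) - mean U 0 (2 ^+ n * 1)) + mean U 0 (2 ^+ n * 1))); last first.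
  by apply/funext => n; rewrite subrK.
by rewrite -[limit_mean]add0r; exact: cvgD.
Qed.

Definition chain_const : R := step_const 2 / (1 - rho).

Let chain_const_ge0 : 0 <= chain_const.
Proof. by rewrite divr_ge0 ?step_const_ge0// subr_ge0 ltW. Qed.

Lemma mean_limit_distance (a : rV) l : delta <= l ->
  `|mean U a l - limit_mean| <= chain_const * total_scale * l `^ (- sigma).
Proof.
move=> dl; have l0 : 0 < l by exact: lt_le_trans dl.
have := @geometric_chain_lim R (fun n => mean U a (2 ^+ n * l))
  (step_const 2 * total_scale * l `^ (- sigma)) rho limit_mean _ rho0 rho1 _ (mean_cvg_limit a dl).
rewrite expr0 mul1r => H; apply: le_trans (H _ _) _.
- by apply: decay_ge0; exact: ltW.
- by move=> k; apply: doubling_step => //; exact: energy_total.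
by rewrite le_eqVlt /chain_const; apply/orP; left; apply/eqP; ring.
Qed.

Lemma sigma_antitone (l : R) : delta <= l -> l `^ (- sigma) <= delta `^ (- sigma).
Proof.
move=> dl; have l0 : 0 < l by exact: lt_le_trans dl.
rewrite !powRN lef_pV2 ?posrE ?powR_gt0//.
by apply: ge0_ler_powR; rewrite ?nnegrE ?(ltW delta0) ?(ltW l0) ?(ltW sigma0).
Qed.

(** The mean over a cube is close to the limit if the edge is large, by the
    geometric series. If it is not, and the cube is far from the origin, then its
    first [k] doublings are still far from the origin, where the energy is small,
    and the last of them is large. *)
Theorem limit_average (e : R) : 0 < e -> exists2 r, 0 < r & forall (a : rV) l, delta <= l ->
  (forall x, qbox a l x -> ~ eball 0 r x) ->
  mu.-integrable (qbox a l) (EFin \o (fun x => U x * w x)) /\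
  `|(\int[mu]_(x in qbox a l) (U x * w x))%R / wmass w a l - limit_mean| <= e.
Proof.
move=> e0.
set S := delta `^ (- sigma); have S0 : 0 < S by exact: powR_gt0.
have e2 : 0 < e / 2 by rewrite divr_gt0.
have s20 : 0 <= step_const 2 by exact: step_const_ge0.
have [k Hk] : exists k, chain_const * total_scale * S * rho ^+ k <= e / 2.
  have : geometric (chain_const * total_scale * S) rho n @[n --> \oo] --> (0 : R).
    by apply: cvg_geometric; rewrite ger0_norm.
  move=> /cvgr0Pnorm_le /(_ _ e2)[N _ HN]; exists N.
  by apply: le_trans (HN N (leqnn N)); exact: ler_norm.
(* Edges above [L] count as large; the first [k] doublings make any edge large. *)
set L := 2 ^+ k * delta.
have L0 : 0 < L by rewrite mulr_gt0// exprn_gt0.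
set M := (chain_const + 2 * step_const 2) * S.
have M0 : 0 <= M by rewrite mulr_ge0 ?(ltW S0)// addr_ge0// mulr_ge0.
set eta := e / 2 / (M + 1).
have eta_gt0 : 0 < eta by rewrite divr_gt0// ltr_wpDl.
have HM : M * eta <= e / 2.
  have -> : M * eta = e / 2 * (M / (M + 1)) by rewrite /eta; ring.
  by rewrite ler_piMr ?(ltW e2)// ler_pdivrMr ?ltr_wpDl// mul1r lerDl.
(* Outside of the ball of radius [n] there is little energy. *)
have [n Hn] : exists n : nat, energy (~` eball 0 n%:R) <= eta `^ p.
  apply: (@integral_tail R _ T mu (fun x => G x `^ p * w x) (fun n => eball 0 n%:R) (eta `^ p)) => //.
  - by move=> n; exact: measurable_eball.
  - by move=> x; exists (Num.truncn (enorm x)).+1 => // n /= xn; rewrite /eball /= subr0 (lt_le_trans (truncnS_gt _))// ler_nat.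
  - exact: powR_gt0.
(* A cube of edge at most [2 ^+ k * L] whose corner is at least this far from the
   origin does not meet that ball. *)
pose r := d%:R * (n%:R + 2 ^+ k * L) + 1.
exists r; first by rewrite ltr_wpDl// mulr_ge0// addr_ge0// mulr_ge0 ?exprn_ge0 ?(ltW L0).
move=> a l dl far; have l0 : 0 < l by exact: lt_le_trans dl.
have sl := sigma_antitone dl; rewrite -/S in sl.
have small l' : 0 < l' -> l' <= 2 ^+ k * L -> energy (qbox a l') <= eta `^ p.
  move=> l'0 l'L; apply: le_trans Hn; apply: energy_sub.
  - exact: measurable_qbox.
  - by apply: measurableC; exact: measurable_eball.
  move=> x /qboxP xa xn; apply: (far a); first by apply/qboxP => i; rewrite lexx ltrDl.
  rewrite /eball /= subr0 /r; apply: (@le_lt_trans _ _ (d%:R * (n%:R + 2 ^+ k * L))); last by rewrite ltrDl.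
  apply: enorm_le => [|i]; first by rewrite addr_ge0// mulr_ge0 ?exprn_ge0 ?(ltW L0).
  have := xa i; move: xn; rewrite /eball /= subr0 => /(le_lt_trans (coord_le_enorm x i)).
  by rewrite ltr_norml ler_norml; lra.
have energy_l : energy (qbox a l) <= eta `^ p.
  have [lL|Ll] := leP l (2 ^+ k * L); first exact: small.
  apply: le_trans Hn; apply: energy_sub.
  - exact: measurable_qbox.
  - by apply: measurableC; exact: measurable_eball.
  move=> x xa xn; apply: (far x) => //.
  apply: (lt_le_trans xn); rewrite /r -[leLHS]mul1r.
  have d1 : 1 <= d%:R :> R by rewrite ler1n.
  have h0 : 0 <= n%:R :> R by [].
  have h1 : 0 <= 2 ^+ k * L by rewrite mulr_ge0 ?exprn_ge0 ?(ltW L0).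
  by apply: (@le_trans _ _ (d%:R * (n%:R + 2 ^+ k * L))); [apply: ler_pM => //; lra|rewrite lerDl].
have [II HA] := average_decay eta_gt0 dl energy_l; split=> //.
have HA' : 2 * step_const 2 * eta * l `^ (- sigma) <= 2 * step_const 2 * S * eta.
  rewrite -mulrA (mulrC eta) mulrA -[leRHS]mulrA -[leLHS]mulrA; apply: ler_wpM2l; first by rewrite mulr_ge0.
  by rewrite ler_pM2r.
have [Ll|lL] := leP L l.
  have H1 : `|mean U a l - limit_mean| <= e / 2.
    apply: (le_trans (mean_limit_distance a dl)); apply: le_trans Hk.
    rewrite -[leRHS]mulrA; apply: ler_wpM2l; first by rewrite mulr_ge0// ltW.
    rewrite mulrC /S -scale_powR ?(ltW delta0)//.
    rewrite !powRN lef_pV2 ?posrE ?powR_gt0//.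
    by apply: ge0_ler_powR; rewrite ?nnegrE ?(ltW L0) ?(ltW l0) ?(ltW sigma0).
  rewrite -[X in `|X| <= _](subrKA (mean U a l)); apply: (le_trans (ler_normD _ _)).
  have : 0 <= chain_const * S * eta.
    by apply: mulr_ge0 (ltW eta_gt0); apply: mulr_ge0 (ltW S0); exact: chain_const_ge0.
  move: HM H1 HA HA'; rewrite /M; lra.
have kl : delta <= 2 ^+ k * l.
  by apply: (le_trans dl); rewrite ler_peMl ?(ltW l0)// exprn_ege1// ler1n.
have H1 : `|mean U a (2 ^+ k * l) - limit_mean| <= e / 2.
  apply: (le_trans (mean_limit_distance a kl)); apply: le_trans Hk.
  rewrite scale_powR ?(ltW l0)// -[leRHS]mulrA; apply: ler_wpM2l; first by rewrite mulr_ge0// ltW.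
  by rewrite mulrC ler_wpM2r// exprn_ge0.
have H2 : `|mean U a (2 ^+ k * l) - mean U a l| <= chain_const * S * eta.
  have := @geometric_chain R (fun j => mean U a (2 ^+ j * l)) (step_const 2 * eta * l `^ (- sigma)) rho k _ rho0 rho1 _.
  rewrite expr0 mul1r => H; apply: le_trans (H _ _) _.
  - by apply: decay_ge0; exact: ltW.
  - move=> j jk; apply: doubling_step => //; apply: small; first by rewrite mulr_gt0 ?exprn_gt0.
    apply: ler_pM; rewrite ?exprn_ge0 ?(ltW l0) ?(ltW lL)//.
    by rewrite ler_weXn2l// ler1n.
  rewrite /chain_const (_ : _ / _ = step_const 2 / (1 - rho) * (l `^ (- sigma) * eta)); last by ring.
  rewrite -[leRHS]mulrA; apply: ler_wpM2l; first exact: chain_const_ge0.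
  by rewrite ler_pM2r.
set A := _ / _ in HA *.
rewrite (_ : A - limit_mean = (A - mean U a l) + ((mean U a l - mean U a (2 ^+ k * l)) + (mean U a (2 ^+ k * l) - limit_mean))); last by ring.
apply: (le_trans (ler_normD _ _)); apply: (le_trans (lerD (lexx _) (ler_normD _ _))).
rewrite (distrC (mean U a l)); move: HM H1 H2 HA HA'; rewrite /M; lra.
Qed.

End scale.

End limit.

(** * A lower bound on unit cubes gives limits *)

Lemma limn_einf_gt0 (R : realType) (u : nat -> \bar R) : (0 < limn_einf u)%E ->
  exists2 delta : R, 0 < delta & exists N : nat, forall i, (N <= i)%N -> (delta%:E <= u i)%E.
Proof.
rewrite limn_einf_lim => H.
have [n Hn] : exists n, (0 < einfs u n)%E.
  apply: contrapT => /forallNP nH; move: H; apply/negP; rewrite -leNgt.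
  apply: lime_le; first exact: is_cvg_einfs.
  by apply: nearW => n; rewrite leNgt; apply/negP; exact: nH.
have lb i : (n <= i)%N -> (einfs u n <= u i)%E.
  by move=> ni; apply: ereal_inf_lbound; exists i.
case E : (einfs u n) Hn lb => [r| |]//= Hn lb.
- by exists r; [rewrite -lte_fin|exists n].
- by exists 1 => //; exists n => i /lb; rewrite leye_eq => /eqP ->; rewrite leey.
Qed.

Section abstract_ae.
Context (R : realType) (disp : measure_display) (T : measurableType disp) (mu : {measure set T -> \bar R}).

Lemma ae_eq_integral_fine (D : set T) (u : T -> \bar R) (h : T -> R) : measurable D ->
  measurable_fun [set: T] u -> measurable_fun [set: T] h -> {ae mu, forall x, u x \is a fin_num} ->
  (\int[mu]_(x in D) (u x * (h x)%:E) = \int[mu]_(x in D) (fine (u x) * h x)%:E)%E.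
Proof.
move=> mD mu_ mh uf; apply: ae_eq_integral => //.
- by apply: (measurable_funS measurableT) => //; apply: emeasurable_funM => //; exact/measurable_EFinP.
- apply: (measurable_funS measurableT) => //; apply/measurable_EFinP; apply: measurable_funM => //.
  exact: measurableT_comp.
- by apply: filterS uf => x ux _; rewrite EFinM fineK.
Qed.

End abstract_ae.

Section forward.
Variables (R : realType) (d : nat).
Local Notation rV := 'rV[R]_d.
Local Notation T := (lebesgue_space R d).
Local Notation mu := (@leb R d).

Lemma cube_set_closed_box (Q : cube R d) :
  cube_set Q = closed_box (corner Q) (\row_j (corner Q ord0 j + edge Q)).
Proof. by apply/seteqP; split => x H i; have := H i; rewrite mxE. Qed.

Lemma qbox_sub_cube_set (Q : cube R d) : qbox (corner Q) (edge Q) `<=` cube_set Q.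
Proof. by move=> x /qboxP H i; have /andP[-> /ltW ->] := H i. Qed.

Lemma enorm_le_sum (x : rV) : enorm x <= \sum_(i < d) `|x ord0 i|.
Proof.
have S0 : 0 <= \sum_(i < d) `|x ord0 i| by apply: sumr_ge0.
rewrite /enorm -[leRHS]ger0_norm// -sqrtr_sqr ler_wsqrtr// expr2 mulr_suml.
apply: ler_sum => i _; rewrite -real_normK ?num_real// expr2 ler_wpM2l//.
by rewrite (bigD1 i)//= lerDl sumr_ge0.
Qed.

Lemma box_integrable_norm (f : rV -> R) : box_integrable f -> box_integrable (fun x => `|f x|).
Proof.
move=> [mf If]; split; first exact: measurableT_comp.
by move=> a b; exact: (integrable_norm (If a b)).
Qed.

Lemma box_integrable_sum (n : nat) (f : 'I_n -> rV -> R) : (forall i, box_integrable (f i)) ->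
  box_integrable (fun x => \sum_(i < n) f i x).
Proof.
move=> H; split; first by apply: measurable_sum => i; exact: (H i).1.
move=> a b; rewrite (_ : _ \o _ = fun x => (\sum_(i < n) (f i x)%:E)%E); last first.
  by apply/funext => x /=; rewrite sumEFin.
by apply: (integrable_sum (measurable_closed_box a b)) => i _; exact: (H i).2.
Qed.

Lemma box_integrable_le (f g : rV -> R) : measurable_fun [set: T] (f : T -> measurableTypeR R) ->
  (forall x, `|f x| <= g x) -> box_integrable g -> box_integrable f.
Proof.
move=> mf fg [mg Ig]; split=> // a b.
apply: (le_integrable (measurable_closed_box a b) _ _ (Ig a b)).
  by apply/measurable_EFinP; exact: measurable_funS mf.
by move=> x _ /=; rewrite lee_fin (le_trans (fg x))// ler_norm.
Qed.

Variables (p : R) (w : rV -> R).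
Hypotheses (p1 : 1 <= p) (pd : p < d%:R) (hw : muckenhoupt p w).

Let mw : measurable_fun [set: T] (w : T -> measurableTypeR R) := (muckenhoupt_box_integrable hw).1.

Lemma wmeas_cube (Q : cube R d) : wmeas w (cube_set Q) = (wmass w (corner Q) (edge Q))%:E.
Proof.
rewrite /wmeas cube_set_closed_box.
transitivity (\int[mu]_(x in qbox (corner Q) (edge Q)) (w x)%:E)%E; last exact: (wmassE hw).
by apply: (integral_closed_box _ _ (f := EFin \o w)); apply/measurable_EFinP; exact: mw.
Qed.

Lemma inf_wmeas_gt0 :
  (0 < ereal_inf [set wmeas w (cube_set Q) | Q in [set Q : cube R d | (edge Q = 1)%R]])%E ->
  exists2 m : R, 0 < m & forall a, m <= wmass w a 1.
Proof.
set S := ereal_inf _ => S0.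
have lb a : (S <= (wmass w a 1)%:E)%E.
  by apply: ereal_inf_lbound; exists (Cube a (ltr01 : 0 < 1 :> R)) => //; exact: wmeas_cube.
move: S0 lb; case: S => [r| |]// r0 lb; first by exists r => // a; rewrite -lee_fin.
by have := lb 0; rewrite leye_eq.
Qed.

Lemma wavg_cube (u : rV -> \bar R) (Q : cube R d) : measurable_fun [set: T] (u : T -> \bar R) ->
  {ae mu, forall x, u x \is a fin_num} ->
  wavg w u (cube_set Q) = (\int[mu]_(x in qbox (corner Q) (edge Q)) (fine (u x) * w x)%:E /
    (wmass w (corner Q) (edge Q))%:E)%E.
Proof.
move=> mu_ uf; rewrite /wavg wmeas_cube; congr (_ / _)%E; rewrite cube_set_closed_box.
transitivity (\int[mu]_(x in qbox (corner Q) (edge Q)) (u x * (w x)%:E))%E.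
  by apply: integral_closed_box; apply: emeasurable_funM; [exact: mu_|apply/measurable_EFinP; exact: mw].
exact: (@ae_eq_integral_fine R _ T mu _ u w (measurable_qbox _ _) mu_ mw uf).
Qed.

(** Replaces [u] by the real function [fine \o u], which agrees with it almost
    everywhere, and the weak gradient by its norm [G]. *)
Lemma sobolev_gradient (u : rV -> \bar R) : homogeneous_sobolev p w u ->
  exists (g : 'I_d -> rV -> R) (G : rV -> R),
  [/\ forall i, box_integrable (g i), box_integrable G, forall i x, `|g i x| <= G x,
   forall i (phi : rV -> R), test_function phi ->
     (\int[mu]_x (fine (u x) * partial i phi x) = - \int[mu]_x (g i x * phi x))%R &
   mu.-integrable [set: T] (EFin \o (fun x => G x `^ p * w x))].
Proof.
move=> [Lu _ [g wg Eg]].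
have Ig i : box_integrable (g i) by apply: loc_integrable_box; exact: (wg i).1.
pose G x := Num.sqrt (\sum_(i < d) g i x ^+ 2).
have GE x : G x = enorm (\row_i g i x).
  by rewrite /G /enorm; congr Num.sqrt; apply: eq_bigr => i _; rewrite mxE.
have mG : measurable_fun [set: T] (G : T -> measurableTypeR R).
  apply: (measurableT_comp (f := (Num.sqrt : R -> R))).
    by apply: continuous_measurable_fun; exact: sqrt_continuous.
  by apply: measurable_sum => i; apply: measurable_funX; exact: (Ig i).1.
have G0 x : 0 <= G x by exact: sqrtr_ge0.
exists g, G; split; first exact: Ig.
- apply: (@box_integrable_le G (fun x => \sum_(i < d) `|g i x|) mG).
    move=> x; rewrite ger0_norm// GE; apply: (le_trans (enorm_le_sum _)).
    by apply: ler_sum => i _; rewrite mxE.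
  by apply: (@box_integrable_sum d (fun i x => `|g i x|)) => i; exact: box_integrable_norm.
- by move=> i x; have := coord_le_enorm (\row_i g i x) i; rewrite mxE -GE.
- move=> i phi tphi; have [_ /(_ phi tphi) H] := wg i.
  rewrite /Rintegral -fineN; congr fine.
  have mphi : measurable_fun [set: T] (partial i phi : T -> measurableTypeR R).
    by apply: measurable_continuous; have [/(_ [:: i])[]] := tphi.
  rewrite -(@ae_eq_integral_fine R _ T mu [set: T] u (partial i phi) measurableT Lu.1 mphi (Lp_loc_finite p1 hw Lu)).
  exact: H.
- apply/integrableP; split.
    apply/measurable_EFinP; apply: measurable_funM; last exact: mw.
    exact: (measurableT_comp (measurable_powR _) mG).
  apply: le_lt_trans Eg; apply: le_of_eq.
  by apply: eq_integral => x _ /=; rewrite ger0_norm// mulr_ge0 ?powR_ge0// (muckenhoupt_ge0 hw).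
Qed.

Lemma wavg_cvg (u : rV -> \bar R) (m : R) : 0 < m -> (forall a, m <= wmass w a 1) ->
  homogeneous_sobolev p w u -> exists c : R, forall Q : nat -> cube R d,
    (0 < limn_einf (fun i => (edge (Q i))%:E))%E -> cubes_to_infty Q ->
    (fun i => wavg w u (cube_set (Q i))) @ \oo --> c%:E.
Proof.
move=> m0 Hm hu; have [Lu _ _] := hu.
have [g [G [Ig IG gG weak IE]]] := sobolev_gradient hu.
have IU := Lp_loc_box_integrable p1 hw Lu.
have uf := Lp_loc_finite p1 hw Lu.
pose U := fine \o u.
exists (limit_mean U) => Q /limn_einf_gt0[delta' delta'0 [N1 HN1]] Qoo.
pose delta := Num.min delta' 1.
have delta0 : 0 < delta by rewrite lt_min delta'0 ltr01.
have delta1 : delta <= 1 by rewrite ge_min lexx orbT.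
have [c1 c10 Hc1] := wmass_growth p1 hw m0 delta0 Hm.
have key e : 0 < e -> exists N : nat, forall i, (N <= i)%N ->
    exists2 r : R, wavg w u (cube_set (Q i)) = r%:E & `|limit_mean U - r| <= e.
  move=> e0.
  have [r r0 Hr] := limit_average p1 pd hw IU Ig IG gG weak IE delta0 c10 Hc1 delta1 e0.
  have [N2 HN2] := Qoo r r0.
  exists (maxn N1 N2) => i; rewrite geq_max => /andP[i1 i2].
  have di : delta <= edge (Q i) by rewrite ge_min -lee_fin HN1.
  have far x : qbox (corner (Q i)) (edge (Q i)) x -> ~ eball 0 r x.
    move=> xQ xr; have : (eball 0 r `&` cube_set (Q i)) x by split=> //; exact: qbox_sub_cube_set.
    by rewrite HN2.
  have [II HA] := Hr (corner (Q i)) (edge (Q i)) di far.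
  exists ((\int[mu]_(x in qbox (corner (Q i)) (edge (Q i))) (U x * w x))%R / wmass w (corner (Q i)) (edge (Q i))).
    rewrite wavg_cube//; last exact: Lu.1.
    rewrite inver gt_eqF ?(wmass_gt0 hw) ?edge_gt0// EFinM; congr (_ * _)%E.
    by rewrite /Rintegral fineK//; apply: integrable_fin_num => //; exact: measurable_qbox.
  by rewrite distrC.
apply: cvg_EFin.
  have [N HN] := key 1 ltr01; exists N => // i /= Ni.
  by have [r -> _] := HN i Ni.
apply/cvgrPdist_le => e e0; have [N HN] := key e e0; exists N => // i /= Ni.
by have [r /= -> Hr] := HN i Ni.
Qed.

(** Guarantees that the limit in the theorem is unique. *)
Lemma far_unit_cubes : exists Q : nat -> cube R d,
  (0 < limn_einf (fun i => (edge (Q i))%:E))%E /\ cubes_to_infty Q.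
Proof.
have d0 : (0 < d)%N by rewrite -(ltr_nat R); apply: lt_trans pd; exact: lt_le_trans p1.
exists (fun i => Cube (\row__ i%:R : rV) (ltr01 : 0 < 1 :> R)); split.
  rewrite (cvg_limn_einf_sup (cvg_cst (1%:E : \bar R))).1.
  by rewrite lte_fin.
move=> r r0; exists (Num.truncn r).+1 => i ri; apply/seteqP; split=> // x [xr xQ].
have := xQ (Ordinal d0); rewrite mxE => /andP[+ _].
rewrite leNgt => /negP; apply.
apply: le_lt_trans (ler_norm _) _; apply: (le_lt_trans (coord_le_enorm x (Ordinal d0))).
move: xr; rewrite /eball /= subr0 => /lt_trans; apply.
by apply: (lt_le_trans (truncnS_gt _)); rewrite ler_nat.
Qed.

Theorem inf_wmeas_limit :
  (0 < ereal_inf [set wmeas w (cube_set Q) | Q in [set Q : cube R d | (edge Q = 1)%R]])%E ->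
  forall u : rV -> \bar R, homogeneous_sobolev p w u ->
     exists! c : R, forall Q : nat -> cube R d,
       (0 < limn_einf (fun i => (edge (Q i))%:E))%E ->
       cubes_to_infty Q ->
       (fun i => wavg w u (cube_set (Q i))) @ \oo --> c%:E.
Proof.
move=> /inf_wmeas_gt0[m m0 Hm] u hu; have [c Hc] := wavg_cvg m0 Hm hu.
exists c; split=> // c' Hc'; have [Q [Q0 Qoo]] := far_unit_cubes.
by apply: EFin_inj; apply: (cvg_unique (@ereal_hausdorff R) (Hc Q Q0 Qoo) (Hc' Q Q0 Qoo)).
Qed.

End forward.

(** * Calculus of continuously differentiable functions *)

Section abstract_bounded.
Context (R : realType) (disp : measure_display) (T : measurableType disp) (mu : {measure set T -> \bar R}).
Lemma integral_bounds (A : set T) (u : T -> R) (s m M : R) : measurable A -> mu A = s%:E ->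
  measurable_fun [set: T] u -> (forall x, A x -> m <= u x <= M) ->
  ((m * s)%:E <= \int[mu]_(x in A) (u x)%:E <= (M * s)%:E)%E.
Proof.
move=> mA As mu_ H.
have Aoo : (mu A < +oo)%E by rewrite As ltry.
have Ic (c : R) : mu.-integrable A (EFin \o cst c).
  apply/integrableP; split; first exact: (measurable_cst (c%:E : \bar R)).
  by rewrite (eq_integral (cst `|c|%:E))// integral_cst// lte_mul_pinfty.
have Iu : mu.-integrable A (EFin \o u).
  apply: (le_integrable mA (g := EFin \o cst (`|m| + `|M|))).
  - by apply/measurable_EFinP; exact: measurable_funS mu_.
  - move=> x Ax /=; rewrite lee_fin [leRHS]ger0_norm ?addr_ge0//.
    have /andP[h1 h2] := H x Ax.
    by rewrite ler_norml; have := ler_norm M; have := ler_norm (- m); have := normr_ge0 m; have := normr_ge0 M; rewrite normrN; lra.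
  - exact: Ic.
have cE (c : R) : (\int[mu]_(x in A) (EFin \o cst c) x = (c * s)%:E)%E.
  by rewrite (eq_integral (cst c%:E))// integral_cst// EFinM As.
rewrite -(cE m) -(cE M); apply/andP; split; apply: le_integral => // x; rewrite inE => Ax /=; rewrite lee_fin.
  by have /andP[] := H x Ax.
by have /andP[] := H x Ax.
Qed.

Variables (B : set T) (S : R).
Hypotheses (mB : measurable B) (Boo : (mu B < +oo)%E).

Lemma constant_integrable : mu.-integrable B (EFin \o cst S).
Proof.
apply/integrableP; split; first exact: (measurable_cst (S%:E : \bar R)).
by rewrite (eq_integral (cst `|S|%:E))// integral_cst// lte_mul_pinfty.
Qed.

Lemma bounded_integrable (f : T -> R) : measurable_fun [set: T] f ->
  (forall x, B x -> `|f x| <= S) -> mu.-integrable B (EFin \o f).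
Proof.
move=> mf fS; have I1 := constant_integrable.
apply: (le_integrable mB _ _ I1); first by apply/measurable_EFinP; exact: measurable_funS mf.
by move=> x Bx /=; rewrite lee_fin (le_trans (fS x Bx))// ler_norm.
Qed.

Lemma bounded_support_integrable (f : T -> R) : measurable_fun [set: T] f ->
  (forall x, B x -> `|f x| <= S) -> (forall x, ~ B x -> f x = 0) -> mu.-integrable [set: T] (EFin \o f).
Proof.
move=> mf fS f0; have := bounded_integrable mf fS; rewrite (integrable_mkcond _ mB).
apply: eq_integrable => // x _; rewrite patchE; case: ifPn => //; rewrite notin_setE => /f0 /= ->.
by [].
Qed.

Lemma integral_difference0 (f g : T -> R) (k : R) : measurable_fun [set: T] f -> measurable_fun [set: T] g ->
  (forall x, B x -> `|f x| <= S) -> (forall x, ~ B x -> f x = 0) ->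
  (forall x, B x -> `|g x| <= S) -> (forall x, ~ B x -> g x = 0) ->
  (\int[mu]_x (f x)%:E = \int[mu]_x (g x)%:E)%E -> (\int[mu]_x (k * (f x - g x)))%R = 0.
Proof.
move=> mf mg fS f0 gS g0 fg.
have If := bounded_support_integrable mf fS f0; have Ig := bounded_support_integrable mg gS g0.
have E : (fun x => k * (f x - g x)) = (fun x => f x * k - g x * k) by apply/funext => x; ring.
by rewrite E Rintegral_combination// /Rintegral fg subrr.
Qed.

Lemma bounded_cvg_Rintegral (F : nat -> T -> R) (f : T -> R) :
  (forall n, measurable_fun [set: T] (F n)) -> measurable_fun [set: T] f ->
  (forall n x, B x -> `|F n x| <= S) -> (forall n x, ~ B x -> F n x = 0) ->
  (forall x, F n x @[n --> \oo] --> f x) -> (forall n, (\int[mu]_x (F n x))%R = 0) ->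
  (\int[mu]_x f x)%R = 0.
Proof.
move=> mF mf FS F0 Ff IF.
have I1 := constant_integrable.
have [] := @dominated_convergence _ _ _ mu [set: T] measurableT (fun n x => (F n x)%:E)
  (EFin \o f) (fun x => (S * \1_B x)%:E).
- by move=> n; apply/measurable_EFinP; exact: mF.
- exact/measurable_EFinP.
- by apply: aeW => x _; apply: cvg_EFin; [exact: nearW|exact: Ff].
- have := I1; rewrite (integrable_mkcond _ mB).
  by apply: eq_integrable => // x _; rewrite patchE indicE; case: ifPn => _; rewrite ?mulr1 ?mulr0.
- apply: aeW => x n _; rewrite lee_fin indicE; case: (boolP (x \in B)) => [|].
    by rewrite inE mulr1; exact: FS.
  by rewrite notin_setE => /F0 ->; rewrite normr0 mulr0.
move=> _ _ H.
have I0 n : (\int[mu]_x (F n x)%:E = 0)%E.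
  have Fi := bounded_support_integrable (mF n) (FS n) (F0 n).
  by rewrite -(fineK (integrable_fin_num measurableT Fi)) -[fine _]/(\int[mu]_x F n x)%R IF.
move: H; under eq_fun do rewrite I0.
move=> /(cvg_unique (@ereal_hausdorff R) (cvg_cst _)) H.
by rewrite /Rintegral -[X in fine X]H.
Qed.

End abstract_bounded.

Section calculus.
Variables (R : realType) (d : nat).
Local Notation rV := 'rV[R]_d.
Local Notation T := (lebesgue_space R d).
Local Notation mu := (@leb R d).
Local Notation dir i := (delta_mx ord0 i : rV).

Lemma coord_le_norm (x : rV) j : `|x ord0 j| <= `|x|.
Proof.
rewrite [leRHS]/Num.norm/= mx_normrE.
exact: (@le_bigmax _ _ _ 0 (fun ij : 'I_1 * 'I_d => `|x ij.1 ij.2|) (ord0, j)).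
Qed.

Lemma compact_coord_bounded (K : set rV) : compact K -> exists2 M, 0 < M & forall x j, K x -> `|x ord0 j| <= M.
Proof.
move=> /compact_bounded[M [_ HM]].
exists (`|M| + 1); first by rewrite ltr_wpDl.
move=> x j Kx; apply: (le_trans (coord_le_norm x j)); apply: HM Kx.
by apply: (le_lt_trans (ler_norm M)); rewrite ltrDl.
Qed.

Lemma continuous_bounded_box (f : rV -> R) (a b : rV) : continuous f ->
  exists2 S, 0 <= S & forall x, closed_box a b x -> `|f x| <= S.
Proof.
move=> cf; have cK := @compact_closed_box R d a b.
have : compact (f @` closed_box a b).
  by apply: continuous_compact => //; apply: continuous_subspaceT.
move=> /compact_bounded[S [_ HS]].
exists (`|S| + 1) => [|x xab]; first by rewrite addr_ge0.
apply: (HS (`|S| + 1)); last by exists x.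
by apply: (le_lt_trans (ler_norm S)); rewrite ltrDl.
Qed.

Lemma closed_box_finite (a b : rV) : (mu (closed_box a b) < +oo)%E.
Proof.
have [l l0 sub] := closed_box_sub_qbox a b.
apply: (@le_lt_trans _ _ (mu (qbox a l))).
  by apply: le_measure; rewrite ?inE; [exact: measurable_closed_box|exact: measurable_qbox|exact: sub].
by rewrite [X in (X < _)%E](_ : _ = (l ^+ d)%:E) ?ltry//; exact: leb_qbox (ltW l0).
Qed.

Lemma continuous_box_integrable (f : rV -> R) : continuous f -> box_integrable f.
Proof.
move=> cf; split; first exact: measurable_continuous.
move=> a b; have [S S0 HS] := continuous_bounded_box a b cf.
apply: (@bounded_integrable R _ T mu (closed_box a b) S (measurable_closed_box a b) (closed_box_finite a b) f
  (measurable_continuous cf) HS).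
Qed.

Lemma continuous_loc_integrable (f : rV -> R) : continuous f -> loc_integrable f.
Proof.
move=> cf; split=> [|K cK]; first exact: measurable_continuous.
have [M M0 HM] := compact_coord_bounded cK.
have [_ If] := continuous_box_integrable cf.
have sub : K `<=` closed_box (const_mx (- M)) (const_mx M).
  by move=> x Kx i; rewrite !mxE -ler_norml; exact: HM.
have := @integrableS _ _ _ mu (closed_box (const_mx (- M)) (const_mx M)) K _ (measurable_closed_box _ _) (measurable_compact cK) sub (If _ _).
by move=> /integrableP[].
Qed.

Lemma is_derive_line (f : rV -> R) (i : 'I_d) (x : rV) (t : R) : derivable f (t *: dir i + x) (dir i) ->
  is_derive (t : R) (1 : R) (fun s : R => f (s *: dir i + x)) (partial i f (t *: dir i + x)).
Proof.
move=> df.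
have cv : h^-1 *: (f (h *: dir i + (t *: dir i + x)) - f (t *: dir i + x)) @[h --> (0:R)^'] --> partial i f (t *: dir i + x).
  exact: df.
have cv' : h^-1 *: (f ((h *: (1 : R) + t) *: dir i + x) - f (t *: dir i + x)) @[h --> (0:R)^'] --> partial i f (t *: dir i + x).
  rewrite (_ : (fun h => _) = fun h => h^-1 *: (f (h *: dir i + (t *: dir i + x)) - f (t *: dir i + x)))//.
  by apply/funext => h; rewrite addrA -scalerDl /GRing.scale/= mulr1.
apply: DeriveDef; first by apply/cvg_ex; exists (partial i f (t *: dir i + x)); exact: cv'.
by apply/cvg_lim => //; exact: cv'.
Qed.

Lemma mean_value_bound (f : rV -> R) (i : 'I_d) (x : rV) (h S : R) : 0 <= h ->
  (forall y, derivable f y (dir i)) ->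
  (forall y, `|partial i f y| <= S) -> `|f (h *: dir i + x) - f x| <= S * h.
Proof.
move=> h0 df HS.
have D (t : R) := @is_derive_line f i x t (df (t *: dir i + x)).
have [] := @MVT_segment R (fun s => f (s *: dir i + x)) (fun t => partial i f (t *: dir i + x)) 0 h h0.
  apply: continuous_subspaceT => t.
  by apply: differentiable_continuous; apply/derivable1_diffP; exact: (ex_derive (is_derive := D t)).
move=> c _; rewrite scale0r add0r subr0 => ->.
by rewrite normrM (ger0_norm h0) ler_wpM2r.
Qed.

Lemma inv_succ_cvg_dnbhs : (n.+1%:R^-1 : R) @[n --> \oo] --> (0 : R)^'.
Proof.
move=> A; rewrite /dnbhs /within /= => HA.
have : \forall n \near \oo, ((n.+1%:R^-1 : R) != 0) -> A (n.+1%:R^-1 : R) := @cvg_harmonic R _ HA.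
by apply: filterS => n; apply; rewrite invr_eq0.
Qed.

Lemma partial_near0 (f : rV -> R) (i : 'I_d) (x : rV) : (\forall y \near x, f y = 0) -> partial i f x = 0.
Proof.
by move=> f0; rewrite /partial -(derive_cst (0 : R) x (dir i)); exact: near_eq_derive.
Qed.

Lemma partial_out (f : rV -> R) (i : 'I_d) (M : R) (x : rV) (j : 'I_d) :
  (forall (x : rV) j, M < `|x ord0 j| -> f x = 0) -> M < `|x ord0 j| -> partial i f x = 0.
Proof.
move=> f0 xM; apply: partial_near0.
have cx : {for x, continuous (fun y : rV => `|y ord0 j|)}.
  by apply: (@continuous_comp _ _ _ (fun y : rV => y ord0 j)); [exact: coord_continuous|exact: norm_continuous].
have : \forall y \near x, M < `|(y : rV) ord0 j| by apply: (cvgr_gt _ cx).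
by apply: filterS => y /f0.
Qed.

Lemma continuous_support_integrable (f : rV -> R) (M : R) : continuous f ->
  (forall (x : rV) j, M < `|x ord0 j| -> f x = 0) -> mu.-integrable [set: T] (EFin \o f).
Proof.
move=> cf f0; have [S _ HS] := continuous_bounded_box (const_mx (- M)) (const_mx M) cf.
apply: (@bounded_support_integrable R _ T mu (closed_box (const_mx (- M)) (const_mx M)) S
  (measurable_closed_box _ _) (closed_box_finite _ _) f (measurable_continuous cf) HS).
move=> x /existsNP[j]; rewrite !mxE -ler_norml => /negP; rewrite -ltNge; exact: f0.
Qed.

(** The difference quotients have integral 0 by translation invariance; they
    converge to the derivative and are bounded by the mean value theorem. *)
Lemma integral_partial0 (f : rV -> R) (i : 'I_d) (M : R) : 0 < M -> continuous f -> continuous (partial i f) ->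
  (forall y, derivable f y (dir i)) -> (forall (x : rV) j, M < `|x ord0 j| -> f x = 0) ->
  (\int[mu]_x (partial i f x))%R = 0.
Proof.
move=> M0 cf cpf df f0.
pose lo : rV := const_mx (- (M + 1)); pose hi : rV := const_mx (M + 1).
pose B : set rV := closed_box lo hi.
have outB x : ~ B x -> exists j, M + 1 < `|x ord0 j|.
  by move=> /existsNP[j]; rewrite !mxE -ler_norml => /negP; rewrite -ltNge; exists j.
have out (x : rV) j : M < `|x ord0 j| -> partial i f x = 0 by exact: partial_out.
have [S1 S10 HS1] := continuous_bounded_box lo hi cpf.
have [S2 S20 HS2] := continuous_bounded_box lo hi cf.
pose S := S1 + S2.
have HS' y : `|partial i f y| <= S1.
  have [yB|/outB[j yj]] := pselect (B y); first exact: HS1.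
  by rewrite (out y j) ?normr0//; apply: lt_trans yj; rewrite ltrDl.
have Hf y : `|f y| <= S.
  rewrite /S -[leLHS]add0r; apply: lerD S10 _.
  have [yB|/outB[j yj]] := pselect (B y); first exact: HS2.
  by rewrite (f0 y j) ?normr0//; apply: lt_trans yj; rewrite ltrDl.
pose h (n : nat) : R := n.+1%:R^-1.
have h0 n : 0 < h n by rewrite invr_gt0.
have h1 n : h n <= 1 by rewrite invf_le1// ler1n.
have cft n : continuous (fun x => f (h n *: dir i + x)).
  move=> x; apply: (@continuous_comp _ _ _ (fun x : rV => h n *: dir i + x)); last exact: cf.
  exact: (cvgD (cvg_cst _) cvg_id).
have fB x : ~ B x -> f x = 0.
  by move=> /outB[j xj]; rewrite (f0 x j)//; apply: lt_trans xj; rewrite ltrDl.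
have ftB n x : ~ B x -> f (h n *: dir i + x) = 0.
  move=> /outB[j xj]; apply: (f0 _ j); rewrite !mxE eqxx/=.
  have hj : `|h n * (j == i)%:R| <= 1.
    case: (j == i); rewrite ?mulr1 ?mulr0 ?normr0//.
    by rewrite ger0_norm ?(ltW (h0 n)).
  have := lerB_normD (x ord0 j) (h n * (j == i)%:R); rewrite (addrC (x ord0 j)); lra.
pose F n x := (h n)^-1 * (f (h n *: dir i + x) - f x).
apply: (@bounded_cvg_Rintegral R _ T mu B S (measurable_closed_box _ _) (closed_box_finite _ _) F (partial i f)).
- move=> n; apply: measurable_funM; first exact: measurable_cst.
  by apply: measurable_funB; exact: measurable_continuous.
- exact: measurable_continuous.
- move=> n x _; apply: (@le_trans _ _ S1); last by rewrite lerDl.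
  rewrite /F normrM gtr0_norm ?invr_gt0// ler_pdivrMl// mulrC.
  by apply: mean_value_bound => //; exact: ltW.
- by move=> n x xB; rewrite /F ftB// fB// subrr mulr0.
- by move=> x; exact: (cvg_comp _ _ inv_succ_cvg_dnbhs (df x)).
move=> n; apply: (@integral_difference0 R _ T mu B S (measurable_closed_box _ _) (closed_box_finite _ _)
  (fun x => f (h n *: dir i + x)) f).
- exact: measurable_continuous.
- exact: measurable_continuous.
- by move=> x _; exact: Hf.
- by move=> x; exact: ftB.
- by move=> x _; exact: Hf.
- exact: fB.
transitivity (\int[mu]_x (EFin \o f) (x + h n *: dir i)%R)%E.
  by apply: eq_integral => x _ /=; rewrite addrC.
apply: integral_translation; apply/measurable_EFinP; exact: borel_continuous.
Qed.

Lemma eball_measure (x : rV) (r : R) : 0 < r -> exists2 s, 0 < s & mu (eball x r) = s%:E.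
Proof.
move=> r0; have mB := measurable_eball x r.
have l0 : 0 < r / d.+1%:R by rewrite divr_gt0.
have sub : qbox x (r / d.+1%:R) `<=` eball x r.
  by have := qbox_sub_eball (a := x) l0; rewrite (mulrC d.+1%:R) divfK ?pnatr_eq0.
have B0 : (0 < mu (eball x r))%E.
  apply: (@lt_le_trans _ _ (mu (qbox x (r / d.+1%:R)))); last first.
    by apply: le_measure; rewrite ?inE; [exact: measurable_qbox|exact: mB|exact: sub].
  rewrite [X in (_ < X)%E](_ : _ = ((r / d.+1%:R) ^+ d)%:E); last exact: leb_qbox (ltW l0).
  by rewrite lte_fin exprn_gt0.
have Boo : (mu (eball x r) < +oo)%E.
  apply: (@le_lt_trans _ _ (mu (qbox (\row_i (x ord0 i - r)) (2 * r)))).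
    by apply: le_measure; rewrite ?inE; [exact: mB|exact: measurable_qbox|exact: eball_sub_qbox].
  rewrite [X in (X < _)%E](_ : _ = ((2 * r) ^+ d)%:E) ?ltry//.
  by apply: leb_qbox; rewrite mulr_ge0// ltW.
exists (fine (mu (eball x r))); first by rewrite fine_gt0// B0.
by rewrite fineK// ge0_fin_numE// ltW.
Qed.

Lemma avg_near (u : rV -> R) (x : rV) (e : R) : continuous u -> 0 < e -> exists2 delta : R, 0 < delta &
  forall r, 0 < r -> r < delta -> ((u x - e)%:E <= avg (EFin \o u) (eball x r) <= (u x + e)%:E)%E.
Proof.
move=> cu e0.
have : \forall y \near x, `|u x - u y| <= e by move/cvgrPdist_le : (cu x) => /(_ e e0).
move=> /nbhs_ballP[delta /= delta0 H]; exists delta => // r r0 rd.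
have [s s0 sE] := eball_measure x r0.
have ub y : eball x r y -> u x - e <= u y <= u x + e.
  move=> yr; have : `|u x - u y| <= e.
    apply: H; split=> // i j; rewrite (ord1 i) /ball /=.
    have := coord_le_enorm (y - x) j; rewrite !mxE distrC => /le_lt_trans; apply.
    exact: lt_trans rd.
  by rewrite distrC ler_distl.
have := @integral_bounds R _ T mu (eball x r) u s (u x - e) (u x + e) (measurable_eball x r) sE
  (measurable_continuous cu) ub.
rewrite /avg [X in (_ / X)%E](_ : _ = s%:E); last exact: sE.
rewrite inver gt_eqF// => /andP[h1 h2].
by rewrite lee_pdivlMr// lee_pdivrMr// -!EFinM; apply/andP; split; [exact: h1|exact: h2].
Qed.

(** By continuity the means over small balls are close to the value at the
    centre. *)
Lemma continuous_lebesgue_representative (u : rV -> R) : continuous u -> lebesgue_representative (EFin \o u).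
Proof.
move=> cu x; rewrite limf_esupE; set f := fun r => avg _ _.
have rpos : \forall r \near (0 : R)^'+, 0 < r by exact: nbhs_right_gt.
apply/eqP; rewrite eq_le; apply/andP; split.
- apply: le_ereal_inf_tmp => _ [V HV <-]; apply/lee_addgt0Pr => e e0.
  have [delta delta0 H] := avg_near x cu e0.
  have rlt : \forall r \near (0 : R)^'+, r < delta by exact: nbhs_right_lt.
  have [r [[rV r0] rd]] := filter_ex (filterI (filterI HV rpos) rlt).
  have /andP[h _] := H r r0 rd.
  apply: (@le_trans _ _ (f r + e%:E)%E); first by rewrite -leeBlDr.
  by rewrite leeD2r//; apply: ereal_sup_ubound; exists r.
- apply/lee_addgt0Pr => e e0; have [delta delta0 H] := avg_near x cu e0.
  have rlt : \forall r \near (0 : R)^'+, r < delta by exact: nbhs_right_lt.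
  pose V := [set r : R | 0 < r /\ r < delta].
  apply: (@le_trans _ _ (ereal_sup [set f r | r in V])).
    apply: ereal_inf_lbound; exists V => //.
    by move: rpos rlt; apply: filterS2 => r r0 rd.
  apply: ge_ereal_sup => _ [r [r0 rd] <-]; rewrite -EFinD.
  by have /andP[_] := H r r0 rd.
Qed.

End calculus.

(** * A sum of distant bumps of increasing height *)

Section plateau.
Variables (R : realType) (d : nat).
Local Notation rV := 'rV[R]_d.
Local Notation dir i := (delta_mx ord0 i : rV).

Definition unit_bump : R -> R := smooth_bump 0 3 0.

(** A bump for the unit cube with corner [a]: bounded below on it, and supported in
    the concentric cube of edge 3. *)
Definition plateau (a : rV) : rV -> R := product_fun (fun j t => unit_bump (1 * t + (1 - a ord0 j))).

Lemma smooth1_plateau (a : rV) j : smooth1 (fun t => unit_bump (1 * t + (1 - a ord0 j))).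
Proof. by apply: smooth1_affine; exact: smooth1_bump. Qed.

Lemma smooth_plateau a : smooth (plateau a).
Proof. by apply: smooth_product_fun => j; exact: smooth1_plateau. Qed.

Lemma continuous_plateau a : continuous (plateau a).
Proof. by have [] := smooth_plateau a [::]. Qed.

Lemma derivable_plateau a i x : derivable (plateau a) x (dir i).
Proof. by have [_] := smooth_plateau a [::]; exact. Qed.

Lemma continuous_partial_plateau a i : continuous (partial i (plateau a)).
Proof. by have [] := smooth_plateau a [:: i]. Qed.

Lemma plateau_ge0 a x : 0 <= plateau a x.
Proof. by apply: prodr_ge0 => j _; exact: bump_ge0. Qed.

Lemma plateau_out (a x : rV) j : ~~ (a ord0 j - 1 < x ord0 j < a ord0 j + 2) -> plateau a x = 0.
Proof.
move=> xj; rewrite /plateau (product_funD1 j) /unit_bump bump_out ?mul0r//.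
apply: contra xj; lra.
Qed.

Definition plateau_height : R := (expR (- 1) * expR (- 1)) ^+ d.

Lemma plateau_height_gt0 : 0 < plateau_height.
Proof. by rewrite exprn_gt0// mulr_gt0// expR_gt0. Qed.

Lemma flat_exp_ge1 (t : R) : 1 <= t -> expR (- 1) <= flat_exp t.
Proof.
move=> t1; rewrite flat_exp_gt0 ?(lt_le_trans ltr01)// ler_expR lerN2.
by rewrite invf_le1// (lt_le_trans ltr01).
Qed.

Lemma plateau_height_le (a x : rV) : qbox a 1 x -> plateau_height <= plateau a x.
Proof.
move=> /qboxP xa; rewrite /plateau_height -[X in _ ^+ X](card_ord d) -prodr_const.
apply: ler_prod => j _; rewrite mulr_ge0 ?expR_ge0//=.
have := xa j; rewrite /unit_bump /smooth_bump => H.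
by apply: ler_pM; rewrite ?expR_ge0//; apply: flat_exp_ge1; lra.
Qed.

Lemma unit_bump_derivative : exists f' D, [/\ forall t, is_derive (t : R) (1 : R) unit_bump (f' t), 0 <= D &
  forall t, `|f' t| <= D].
Proof.
have [f' sf' ff'] := smooth1_derive (smooth1_bump (0 : R) 3 0).
have cf' := smooth1_continuous sf'.
have f'0 t : ~~ (0 <= t <= 3) -> f' t = 0.
  move=> t03; rewrite -(derive_val (is_derive := ff' t)).
  transitivity ('D_(1 : R) (cst (0 : R)) t); last exact: derive_cst.
  apply: near_eq_derive; move: t03; rewrite negb_and -!ltNge => /orP[t0|t3].
    have : \forall s \near t, s < 0 by apply: (cvgr_lt _ (cvg_id : (fun s : R => s) @ t --> t)).
    by apply: filterS => s s0; rewrite bump_out//; apply/negP => /andP[h _]; lra.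
  have : \forall s \near t, 3 < s by apply: (cvgr_gt _ (cvg_id : (fun s : R => s) @ t --> t)).
  by apply: filterS => s s0; rewrite bump_out//; apply/negP => /andP[_ h]; lra.
have : compact (f' @` `[0, 3]%classic).
  by apply: continuous_compact; [exact: continuous_subspaceT|exact: segment_compact].
move=> /compact_bounded[S [_ HS]].
exists f', (`|S| + 1); split; [exact: ff'|by rewrite addr_ge0|].
move=> t; have [t03|/f'0 ->] := boolP (0 <= t <= 3); last by rewrite normr0 addr_ge0.
apply: (HS (`|S| + 1)); first by apply: (le_lt_trans (ler_norm S)); rewrite ltrDl.
by exists t => //=; rewrite in_itv.
Qed.

Lemma partial_plateau_bound : exists2 D, 0 <= D & forall a i x, `|partial i (plateau a) x| <= D.
Proof.
have [f' [D [ff' D0 HD]]] := unit_bump_derivative.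
exists D => // a i x.
have d1 (t c : R) : is_derive (t : R) (1 : R) (fun t => unit_bump (1 * t + c)) (f' (1 * t + c)).
  have da : is_derive t (1 : R) (fun x : R => 1 * x + c) 1.
    have := is_deriveD (is_deriveZ (1 : R) (is_derive_id t (1 : R))) (is_derive_cst c t (1:R)).
    by rewrite addr0 [1 *: 1]mulr1.
  have := @is_derive1_comp _ unit_bump (fun x => 1 * x + c) t _ _ (ff' (1 * t + c)) da.
  by rewrite mulr1.
have pE := derive_val (is_derive := is_derive_product_fun (phi := fun j t => unit_bump (1 * t + (1 - a ord0 j))) (d1 (x ord0 i) (1 - a ord0 i))).
rewrite /partial /plateau pE normrM -[leRHS]mulr1; apply: ler_pM => //.
rewrite normr_prod; apply: prodr_ile1 => j _; rewrite normr_ge0/= ger0_norm ?bump_ge0//.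
exact: bump_le1.
Qed.

Lemma partial_plateau_out (a x : rV) i j : ~~ (a ord0 j - 1 <= x ord0 j <= a ord0 j + 2) ->
  partial i (plateau a) x = 0.
Proof.
move=> xj; apply: partial_near0.
have cx : {for x, continuous (fun y : rV => y ord0 j)} by exact: coord_continuous.
move: xj; rewrite negb_and -!ltNge => /orP[h|h].
  have : \forall y \near x, (y : rV) ord0 j < a ord0 j - 1 by apply: (cvgr_lt _ cx).
  by apply: filterS => y hy; apply: (@plateau_out _ _ j); apply/negP => /andP[]; lra.
have : \forall y \near x, a ord0 j + 2 < (y : rV) ord0 j by apply: (cvgr_gt _ cx).
by apply: filterS => y hy; apply: (@plateau_out _ _ j); apply/negP => /andP[]; lra.
Qed.

End plateau.

Section series.
Variables (R : realType) (d : nat).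
Local Notation rV := 'rV[R]_d.
Local Notation T := (lebesgue_space R d).
Local Notation mu := (@leb R d).
Local Notation dir i := (delta_mx ord0 i : rV).
(** Integration by parts: the integral of the derivative of [u * phi] vanishes. *)
Lemma weak_gradient_C1 (u : rV -> R) : continuous u -> (forall i x, derivable u x (dir i)) ->
  (forall i, continuous (partial i u)) -> weak_gradient (EFin \o u) (fun i => partial i u).
Proof.
move=> cu du cpu i; split; first exact: continuous_loc_integrable.
move=> phi [sphi suppphi].
have cphi : continuous phi by have [] := sphi [::].
have cpphi : continuous (partial i phi) by have [] := sphi [:: i].
have dphi x : derivable phi x (dir i) by have [_] := sphi [::]; exact.
have [M M0 HM] := compact_coord_bounded suppphi.
have phi0 (x : rV) j : M < `|x ord0 j| -> phi x = 0.
  move=> xj; apply/eqP; apply: contraTT xj => px; rewrite -leNgt; apply: HM.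
  exact: subset_closure.
have pphi0 (x : rV) j : M < `|x ord0 j| -> partial i phi x = 0 by exact: partial_out.
have c1 : continuous (fun x => u x * partial i phi x) by move=> x; exact: (cvgM (cu x) (cpphi x)).
have c2 : continuous (fun x => partial i u x * phi x) by move=> x; exact: (cvgM (cpu i x) (cphi x)).
have I1 : mu.-integrable [set: T] (EFin \o (fun x => u x * partial i phi x)).
  by apply: (@continuous_support_integrable R d _ M c1) => x j /pphi0 ->; rewrite mulr0.
have I2 : mu.-integrable [set: T] (EFin \o (fun x => partial i u x * phi x)).
  by apply: (@continuous_support_integrable R d _ M c2) => x j /phi0 ->; rewrite mulr0.
have E : partial i (u * phi) = fun x => u x * partial i phi x + partial i u x * phi x.
  apply/funext => x; rewrite /partial deriveM ?du ?dphi// /GRing.scale/=; congr (_ + _).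
  by rewrite mulrC.
have := @integral_partial0 R d (u * phi) i M M0.
rewrite E => /(_ _ _ _ _)H.
have {H} H : (\int[mu]_x (u x * partial i phi x + partial i u x * phi x))%R = 0.
  apply: H.
  - by move=> x; exact: (cvgM (cu x) (cphi x)).
  - by move=> x; apply: (cvgD (c1 x) (c2 x)).
  - by move=> x; apply: derivableM.
  - by move=> x j /phi0 h; rewrite /GRing.mul/= h mulr0.
move: H; rewrite (RintegralD measurableT I1 I2) => H.
have -> : (\int[mu]_x ((EFin \o u) x * (partial i phi x)%:E) = (\int[mu]_x (u x * partial i phi x))%R%:E)%E.
  by rewrite /Rintegral fineK//; exact: (integrable_fin_num measurableT I1).
have -> : (\int[mu]_x (partial i u x * phi x)%:E = (\int[mu]_x (partial i u x * phi x))%R%:E)%E.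
  by rewrite /Rintegral fineK//; exact: (integrable_fin_num measurableT I2).
by rewrite -EFinN; congr EFin; apply/eqP; rewrite -addr_eq0; apply/eqP.
Qed.

Variable a : nat -> rV.
Hypothesis far : forall k, exists j, k%:R < `|a k ord0 j|.

Definition psum (M : nat) (x : rV) : R := \sum_(k < M) k%:R * plateau (a k) x.
Definition pgrad (M : nat) (i : 'I_d) (x : rV) : R := \sum_(k < M) k%:R * partial i (plateau (a k)) x.
(** No bump of index [level x] or more reaches [x], see [far_plateau]; the sum is
    therefore locally finite. *)
Definition level (x : rV) : nat := (Num.truncn (\sum_(j < d) `|x ord0 j|)).+3.
Definition staircase (x : rV) : R := psum (level x) x.

Lemma far_plateau (x : rV) (N : R) k : (forall j, `|x ord0 j| <= N) -> N + 2 <= k%:R -> plateau (a k) x = 0.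
Proof.
move=> xN Nk; have [j aj] := far k; apply: (@plateau_out R d _ _ j); apply/negP => /andP[h1 h2].
have := xN j; rewrite ler_norml => /andP[n1 n2].
by move: aj; rewrite lter_normr => /orP[]; lra.
Qed.

Lemma psum_stable (x : rV) (m M : nat) : (m <= M)%N -> (forall k, (m <= k)%N -> plateau (a k) x = 0) ->
  psum M x = psum m x.
Proof.
move=> /subnK <- H; elim: (M - m)%N => [//|n IH].
by rewrite addSn /psum big_ord_recr /= -/(psum _ _) IH H ?mulr0 ?addr0// leq_addl.
Qed.

Lemma staircaseE (x : rV) (N : R) (M : nat) : (forall j, `|x ord0 j| <= N) -> N + 2 <= M%:R ->
  staircase x = psum M x.
Proof.
move=> xN NM; rewrite /staircase.
pose N' := \sum_(j < d) `|x ord0 j|.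
have xN' j : `|x ord0 j| <= N' by rewrite /N' (bigD1 j)//= lerDl sumr_ge0.
have NM' : N' + 2 <= (level x)%:R.
  have := truncnS_gt N'; rewrite /level -/N' -(addn2 _.+1) natrD; lra.
rewrite -(@psum_stable x (level x) (maxn M (level x))) ?leq_maxr//; last first.
  by move=> k hk; apply: (far_plateau xN'); apply: (le_trans NM'); rewrite ler_nat.
rewrite (@psum_stable x M (maxn M (level x))) ?leq_maxl// => k hk.
by apply: (far_plateau xN); apply: (le_trans NM); rewrite ler_nat.
Qed.

Lemma psumS M : psum M.+1 = psum M + (M%:R \*o plateau (a M)).
Proof. by apply/funext => x; rewrite /psum big_ord_recr. Qed.

Lemma continuous_psum M : continuous (psum M).
Proof.
elim: M => [|M IH] x.
  by rewrite (_ : psum 0 = fun=> 0); [exact: cst_continuous|apply/funext => y; rewrite /psum big_ord0].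
rewrite psumS; apply: (cvgD (IH x)); apply: cvgMr; exact: continuous_plateau.
Qed.

Lemma continuous_pgrad M i : continuous (pgrad M i).
Proof.
elim: M => [|M IH] x.
  by rewrite (_ : pgrad 0 i = fun=> 0); [exact: cst_continuous|apply/funext => y; rewrite /pgrad big_ord0].
rewrite (_ : pgrad M.+1 i = fun x => pgrad M i x + M%:R * partial i (plateau (a M)) x); last first.
  by apply/funext => y; rewrite /pgrad big_ord_recr.
by apply: (cvgD (IH x)); apply: cvgMr; exact: continuous_partial_plateau.
Qed.

Lemma is_derive_psum M i x : is_derive x (dir i) (psum M) (pgrad M i x).
Proof.
elim: M => [|M IH].
  rewrite (_ : psum 0 = cst 0); last by apply/funext => y; rewrite /psum big_ord0.
  by rewrite /pgrad big_ord0; exact: is_derive_cst.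
rewrite psumS /pgrad big_ord_recr /=; apply: is_deriveD.
exact: (is_deriveZ M%:R (derivableP (@derivable_plateau R d (a M) i x))).
Qed.

Lemma near_bounded (x : rV) (N : R) : (forall j, `|x ord0 j| < N) -> \forall y \near x, forall j, `|(y : rV) ord0 j| < N.
Proof.
move=> xN; apply: (@filter_forall rV _ (fun j (y : rV) => `|y ord0 j| < N) (nbhs x) _) => j.
have cx : {for x, continuous (fun y : rV => `|y ord0 j|)}.
  by apply: (@continuous_comp _ _ _ (fun y : rV => y ord0 j)); [exact: coord_continuous|exact: norm_continuous].
by apply: (cvgr_lt _ cx).
Qed.

Lemma staircase_near (x : rV) (N : R) (M : nat) : (forall j, `|x ord0 j| < N) -> N + 2 <= M%:R ->
  \forall y \near x, psum M y = staircase y.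
Proof.
move=> xN NM; have := near_bounded xN; apply: filterS => y yN.
by rewrite (@staircaseE y N M)// => j; exact: ltW.
Qed.

Lemma coord_bound (x : rV) : exists (N : R) (M : nat), (forall j, `|x ord0 j| < N) /\ N + 2 <= M%:R.
Proof.
pose N := 1 + \sum_(j < d) `|x ord0 j|.
exists N, (Num.truncn (N + 2)).+1; split; last exact: ltW (truncnS_gt _).
by move=> j; rewrite /N (bigD1 j)//= addrCA ltrDl ltr_pwDl// sumr_ge0.
Qed.

Lemma continuous_staircase : continuous staircase.
Proof.
move=> x; have [N [M [xN NM]]] := coord_bound x.
have E := staircase_near xN NM.
rewrite /continuous_at -(nbhs_singleton E).
by apply: cvg_trans (continuous_psum (M := M) (x := x)); exact: (near_eq_cvg E).
Qed.

Lemma is_derive_staircase (i : 'I_d) (x : rV) (N : R) (M : nat) : (forall j, `|x ord0 j| < N) -> N + 2 <= M%:R ->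
  is_derive x (dir i) staircase (pgrad M i x).
Proof.
move=> xN NM; apply: near_eq_is_derive (staircase_near xN NM) _; exact: is_derive_psum.
Qed.

Lemma partial_staircase (i : 'I_d) (x : rV) (N : R) (M : nat) : (forall j, `|x ord0 j| < N) -> N + 2 <= M%:R ->
  partial i staircase x = pgrad M i x.
Proof. by move=> xN NM; exact: (derive_val (is_derive := is_derive_staircase i xN NM)). Qed.

Lemma derivable_staircase (i : 'I_d) (x : rV) : derivable staircase x (dir i).
Proof.
have [N [M [xN NM]]] := coord_bound x.
exact: (ex_derive (is_derive := is_derive_staircase i xN NM)).
Qed.

Lemma continuous_partial_staircase i : continuous (partial i staircase).
Proof.
move=> x; have [N [M [xN NM]]] := coord_bound x.
have E : \forall y \near x, pgrad M i y = partial i staircase y.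
  by have := near_bounded xN; apply: filterS => y yN; rewrite (partial_staircase i yN NM).
rewrite /continuous_at -(nbhs_singleton E).
by apply: cvg_trans (continuous_pgrad (M := M) (i := i) (x := x)); exact: (near_eq_cvg E).
Qed.

Lemma staircase_ge (x : rV) k : qbox (a k) 1 x -> k%:R * plateau_height R d <= staircase x.
Proof.
move=> xa; have [N [M [xN NM]]] := coord_bound x.
have xN' j : `|x ord0 j| <= N by exact: ltW.
have NM' : N + 2 <= (maxn M k.+1)%:R by apply: (le_trans NM); rewrite ler_nat leq_maxl.
have kM : (k < maxn M k.+1)%N by rewrite leq_maxr.
rewrite (staircaseE xN' NM') /psum (bigD1 (Ordinal kM))//=.
apply: (@le_trans _ _ (k%:R * plateau (a k) x)); first by rewrite ler_wpM2l// plateau_height_le.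
by rewrite lerDl sumr_ge0// => j _; rewrite mulr_ge0// plateau_ge0.
Qed.

End series.

(** * Limits give a lower bound on unit cubes *)

(** As [\sum_k 2^-1 ^+ k.+1 <= 1], some term [2 ^+ k.+1 * s k] is at least the whole
    sum. The factor is harmless here: the mass of the k-th cube can be taken as
    small as needed. *)
Lemma powR_sum_le (R : realType) (p : R) (s : nat -> R) (M : nat) : 1 <= p -> (forall k, 0 <= s k) ->
  (\sum_(k < M) s k) `^ p <= \sum_(k < M) (2 ^+ k.+1 * s k) `^ p.
Proof.
move=> p1 s0; set X := \sum_(k < M) s k.
have p0 : 0 < p by exact: lt_le_trans ltr01 p1.
have X0 : 0 <= X by apply: sumr_ge0.
have R0 : 0 <= \sum_(k < M) (2 ^+ k.+1 * s k) `^ p by apply: sumr_ge0 => k _; exact: powR_ge0.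
have [XE|XN] := eqVneq X 0; first by rewrite XE powR0 ?gt_eqF.
have Xp : 0 < X by rewrite lt_neqAle eq_sym XN.
have [k Hk] : exists k : 'I_M, X <= 2 ^+ k.+1 * s k.
  apply: contrapT => /forallNP H.
  have H2 (k : 'I_M) : s k <= X * 2^-1 ^+ k.+1.
    have /negP := H k; rewrite -ltNge mulrC => /ltW; rewrite -ler_pdivlMr ?exprn_gt0//.
    by rewrite exprVn.
  have : X <= \sum_(k < M) X * 2^-1 ^+ k.+1 by apply: ler_sum.
  rewrite -mulr_sumr; have -> : \sum_(k < M) (2^-1 : R) ^+ k.+1 = 1 - 2^-1 ^+ M.
    elim: (M) => [|n IH]; first by rewrite big_ord0 expr0 subrr.
    by rewrite big_ord_recr /= IH !exprS; lra.
  rewrite mulrBr mulr1 lerBrDl gerDr leNgt => /negP; apply.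
  by rewrite mulr_gt0// exprn_gt0// invr_gt0.
apply: (@le_trans _ _ ((2 ^+ k.+1 * s k) `^ p)).
  by apply: ge0_ler_powR; rewrite ?nnegrE ?mulr_ge0 ?exprn_ge0// ltW.
by rewrite (bigD1 k)//= lerDl sumr_ge0// => j _; exact: powR_ge0.
Qed.

Section abstract_series.
Context (R : realType) (disp : measure_display) (T : measurableType disp) (mu : {measure set T -> \bar R}).

Lemma integral_geometric_bound (h : nat -> T -> R) (F : T -> R) :
  (forall k, measurable_fun [set: T] (h k)) -> (forall k x, 0 <= h k x) ->
  (forall k, (\int[mu]_x (h k x)%:E <= (2^-1 ^+ k)%:E)%E) ->
  measurable_fun [set: T] F -> (forall x, 0 <= F x) ->
  (forall x, exists M, F x <= \sum_(k < M) h k x) -> (\int[mu]_x (F x)%:E < +oo)%E.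
Proof.
move=> mh h0 Hh mF F0 FH.
have h0' k x : (0 <= (h k x)%:E)%E by rewrite lee_fin.
apply: (@le_lt_trans _ _ (\int[mu]_x (\sum_(0 <= k <oo) (h k x)%:E))%E).
  apply: ge0_le_integral => //.
  - by move=> x _; rewrite lee_fin.
  - exact/measurable_EFinP.
  - by apply: ge0_emeasurable_sum => // k _; exact/measurable_EFinP.
  - move=> x _; have [M HM] := FH x.
    apply: (@le_trans _ _ (\sum_(0 <= k < M) (h k x)%:E)%E).
      by rewrite sumEFin big_mkord lee_fin.
    by apply: nneseries_lim_ge => k _ _.
rewrite integral_nneseries//; last by move=> k; exact/measurable_EFinP.
apply: (@le_lt_trans _ _ 2%:E); last exact: ltry.
apply: lime_le; first by apply: is_cvg_nneseries => k _ _; exact: integral_ge0.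
apply: nearW => n; apply: (@le_trans _ _ (\sum_(0 <= k < n) (2^-1 ^+ k)%:E)%E); first exact: lee_sum.
rewrite sumEFin lee_fin big_mkord.
suff -> : \sum_(k < n) (2^-1 : R) ^+ k = 2 - 2 * 2^-1 ^+ n by rewrite gerBl mulr_ge0// exprn_ge0.
elim: n => [|n IH]; first by rewrite big_ord0 expr0 mulr1 subrr.
by rewrite big_ord_recr /= IH exprS; lra.
Qed.

Lemma integral_bounded_mul (A : set T) (v w : T -> R) (S : R) : measurable A ->
  measurable_fun [set: T] v -> measurable_fun [set: T] w -> (forall x, 0 <= w x) -> (forall x, 0 <= v x) -> 0 <= S ->
  (forall x, A x -> v x <= S) -> (\int[mu]_(x in A) (w x)%:E < +oo)%E ->
  (\int[mu]_(x in A) (v x * w x)%:E < +oo)%E.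
Proof.
move=> mA mv mw w0 v0 S0 vS Iw.
apply: (@le_lt_trans _ _ (\int[mu]_(x in A) (S * w x)%:E)%E).
  apply: ge0_le_integral => //.
  - by move=> x _; rewrite lee_fin mulr_ge0.
  - by apply/measurable_EFinP; apply: (measurable_funS measurableT) => //; exact: measurable_funM.
  - by apply/measurable_EFinP; apply: (measurable_funS measurableT) => //; exact: measurable_funM.
  - by move=> x Ax; rewrite lee_fin ler_wpM2r// vS.
under eq_integral do rewrite EFinM.
rewrite ge0_integralZl_EFin//; last 2 first.
- by move=> x _; rewrite lee_fin.
- by apply/measurable_EFinP; exact: measurable_funS mw.
by rewrite lte_mul_pinfty.
Qed.

Lemma integral_scaled_indic (C : set T) (w : T -> R) (c : R) : measurable C -> 0 <= c ->
  measurable_fun [set: T] w -> (forall x, 0 <= w x) ->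
  (\int[mu]_x (c * (\1_C x * w x))%:E = c%:E * \int[mu]_(x in C) (w x)%:E)%E.
Proof.
move=> mC c0 mw w0; under eq_integral do rewrite EFinM.
rewrite ge0_integralZl_EFin//; last 2 first.
- by move=> x _; rewrite lee_fin mulr_ge0.
- by apply/measurable_EFinP; apply: measurable_funM => //; exact: measurable_indic.
by congr (_ * _)%E; exact: integral_indic_mul.
Qed.

Lemma integral_ge_scaled (Q : set T) (u w : T -> R) (c W : R) : measurable Q ->
  measurable_fun [set: T] u -> measurable_fun [set: T] w -> (forall x, 0 <= w x) -> 0 <= c ->
  (forall x, Q x -> c <= u x) -> (\int[mu]_(x in Q) (w x)%:E = W%:E)%E ->
  ((c * W)%:E <= \int[mu]_(x in Q) (u x * w x)%:E)%E.
Proof.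
move=> mQ mu_ mw w0 c0 cu WE.
have mw' : measurable_fun Q (EFin \o w) by apply/measurable_EFinP; exact: measurable_funS mw.
rewrite EFinM -WE -ge0_integralZl_EFin//; last by move=> x _; rewrite lee_fin.
apply: ge0_le_integral => //.
- by move=> x _; rewrite -EFinM lee_fin mulr_ge0.
- exact: measurable_funeM.
- by apply/measurable_EFinP; apply: (measurable_funS measurableT) => //; exact: measurable_funM.
- by move=> x Qx; rewrite -EFinM lee_fin ler_wpM2r// cu.
Qed.

End abstract_series.

Section converse.
Variables (R : realType) (d : nat).
Local Notation rV := 'rV[R]_d.
Local Notation T := (lebesgue_space R d).
Local Notation mu := (@leb R d).
Variables (p : R) (w : rV -> R).
Hypotheses (p1 : 1 <= p) (hw : muckenhoupt p w).

Let p0 : 0 < p. Proof. exact: lt_le_trans ltr01 p1. Qed.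
Let w0 := muckenhoupt_ge0 hw.
Let mw : measurable_fun [set: T] (w : T -> measurableTypeR R) := (muckenhoupt_box_integrable hw).1.

(** Doubling inside a large cube: light unit cubes must be far from the origin. *)
Lemma wmass_bounded_corner (n : R) : 0 <= n -> exists2 c, 0 < c &
  forall a : rV, (forall j, `|a ord0 j| <= n) -> c <= wmass w a 1.
Proof.
move=> n0; have [K K0 HK] := muckenhoupt_qbox p1 hw.
pose big : rV := const_mx (- n); pose l := 2 * n + 1.
have l0 : 0 < l by rewrite ltr_wpDl// mulr_ge0.
set f := ((1 / l) ^+ d / 2) `^ p.
have f0 : 0 < f by rewrite powR_gt0// divr_gt0// exprn_gt0// divr_gt0.
exists (f * wmass w big l / K); first by rewrite divr_gt0// mulr_gt0// (wmass_gt0 hw).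
move=> a an; rewrite ler_pdivrMr// mulrC (mulrC _ K).
rewrite mulrC; apply: (wmass_doubling p1 hw K0 HK) => //.
by apply: qbox_sub => j; have := an j; rewrite ler_norml mxE /l; lra.
Qed.

Lemma wmass_triple : exists2 D, 0 < D & forall a : rV, wmass w (a - const_mx 1) 3 <= D * wmass w a 1.
Proof.
have [K K0 HK] := muckenhoupt_qbox p1 hw.
set f := ((1 / 3 : R) ^+ d / 2) `^ p.
have f0 : 0 < f by rewrite powR_gt0// divr_gt0// exprn_gt0// divr_gt0.
exists (K / f) => [|a]; first exact: divr_gt0.
rewrite mulrAC ler_pdivlMr// mulrC; apply: (wmass_doubling p1 hw K0 HK) => //.
by apply: qbox_sub => j; rewrite !mxE; lra.
Qed.

Section light.
Hypothesis small : forall m, 0 < m -> exists a, wmass w a 1 < m.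

Lemma far_light_cube (n : nat) (m : R) : 0 < m -> exists a : rV, (exists j, n%:R < `|a ord0 j|) /\ wmass w a 1 < m.
Proof.
move=> m0; have [c c0 Hc] := wmass_bounded_corner (ler0n R n).
have [a] : exists a, wmass w a 1 < Num.min m c by apply: small; rewrite lt_min m0.
rewrite lt_min => /andP[am ac]; exists a; split=> //.
apply: contrapT => /forallNP H; move: ac; rewrite ltNge => /negP; apply; apply: Hc => j.
by rewrite leNgt; apply/negP; exact: H.
Qed.

Lemma light_sequence (eps : nat -> R) : (forall k, 0 < eps k) -> exists a : nat -> rV,
  (forall k, exists j, k%:R < `|a k ord0 j|) /\ (forall k, wmass w (a k) 1 < eps k).
Proof.
move=> e0; have /choice[a Ha] k := far_light_cube k (e0 k).
by exists a; split=> k; have [] := Ha k.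
Qed.

End light.

Section sequence.
Variables (D D3 : R) (a : nat -> rV).
Hypotheses (D0 : 0 <= D) (HD : forall b i (x : rV), `|partial i (plateau b) x| <= D).
Hypotheses (D30 : 0 < D3) (HD3 : forall b : rV, wmass w (b - const_mx 1) 3 <= D3 * wmass w b 1).
Hypothesis far : forall k, exists j, k%:R < `|a k ord0 j|.

(** The factor by which the mass of the k-th cube enters the energy bound. *)
Definition weight_cost (k : nat) : R := (2 ^+ k.+1 * (d%:R * k%:R * D)) `^ p.

Hypothesis light : forall k, wmass w (a k) 1 < 2^-1 ^+ k / (D3 * (weight_cost k + 1)).

Let u := staircase a.
Let G x := Num.sqrt (\sum_(i < d) partial i u x ^+ 2).
Let C k : set rV := cube_set (Cube (a k - const_mx 1) (ltr0n R 3)).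

Let mC k : measurable (C k : set T).
Proof. by rewrite /C cube_set_closed_box; exact: measurable_closed_box. Qed.

Let mu_ : measurable_fun [set: T] (u : T -> measurableTypeR R).
Proof. by apply: measurable_continuous; exact: continuous_staircase. Qed.

Let mG : measurable_fun [set: T] (G : T -> measurableTypeR R).
Proof.
apply: (measurableT_comp (f := (Num.sqrt : R -> R))).
  by apply: continuous_measurable_fun; exact: sqrt_continuous.
apply: measurable_sum => i; apply: measurable_funX; apply: measurable_continuous.
exact: continuous_partial_staircase.
Qed.

Lemma partial_plateau_indic k i x : `|partial i (plateau (a k)) x| <= D * \1_(C k) x.
Proof.
rewrite indicE; have [_|] := boolP (x \in C k); first by rewrite mulr1.
rewrite notin_setE => /existsNP[j /negP xj]; rewrite mulr0.
rewrite (@partial_plateau_out R d _ _ _ j) ?normr0//.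
by apply: contra xj; rewrite /= !mxE; lra.
Qed.

Lemma gradient_bound x : exists M, G x <= \sum_(k < M) d%:R * k%:R * D * \1_(C k) x.
Proof.
have [N [M [xN NM]]] := coord_bound x; exists M.
have GE : G x = enorm (\row_i partial i u x).
  by rewrite /G /enorm; congr Num.sqrt; apply: eq_bigr => i _; rewrite mxE.
rewrite GE; apply: (le_trans (enorm_le_sum _)).
apply: (@le_trans _ _ (\sum_(i < d) \sum_(k < M) k%:R * (D * \1_(C k) x))).
  apply: ler_sum => i _; rewrite mxE (partial_staircase far i xN NM) /pgrad.
  apply: (le_trans (ler_norm_sum _ _ _)); apply: ler_sum => k _.
  by rewrite normrM ger0_norm// ler_wpM2l// partial_plateau_indic.
rewrite sumr_const card_ord -[leLHS]mulr_natl mulr_sumr.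
by apply: le_of_eq; apply: eq_bigr => k _; ring.
Qed.

Lemma energy_bound x : exists M, G x `^ p * w x <= \sum_(k < M) weight_cost k * (\1_(C k) x * w x).
Proof.
have [M HM] := gradient_bound x; exists M.
apply: (@le_trans _ _ ((\sum_(k < M) (2 ^+ k.+1 * (d%:R * k%:R * D * \1_(C k) x)) `^ p) * w x)).
  rewrite ler_wpM2r//.
  apply: le_trans (@powR_sum_le R p (fun k => d%:R * k%:R * D * \1_(C k) x) M p1 _); last first.
    by move=> k; rewrite indicE !mulr_ge0.
  apply: ge0_ler_powR; rewrite ?nnegrE ?(ltW p0)//; first exact: sqrtr_ge0.
  by apply: sumr_ge0 => k _; rewrite indicE !mulr_ge0.
rewrite mulr_suml; apply: ler_sum => k _; rewrite indicE mulrA.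
case: (x \in C k); first by rewrite mulr1 mul1r.
by rewrite mulr0 powR0 ?gt_eqF// !mul0r mulr0.
Qed.

Lemma staircase_energy : (\int[mu]_x (G x `^ p * w x)%:E < +oo)%E.
Proof.
have mE : measurable_fun [set: T] ((fun x => G x `^ p * w x) : T -> measurableTypeR R).
  by apply: measurable_funM; [exact: (measurableT_comp (measurable_powR _) mG)|exact: mw].
have c0 k : 0 <= weight_cost k by exact: powR_ge0.
apply: (@integral_geometric_bound R _ T mu (fun k x => weight_cost k * (\1_(C k) x * w x)) (fun x => G x `^ p * w x)).
- move=> k; apply: measurable_funM; first exact: measurable_cst.
  by apply: measurable_funM; [apply: measurable_indic; exact: mC|exact: mw].
- by move=> k x; rewrite indicE !mulr_ge0.
- move=> k; rewrite (@integral_scaled_indic R _ T mu (C k) w (weight_cost k) (mC k) (c0 k) mw w0).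
  rewrite [X in (_ * X)%E](wmeas_cube hw (Cube (a k - const_mx 1) (ltr0n R 3))) -EFinM lee_fin /=.
  apply: (@le_trans _ _ (weight_cost k * (D3 * wmass w (a k) 1))); first by rewrite ler_wpM2l.
  have := ltW (light k); rewrite ler_pdivlMr ?mulr_gt0 ?ltr_wpDl//; apply: le_trans.
  have W0 : 0 <= wmass w (a k) 1 by rewrite ltW// (wmass_gt0 hw).
  rewrite [leRHS](_ : _ = weight_cost k * (D3 * wmass w (a k) 1) + D3 * wmass w (a k) 1); last by ring.
  by rewrite lerDl mulr_ge0// ltW.
- exact: mE.
- by move=> x; rewrite mulr_ge0 ?powR_ge0.
- exact: energy_bound.
Qed.

Lemma staircase_sobolev : homogeneous_sobolev p w (EFin \o u).
Proof.
have cu := continuous_staircase far.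
split.
- split; first by apply/measurable_EFinP; exact: mu_.
  move=> K cK; have [M M0 HM] := compact_coord_bounded cK.
  have [S S0 HS] := continuous_bounded_box (const_mx (- M)) (const_mx M) cu.
  have [_ [_ /(_ K cK) wK] _ _] := hw.
  have wK' : (\int[mu]_(x in K) (w x)%:E < +oo)%E.
    apply: le_lt_trans wK; apply: le_of_eq.
    by apply: eq_integral => x _; rewrite ger0_norm.
  have mv : measurable_fun [set: T] ((fun x => `|u x| `^ p) : T -> measurableTypeR R).
    by apply: (measurableT_comp (measurable_powR _)); exact: measurableT_comp.
  have v0 x : 0 <= `|u x| `^ p by exact: powR_ge0.
  have := @integral_bounded_mul R _ T mu K (fun x => `|u x| `^ p) w (S `^ p) (measurable_compact cK) mv mw w0 v0
    (powR_ge0 _ _) _ wK'.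
  move=> H; apply: le_lt_trans (H _).
    by apply: le_of_eq; apply: eq_integral => x _; rewrite /= -EFinM.
  move=> x Kx; apply: ge0_ler_powR; rewrite ?nnegrE ?(ltW p0)//.
  by apply: HS => j; rewrite !mxE -ler_norml; exact: HM.
- exact: continuous_lebesgue_representative.
- exists (fun i => partial i u); last exact: staircase_energy.
  apply: weak_gradient_C1 => //; first exact: derivable_staircase.
  exact: continuous_partial_staircase.
Qed.

Lemma staircase_no_limit (c : R) : ~ ((fun k => wavg w (EFin \o u) (cube_set (Cube (a k) (@ltr01 R)))) @ \oo --> c%:E).
Proof.
move=> H.
have h0 := plateau_height_gt0 R d.
have ge (k : nat) : ((k%:R * plateau_height R d)%:E <= wavg w (EFin \o u) (cube_set (Cube (a k) (@ltr01 R))))%E.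
  rewrite (@wavg_cube R d p w hw (EFin \o u)); last 2 first.
  - by apply/measurable_EFinP; exact: mu_.
  - by apply: aeW.
  rewrite /= inver gt_eqF ?(wmass_gt0 hw)//.
  have W0 := wmass_gt0 hw (a k) (ltr01 : 0 < 1 :> R).
  rewrite lee_pdivlMr// -EFinM.
  apply: (@integral_ge_scaled R _ T mu (qbox (a k) 1) u w _ _ (measurable_qbox _ _) mu_ mw w0).
  - by rewrite mulr_ge0// ltW.
  - by move=> x; exact: staircase_ge.
  - exact: (wmassE hw).
pose k0 := (Num.truncn ((`|c| + 1) / plateau_height R d)).+1.
have : ((`|c| + 1)%:E <= c%:E)%E.
  rewrite -(cvg_lim (@ereal_hausdorff R) H); apply: lime_ge; first by apply/cvg_ex; exists c%:E.
  exists k0 => // k /= k0k; apply: le_trans (ge k); rewrite lee_fin -ler_pdivrMr//.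
  by apply: (le_trans (ltW (truncnS_gt _))); rewrite ler_nat.
by rewrite lee_fin; have := ler_norm c; lra.
Qed.

Lemma light_cubes_to_infty : cubes_to_infty (fun k => Cube (a k) (@ltr01 R)).
Proof.
move=> r r0; exists (Num.truncn (r + 1)).+1 => k rk; apply/seteqP; split=> // x [xr xQ].
have [j aj] := far k; have := xQ j => /= /andP[h1 h2].
have : `|x ord0 j| < r.
  by apply: (le_lt_trans (coord_le_enorm x j)); move: xr; rewrite /eball /= subr0.
have kr : r + 1 < k%:R by apply: (lt_le_trans (truncnS_gt _)); rewrite ler_nat.
by rewrite ltr_norml => /andP[n1 n2]; move: aj; rewrite lter_normr => /orP[]; lra.
Qed.

End sequence.
End converse.

(** If the infimum were 0, there would be light unit cubes arbitrarily far away; the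
    sum of bumps of height [k] on a sequence of such cubes has finite energy, but
    its averages over them tend to infinity. *)
Theorem limit_inf_wmeas (R : realType) (d : nat) (p : R) (w : 'rV[R]_d -> R) : 1 <= p -> muckenhoupt p w ->
  (forall u : 'rV[R]_d -> \bar R, homogeneous_sobolev p w u ->
     exists c : R, forall Q : nat -> cube R d,
       (0 < limn_einf (fun i => (edge (Q i))%:E))%E -> cubes_to_infty Q ->
       (fun i => wavg w u (cube_set (Q i))) @ \oo --> c%:E) ->
  (0 < ereal_inf [set wmeas w (cube_set Q) | Q in [set Q : cube R d | (edge Q = 1)%R]])%E.
Proof.
move=> p1 hw H; apply: contrapT => inf0.
have small m : 0 < m -> exists a, wmass w a 1 < m.
  move=> m0; apply: contrapT => /forallNP Hm; apply: inf0.
  apply: (@lt_le_trans _ _ m%:E); first by rewrite lte_fin.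
  apply: le_ereal_inf_tmp => _ [Q Q1 <-]; rewrite (wmeas_cube hw) Q1 lee_fin leNgt.
  by apply/negP; exact: Hm.
have [D D0 HD] := partial_plateau_bound R d.
have [D3 D30 HD3] := wmass_triple p1 hw.
have e0 k : 0 < 2^-1 ^+ k / (D3 * (weight_cost d p D k + 1)).
  by rewrite divr_gt0// ?exprn_gt0 ?invr_gt0// mulr_gt0// ltr_wpDl// powR_ge0.
have [a [far light]] := light_sequence p1 hw small e0.
have [c Hc] := H _ (staircase_sobolev p1 hw D0 HD D30 HD3 far light).
have edge1 : (0 < limn_einf (fun k => (edge (Cube (a k) (@ltr01 R)))%:E))%E.
  by rewrite (cvg_limn_einf_sup (cvg_cst (1%:E : \bar R))).1 lte_fin.
have infty := light_cubes_to_infty far.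
exact: (staircase_no_limit hw far (Hc _ edge1 infty)).
Qed.

Theorem theorem1p11 (R : realType) (d : nat) (p : R) (w : 'rV[R]_d -> R)
    (hd : (2 <= d)%N) (hp1 : 1 <= p) (hpd : p < d%:R) (hw : muckenhoupt p w) :
  (0 < ereal_inf [set wmeas w (cube_set Q) | Q in [set Q : cube R d | (edge Q = 1)%R]])%E
  <->
  (forall u : 'rV[R]_d -> \bar R, homogeneous_sobolev p w u ->
     exists! c : R, forall Q : nat -> cube R d,
       (0 < limn_einf (fun i => (edge (Q i))%:E))%E ->
       cubes_to_infty Q ->
       (fun i => wavg w u (cube_set (Q i))) @ \oo --> c%:E).
Proof.
split=> [inf_gt0 u hu|limits]; first exact: (inf_wmeas_limit hp1 hpd hw inf_gt0 hu).
apply: (limit_inf_wmeas hp1 hw) => u hu; have [c [Hc _]] := limits u hu.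
by exists c.
Qed.
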